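(* Suppose that $F:D(A^\alpha)\to H$ satisfies $F(0)=0$ and $\|F(u_1)-F(u_2)\|\le L\|A^\alpha(u_1-u_2)\|$ for all $u_1,u_2\in D(A^\alpha)$ with a constant $L>0$, that $g\in L^2_{loc}(\mathbb{R},D(A^\alpha))$ satisfies $\int_{-\infty}^0 e^{\lambda_1 s}\|A^\alpha g(s)\|\,ds<\infty$, and that there are $n\in\mathbb{N}$ and $k\in(0,\tfrac12)$ such that $$\lambda_{n+1}-\lambda_n\ \ge\ \frac{2L}{k}\left(\lambda_{n+1}^\alpha+\lambda_n^\alpha+c_\alpha(\lambda_{n+1}-\lambda_n)^\alpha\right).$$ Put $\mu=\lambda_n+\frac{2L}{k}\lambda_n^\alpha$. Then the cocycle $\Phi$ on $D(A^\alpha)$ generated by the stochastic equation $\frac{du}{dt}+Au=F(u)+g(t)+\frac{dW}{dt}$ has a random inertial manifold $\widetilde{\mathcal M}=\{\widetilde{\mathcal M}(\tau,\omega):\tau\in\mathbb{R},\omega\in\Omega\}$, which is given, for each $\tau\in\mathbb{R}$ and $\omega\in\Omega$, by $$\widetilde{\mathcal M}(\tau,\omega)=\{x+z(\omega)+m(\tau,\omega)(x):x\in P_nH\}=\mathcal M(\tau,\omega)+z(\omega).$$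
   Context: Setting. $H$ is a separable Hilbert space with norm $\|\cdot\|$, and $A:D(A)\subseteq H\to H$ is a symmetric positive operator with compact inverse; $\{e_j\}_{j\ge1}$ is an orthonormal basis of $H$ with $Ae_j=\lambda_je_j$, $0<\lambda_1\le\lambda_2\le\cdots$, $\lambda_j\to\infty$. Fix $\alpha\in[0,\tfrac12)$; $D(A^\alpha)$ carries the norm $\|u\|_{D(A^\alpha)}=\|A^\alpha u\|$. $P_n$ is the orthogonal projection of $H$ onto $\mathrm{span}\{e_1,\dots,e_n\}$ and $Q_n=I-P_n$; $e^{-At}$ is defined on $P_nH$ for all $t\in\mathbb{R}$. $c_\alpha=\alpha^\alpha\int_0^\infty s^{-\alpha}e^{-s}ds$ if $\alpha>0$ and $c_\alpha=0$ if $\alpha=0$. $g^\tau(s)=g(s+\tau)$. Noise. $\Omega=\{\omega\in C(\mathbb{R},H):\omega(0)=0\}$ with the compact-open topology, $\mathcal F$ its Borel $\sigma$-algebra, $P$ the Wiener measure of a two-sided $H$-valued Wiener process $W$ with trace class covariance $Q$, and $\theta_t\omega(\cdot)=\omega(\cdot+t)-\omega(t)$. $z:\Omega\to D(A^\alpha)$ is the unique stationary solution of $dz(\theta_t\omega)+Az(\theta_t\omega)\,dt=dW$, taken in a version for which, for every $\omega$, $t\mapsto z(\theta_t\omega)$ is continuous from $\mathbb{R}$ to $D(A^\alpha)$ and $\lim_{t\to-\infty}e^{ct}\|A^\alpha z(\theta_t\omega)\|=0$ for every $c>0$. Solutions and cocycles. For a forcing $h\in L^2_{loc}(\mathbb{R},D(A^\alpha))$,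 $r\in\mathbb{R}$, $v_r\in D(A^\alpha)$, let $v(t)=v(t,r,\omega,h,v_r)$, $t\ge r$, be the unique mild solution in $C([r,\infty),D(A^\alpha))$ of $\frac{dv}{dt}+Av=F(v+z(\theta_t\omega))+h(t)$, $v(r)=v_r$, i.e. $v(t)=e^{-A(t-r)}v_r+\int_r^te^{-A(t-s)}(F(v(s)+z(\theta_s\omega))+h(s))\,ds$. Set $\Psi(t,\tau,\omega,v_0)=v(t,0,\omega,g^\tau,v_0)$ for $t\ge0$. With $u(t,\tau,\omega,g,u_\tau)=v(t,\tau,\omega,g,u_\tau-z(\theta_\tau\omega))+z(\theta_t\omega)$ (a mild solution of the stochastic equation), set $\Phi(t,\tau,\omega,u_0)=u(t+\tau,\tau,\theta_{-\tau}\omega,g,u_0)$; equivalently $\Phi(t,\tau,\omega,u_0)=\Psi(t,\tau,\omega,u_0-z(\omega))+z(\theta_t\omega)$. Both are continuous cocycles on $D(A^\alpha)$ over $(\Omega,\mathcal F,P,\{\theta_t\})$. The sets $\mathcal M(\tau,\omega)$ and maps $m(\tau,\omega)$. Let $\mathcal S=\{\xi\in C((-\infty,0],D(A^\alpha)):\|\xi\|_{\mathcal S}=\sup_{t\le0}e^{\mu t}\|A^\alpha\xi(t)\|<\infty\}$ and $\mathcal M(\tau,\omega)=\{\xi(0):\xi\in\mathcal S,\ v(t,r,\omega,g^\tau,\xi(r))=\xi(t)\text{ for all }r\le t\le0\}$. For $x\in P_nH$ let $\xi^*(x,\omega,\tau)$ be the unique $\xi\in\mathcal S$ with $$\xi(t)=e^{-At}x-\int_t^0e^{-A(t-s)}P_n(F(\xi(s)+z(\theta_s\omega))+g(s+\tau))ds+\int_{-\infty}^te^{-A(t-s)}Q_n(F(\xi(s)+z(\theta_s\omega))+g(s+\tau))ds,\quad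 t\le0,$$ and $m(\tau,\omega):P_nH\to Q_nD(A^\alpha)$, $m(\tau,\omega)(x)=Q_n\xi^*(x,\omega,\tau)(0)$. One has $\mathcal M(\tau,\omega)=\{x+m(\tau,\omega)(x):x\in P_nH\}$. Definition (random inertial manifold). Let $\Phi$ be a cocycle on a separable Banach space $X$ (here $X=D(A^\alpha)$). A family $\mathcal N=\{\mathcal N(\tau,\omega)\}$ of subsets of $X$, measurable in $\omega$ for each fixed $\tau$ (in the usual sense of closed random sets), is a random inertial manifold of $\Phi$ if: (i) there is a finite-dimensional subspace $X_1$ with $X=X_1\oplus X_2$ and a mapping $q:\mathbb{R}\times\Omega\times X_1\to X_2$ with $\mathcal N(\tau,\omega)=\{x+q(\tau,\omega)(x):x\in X_1\}$ for all $\tau,\omega$, where $q(\tau,\omega)(x)$ is measurable in $\omega$ and Lipschitz continuous in $x$; (ii) $\Phi(t,\tau,\omega,\mathcal N(\tau,\omega))=\mathcal N(\tau+t,\theta_t\omega)$ for all $t\ge0$, $\tau$, $\omega$; (iii) for all $\tau,\omega$ and $x\in X$ there is $y=y(\tau,\omega,x)\in\mathcal N(\tau,\omega)$ such that $\|\Phi(t,\tau,\omega,x)-\Phi(t,\tau,\omega,y)\|_X\le c_1e^{-c_2t}$ for all $t\ge0$, with positive numbers $c_1,c_2$ depending on $\tau,\omega,x$. *)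

(* Defs.v *)
From HB Require Import structures.
From mathcomp Require Import all_boot all_order all_algebra.
From mathcomp Require Import all_classical all_reals all_analysis.
From mathcomp Require Import measurable_realfun.

Set Implicit Arguments.
Unset Strict Implicit.
Unset Printing Implicit Defensive.

Import Order.TTheory GRing.Theory Num.Theory.
Import numFieldNormedType.Exports.

Local Open Scope classical_set_scope.
Local Open Scope ring_scope.

HB.mixin Record CompleteNormedModule_isHilbert (R : realType) H
    & CompleteNormedModule R H := {
  inner : {dot H for (@idfun R)} ;
  inner_normE : forall u : H, inner u u = `|u| ^+ 2
}.

#[short(type="hilbertType")]
HB.structure Definition Hilbert (R : realType) :=
  {H of CompleteNormedModule R H & CompleteNormedModule_isHilbert R H}.

Definition orthonormal_basis (R : realType) (H : hilbertType R)
    (e : nat -> H) : Prop :=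
  (forall i j, inner (e i) (e j) = (i == j)%:R) /\
  (forall u : H, series (fun j => inner u (e j) *: e j) @ \oo --> u).

Section inner_product.
Context {R : realType} {H : hilbertType R}.
Implicit Types u v w : H.

Lemma innerC u v : inner u v = inner v u.
Proof. by rewrite hermC expr0 mul1r. Qed.

Lemma innerDl u v w : inner (u + v) w = inner u w + inner v w.
Proof. by rewrite linearDl. Qed.

Lemma innerZl a u w : inner (a *: u) w = a * inner u w.
Proof. by rewrite linearZl_LR. Qed.

Lemma innerNl u w : inner (- u) w = - inner u w.
Proof. by rewrite -scaleN1r innerZl mulN1r. Qed.

Lemma innerBl u v w : inner (u - v) w = inner u w - inner v w.
Proof. by rewrite innerDl innerNl. Qed.

Lemma inner0l u : inner 0 u = 0.
Proof. by rewrite linear0l. Qed.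

Lemma inner_suml (I : Type) (r : seq I) (p : pred I) (f : I -> H) w :
  inner (\sum_(i <- r | p i) f i) w = \sum_(i <- r | p i) inner (f i) w.
Proof.
apply: (big_morph (fun u => inner u w)) => [u v|]; first exact: innerDl.
exact: inner0l.
Qed.

Lemma inner_sumr (I : Type) (r : seq I) (p : pred I) (f : I -> H) w :
  inner w (\sum_(i <- r | p i) f i) = \sum_(i <- r | p i) inner w (f i).
Proof. by rewrite innerC inner_suml; apply: eq_bigr => i _; rewrite innerC. Qed.

Lemma inner_CauchySchwarz u v : `|inner u v| <= `|u| * `|v|.
Proof.
have [->|v0] := eqVneq v 0.
  by rewrite innerC inner0l !normr0 mulr0.
have vv0 : 0 < `|v| ^+ 2 by rewrite exprn_gt0 ?normr_gt0.
pose t := inner u v / `|v| ^+ 2.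
have : 0 <= inner (u - t *: v) (u - t *: v) by rewrite inner_normE sqr_ge0.
rewrite innerBl innerZl.
rewrite [inner u (_ - _)]innerC [inner v (_ - _)]innerC !innerBl !innerZl.
rewrite !inner_normE [inner v u]innerC.
have -> : t * (inner u v - t * `|v| ^+ 2) = 0.
  by rewrite /t divfK ?gt_eqF// subrr mulr0.
rewrite subr0 subr_ge0 /t mulrAC ler_pdivrMr// -expr2 -exprMn.
by rewrite -[in X in X -> _](real_normK (num_real _)) ler_pXn2r// nnegrE ?mulr_ge0.
Qed.

Lemma cvg_innerl (f : nat -> H) u w :
  f @ \oo --> u -> (fun n => inner (f n) w) @ \oo --> inner u w.
Proof.
move=> fu; apply/cvgrPdist_le => /= eps eps0.
have w0 : 0 < `|w| + 1 by rewrite ltr_wpDl.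
move/cvgrPdist_le : fu => /(_ (eps / (`|w| + 1))).
rewrite divr_gt0// => /(_ isT); apply: filterS => n ufn.
rewrite -innerBl (le_trans (inner_CauchySchwarz _ _))//.
rewrite (le_trans (ler_wpM2r _ ufn))// mulrAC ler_pdivrMr//.
by rewrite ler_wpM2l ?lerDl// ltW.
Qed.

End inner_product.

Section orthonormal_series.
Context {R : realType} {H : hilbertType R} (e : nat -> H).
Hypothesis eB : orthonormal_basis e.
Implicit Types (c d : nat -> R).

Lemma norm_orthonormal_sum c m n :
  `|\sum_(m <= j < n) c j *: e j| ^+ 2 = \sum_(m <= j < n) c j ^+ 2.
Proof.
rewrite -inner_normE inner_suml; apply: eq_big_nat => i imn.
rewrite innerZl inner_sumr (bigD1_seq i)/= ?mem_index_iota ?iota_uniq//.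
rewrite [inner (e i) _]innerC innerZl eB.1 eqxx mulr1 big1 ?addr0// => j ji.
by rewrite innerC innerZl eB.1 (negPf ji) mulr0.
Qed.

Lemma inner_orthonormal_series c u i :
  series (fun j => c j *: e j) @ \oo --> u -> inner u (e i) = c i.
Proof.
move=> cu; have cui := cvg_innerl (w := e i) cu.
suff : (fun n => inner (series (fun j => c j *: e j) n) (e i)) @ \oo --> c i.
  by move=> ci; exact: (cvg_unique _ cui ci).
apply: cvg_near_cst; exists i.+1 => // n /= ni.
rewrite inner_suml (bigD1_seq i)/= ?mem_index_iota ?iota_uniq//.
rewrite innerZl eB.1 eqxx mulr1 big1 ?addr0// => j ji.
by rewrite innerZl eB.1 (negPf ji) mulr0.
Qed.

Lemma cvg_orthonormal_series_le c d (K : R) :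
  (forall j, `|d j| <= K * `|c j|) ->
  cvgn (series (fun j => c j *: e j)) -> cvgn (series (fun j => d j *: e j)).
Proof.
move=> dc cc; apply/cauchy_cvgP/cauchy_seriesP => eps eps0.
have K0 : 0 < `|K| + 1 by rewrite ltr_wpDl.
have K0' := ltW K0.
have /cauchy_cvgP/cauchy_seriesP/(_ (eps / (`|K| + 1))) := cc.
rewrite divr_gt0// => /(_ isT); apply: filterS => -[m n]/=.
rewrite ltr_pdivlMr// => ce; apply: le_lt_trans ce.
rewrite -(@ler_pXn2r _ 2)// ?nnegrE ?mulr_ge0//.
rewrite exprMn !norm_orthonormal_sum mulr_suml; apply: ler_sum => j _.
rewrite -(real_normK (num_real (d j))) -(real_normK (num_real (c j))).
rewrite -exprMn ler_pXn2r// ?nnegrE ?mulr_ge0//.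
rewrite (le_trans (dc j))// mulrC ler_wpM2l//.
by rewrite (le_trans (ler_norm K))// lerDl.
Qed.

End orthonormal_series.

(* Eigenpairs are numbered from 0: [eigval A j] and [eigvec A j] stand for
   lambda_(j+1) and e_(j+1).  The values of [A] outside [op_dom] are junk. *)
Record spectral_operator (R : realType) (H : hilbertType R) :=
  SpectralOperator {
  op_dom : set H ;
  op_fun :> H -> H ;
  op_linear : forall (a : R) u v, op_dom u -> op_dom v ->
    op_dom (a *: u + v) /\ op_fun (a *: u + v) = a *: op_fun u + op_fun v ;
  op_symmetric : forall u v, op_dom u -> op_dom v ->
    inner (op_fun u) v = inner u (op_fun v) ;
  op_positive : forall u, op_dom u -> u != 0 -> 0 < inner (op_fun u) u ;
  op_compact_inverse : exists G : H -> H,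
    [/\ forall y, op_dom (G y) /\ op_fun (G y) = y,
        forall u, op_dom u -> G (op_fun u) = u &
        precompact (G @` [set y | `|y| <= 1])] ;
  eigvec : nat -> H ;
  eigval : nat -> R ;
  eigvec_basis : orthonormal_basis eigvec ;
  eigvecP : forall j,
    op_dom (eigvec j) /\ op_fun (eigvec j) = eigval j *: eigvec j ;
  eigval0_gt0 : 0 < eigval 0%N ;
  eigval_nondecreasing : nondecreasing_seq eigval ;
  eigval_cvgy : eigval @ \oo --> +oo }.

Section fractional_power.
Context {R : realType} {H : hilbertType R} (A : spectral_operator H).

Definition fpow_series (a : R) (u : H) : nat -> H :=
  series (fun j => (eigval A j `^ a * inner u (eigvec A j)) *: eigvec A j).

Definition fpow_dom (a : R) : set H := [set u | cvgn (fpow_series a u)].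

Definition fpow_pred (a : R) : {pred H} := mem (fpow_dom a).

Definition fpow (a : R) (u : H) : H := limn (fpow_series a u).

(* exp(- A t) u; for t < 0 only meant for u in the span of finitely many
   eigenvectors, where the series is a finite sum. *)
Definition semigroup (t : R) (u : H) : H :=
  limn (series (fun j =>
    (expR (- eigval A j * t) * inner u (eigvec A j)) *: eigvec A j)).

Definition proj (n : nat) (u : H) : H :=
  \sum_(j < n) inner u (eigvec A j) *: eigvec A j.

Lemma eigval_gt0 j : 0 < eigval A j.
Proof.
exact: lt_le_trans (eigval0_gt0 A) (eigval_nondecreasing A (leq0n j)).
Qed.

Lemma fpow_series_lin a b u v :
  fpow_series a (b *: u + v) = b *: fpow_series a u + fpow_series a v.
Proof.
apply/funext => n; rewrite !fctE /fpow_series /series/= scaler_sumr.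
rewrite -big_split/=; apply: eq_bigr => j _.
rewrite innerDl innerZl scalerA -scalerDl.
by congr (_ *: _); rewrite mulrDr mulrCA.
Qed.

Lemma fpow_lin_cvg a b u v : fpow_dom a u -> fpow_dom a v ->
  fpow_series a (b *: u + v) @ \oo --> b *: fpow a u + fpow a v.
Proof.
move=> cu cv; rewrite fpow_series_lin.
by apply: cvgD; [apply: cvgZr|]; [exact: cu|exact: cv].
Qed.

Lemma fpow_dom_submod a : submod_closed (fpow_pred a).
Proof.
split=> [|b u v /set_mem uD /set_mem vD]; apply: mem_set.
  rewrite /fpow_dom/= (_ : fpow_series _ _ = cst 0); first exact: is_cvg_cst.
  apply/funext => n; rewrite /fpow_series /series/= big1// => j _.
  by rewrite inner0l mulr0 scale0r.
by apply/cvg_ex; eexists; exact: fpow_lin_cvg.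
Qed.

Lemma eigvec_fpow_dom a i : fpow_dom a (eigvec A i).
Proof.
apply/cvg_ex; exists (eigval A i `^ a *: eigvec A i).
apply: cvg_near_cst; exists i.+1 => // n /= ni.
rewrite /fpow_series /series/= (bigD1_seq i)/= ?mem_index_iota ?iota_uniq//.
rewrite (eigvec_basis A).1 eqxx mulr1 big1 ?addr0// => j ji.
by rewrite (eigvec_basis A).1 eq_sym (negPf ji) mulr0 scale0r.
Qed.

End fractional_power.

(* D(A^alpha) as a Banach space. *)
Record fracdom (R : realType) (H : hilbertType R) (A : spectral_operator H)
    (alpha : {nonneg R}) :=
  FracDom { fd_val :> H ; _ : fd_val \in fpow_pred A alpha%:num }.

Section fracdom_instances.
Context (R : realType) (H : hilbertType R) (A : spectral_operator H).
Context (alpha : {nonneg R}).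
Local Notation X := (fracdom A alpha).

HB.instance Definition _ := [isSub for @fd_val R H A alpha].
HB.instance Definition _ := [Choice of X by <:].
HB.instance Definition _ :=
  GRing.isSubmodClosed.Build R H (fpow_pred A alpha%:num) (fpow_dom_submod A alpha%:num).
HB.instance Definition _ := [SubChoice_isSubLmodule of X by <:].

Lemma fracdomP (x : X) : fpow_dom A alpha%:num x.
Proof. by apply: set_mem; exact: (valP x). Qed.

Definition fracdom_norm (x : X) : R := `|fpow A alpha%:num x|.

Lemma fracdom_fpow_lin b (x y : X) : fpow A alpha%:num (b *: x + y) =
  b *: fpow A alpha%:num x + fpow A alpha%:num y.
Proof. by apply: cvg_lim => //; apply: fpow_lin_cvg; exact: fracdomP. Qed.

Lemma fracdom_fpow0 : fpow A alpha%:num (0 : X) = 0.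
Proof.
have := fracdom_fpow_lin (-1) 0 0.
by rewrite !scaleN1r oppr0 addr0 addNr.
Qed.

Lemma fracdom_normD (x y : X) :
  fracdom_norm (x + y) <= fracdom_norm x + fracdom_norm y.
Proof.
rewrite /fracdom_norm -[x in x + y]scale1r fracdom_fpow_lin scale1r.
exact: ler_normD.
Qed.

Lemma fracdom_normZ (b : R) (x : X) :
  fracdom_norm (b *: x) = `|b| * fracdom_norm x.
Proof.
rewrite /fracdom_norm -[b *: x]addr0 fracdom_fpow_lin.
by rewrite fracdom_fpow0 addr0 normrZ.
Qed.

Lemma fracdom_norm0_eq0 (x : X) : fracdom_norm x = 0 -> x = 0.
Proof.
move/normr0_eq0 => x0; apply: val_inj; rewrite [RHS]/=.
have x0c : fpow_series A alpha%:num x @ \oo --> (0 : H).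
  by rewrite -x0; exact: fracdomP.
have xE j : inner (\val x) (eigvec A j) = 0.
  have := inner_orthonormal_series (eigvec_basis A) j x0c.
  rewrite inner0l => /esym/eqP.
  by rewrite mulf_eq0 gt_eqF ?powR_gt0 ?eigval_gt0//= => /eqP.
have := (eigvec_basis A).2 (\val x).
rewrite (_ : series _ = cst 0); last first.
  apply/funext => n; rewrite /series/= big1// => j _.
  by rewrite xE scale0r.
by move/(cvg_lim (@norm_hausdorff _ _)) => <-; rewrite lim_cst.
Qed.

HB.instance Definition _ := Lmodule_isNormed.Build R X
  fracdom_normD fracdom_normZ fracdom_norm0_eq0.

Lemma fracdom_normE (x : X) : `|x| = `|fpow A alpha%:num x|.
Proof. by []. Qed.

Lemma fracdom_fpow_surj (y : H) : exists x : X, fpow A alpha%:num x = y.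
Proof.
pose c j := inner y (eigvec A j).
pose d j := eigval A j `^ (- alpha%:num) * c j.
have cy : series (fun j => c j *: eigvec A j) @ \oo --> y.
  exact: (eigvec_basis A).2.
have /cvg_ex[x dx] : cvgn (series (fun j => d j *: eigvec A j)).
  apply: (cvg_orthonormal_series_le (eigvec_basis A)
    (K := eigval A 0%N `^ (- alpha%:num)) _ (cvgP _ cy)) => j.
  rewrite /d normrM ler_wpM2r// ger0_norm ?powR_ge0// !powRN.
  rewrite lef_pV2 ?posrE ?powR_gt0 ?eigval_gt0//.
  apply: ge0_ler_powR; rewrite // ?nnegrE; [| |exact: eigval_nondecreasing].
    exact/ltW/eigval_gt0.
  exact/ltW/eigval_gt0.
have sx : fpow_series A alpha%:num x = series (fun j => c j *: eigvec A j).
  congr series; apply/funext => j; congr (_ *: _).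
  rewrite (inner_orthonormal_series (eigvec_basis A) j dx) /d mulrA.
  by rewrite powRN divff ?mul1r// gt_eqF ?powR_gt0 ?eigval_gt0.
have xD : x \in fpow_pred A alpha%:num.
  by apply: mem_set; rewrite /fpow_dom/= sx; exact: cvgP cy.
exists (FracDom xD); rewrite /fpow/= sx; exact: cvg_lim cy.
Qed.

Lemma fracdom_complete (F : set_system X) :
  ProperFilter F -> cauchy F -> cvg F.
Proof.
move=> FF /cauchy_ballP F_cauchy.
have fpowB (x y : X) :
    `|x - y| = `|fpow A alpha%:num x - fpow A alpha%:num y|.
  by rewrite fracdom_normE addrC -scaleN1r fracdom_fpow_lin scaleN1r addrC.
pose B (x : X) := fpow A alpha%:num x.
have /cauchy_cvg : cauchy (B @ F).
  apply/cauchy_ballP => eps eps0; case: (F_cauchy _ eps0) => -[P Q]/= [FP FQ] PQ.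
  exists (B @` P, B @` Q) => /=.
    by split; rewrite /nbhs/=; [apply: filterS FP|apply: filterS FQ] => x Px;
      exists x.
  move=> [_ _]/= [[x Px <-] [y Qy <-]].
  have := PQ (x, y) (conj Px Qy).
  by rewrite -!ball_normE/= fpowB.
move=> /cvg_ex[y By]; have [x xy] := fracdom_fpow_surj y.
apply/cvg_ex; exists x; apply/cvgrPdist_lt => /= eps eps0.
move/cvgrPdist_lt : By => /(_ _ eps0); apply: filterS => t.
by rewrite fpowB xy.
Qed.

HB.instance Definition _ := Uniform_isComplete.Build X fracdom_complete.

End fracdom_instances.

Definition borel_measurable d (T : measurableType d) (V : ptopologicalType)
    (D : set T) (f : T -> V) : Prop :=
  measurable_fun D (f : T -> g_sigma_algebraType (@open V)).

Section bochner.
Context d (T : measurableType d) (R : realType) (H : hilbertType R).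
Context (mu : {measure set T -> \bar R}).

Definition bochner_integrable (D : set T) (f : T -> H) : Prop :=
  borel_measurable D f /\ mu.-integrable D (fun s => `|f s|%:E).

(* The integral of an integrable f is the unique I with
   <I, y> = \int <f, y> for all y (Riesz); it is 0 if f is not integrable. *)
Definition bochner_integral (D : set T) (f : T -> H) : H :=
  xget 0 [set I | bochner_integrable D f /\
    forall y, inner I y = (\int[mu]_(s in D) inner (f s) y)%R].

End bochner.

(* {omega in C(R, H) | omega(0) = 0} *)
Record path_space (R : realType) (H : hilbertType R) := PathSpace {
  path_fun :> R -> H ;
  path_continuous : continuous path_fun ;
  path0 : path_fun 0 = 0 }.

Section path_space_instances.
Context {R : realType} {H : hilbertType R}.
Implicit Types w : path_space H.

HB.instance Definition _ := gen_eqMixin (path_space H).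
HB.instance Definition _ := gen_choiceMixin (path_space H).
Lemma cst0_continuous : continuous (fun _ : R => 0 : H).
Proof. by move=> s; exact: cvg_cst. Qed.

HB.instance Definition _ :=
  isPointed.Build (path_space H) (PathSpace cst0_continuous erefl).
HB.instance Definition _ := Topological.copy (path_space H)
  (initial_topology (@path_fun R H : path_space H -> {compact-open, R -> H})).
HB.instance Definition _ := Measurable.copy (path_space H)
  (g_sigma_algebraType (@open (path_space H))).

Lemma shift_continuous (t : R) w : continuous (fun s => w (s + t) - w t).
Proof.
move=> s; apply: cvgB; last exact: cvg_cst.
apply: (@continuous_comp _ _ _ (fun s => s + t) w); last exact: path_continuous.
by apply: cvgD; [exact: cvg_id|exact: cvg_cst].
Qed.

Lemma shift0 (t : R) w : w (0 + t) - w t = 0.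
Proof. by rewrite add0r subrr. Qed.

Definition theta (t : R) w : path_space H :=
  PathSpace (@shift_continuous t w) (shift0 t w).

End path_space_instances.

Section wiener.
Context {R : realType} {H : hilbertType R}.

Definition trace_class_covariance (Q : {linear H -> H}) : Prop :=
  [/\ forall u v, inner (Q u) v = inner u (Q v),
      forall u, 0 <= inner (Q u) u &
      exists2 e : nat -> H, orthonormal_basis e &
        cvgn (series (fun j => inner (Q (e j)) (e j)))].

(* N(0, var); normal_prob is not meaningful for a zero standard deviation *)
Definition centered_gaussian (var : R) (B : set R) : \bar R :=
  if var == 0 then \d_(0 : R) B else normal_prob 0 (Num.sqrt var) B.

(* The canonical process W(t)(w) = w t is a two-sided Q-Wiener process. *)
Definition wiener_measure (P : probability (path_space H) R)
    (Q : {linear H -> H}) : Prop :=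
  (forall (m : nat) (t : nat -> R) (B : nat -> set H),
     nondecreasing_seq t -> (forall i, <<s @open H >> (B i)) ->
     fine (P (\bigcap_(i in `I_m) [set w | B i (w (t i.+1) - w (t i))])) =
     \prod_(i < m) fine (P [set w | B i (w (t i.+1) - w (t i))])) /\
  (forall (s t : R) (y : H) (B : set R), s <= t -> measurable B ->
     P [set w | B (inner (w t - w s) y)] =
     centered_gaussian ((t - s) * inner (Q y) y) B).

End wiener.

Definition c_alpha (R : realType) (a : R) : R :=
  if a == 0 then 0 else
  a `^ a *
  (\int[@lebesgue_measure R]_(s in `]0%R, +oo[) (s `^ (- a) * expR (- s)))%R.

Section dynamics.
Context {R : realType} {H : hilbertType R} (A : spectral_operator H).
Context {alpha : {nonneg R}}.
Local Notation X := (fracdom A alpha).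
Local Notation leb := (@lebesgue_measure R).

Lemma proj_fracdom n (u : H) : proj A n u \in fpow_pred A alpha%:num.
Proof.
rewrite /proj rpred_sum// => j _; rewrite rpredZ//.
by apply: mem_set; exact: eigvec_fpow_dom.
Qed.

Definition PnX (n : nat) (x : X) : X := FracDom (proj_fracdom n x).

Definition QnX (n : nat) (x : X) : X := x - PnX n x.

Definition PnH (n : nat) : set X := [set x | range (proj A n) x].

Definition L2loc (h : R -> X) : Prop := borel_measurable setT h /\
  forall a b : R, (\int[leb]_(s in `[a, b]) (`|h s| ^+ 2)%:E < +oo)%E.

(* z is the stationary solution of dz + A z dt = dW, in the weak form
   of the equation: tested against y in D(A). *)
Definition stationary_OU (P : probability (path_space H) R)
    (z : path_space H -> X) : Prop :=
  borel_measurable setT z /\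
  {ae P, forall w, forall (s t : R) (y : H), s <= t -> op_dom A y ->
    inner (z (theta t w) : H) y - inner (z (theta s w) : H) y
    + (\int[leb]_(r in `[s, t]) inner (z (theta r w) : H) (A y))%R =
    inner (w t - w s) y}.

Definition tempered_continuous (z : path_space H -> X) : Prop :=
  forall w, continuous (fun t => z (theta t w)) /\
    forall c : R, 0 < c ->
      (expR (c * t) * `|z (theta t w)|) @[t --> -oo] --> 0.

Variables (F : X -> H) (z : path_space H -> X).

Definition mild_solution (r : R) (w : path_space H) (h : R -> X) (vr : X)
    (v : R -> X) : Prop :=
  {within `[r, +oo[, continuous v} /\
  forall t, r <= t -> (v t : H) = semigroup A (t - r) vr +
    bochner_integral leb `[r, t]
      (fun s => semigroup A (t - s) (F (v s + z (theta s w)) + (h s : H))).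

(* the mild solution at time t; only meaningful for r <= t *)
Definition vsol (t r : R) (w : path_space H) (h : R -> X) (vr : X) : X :=
  xget (cst 0) [set v | mild_solution r w h vr v] t.

Variable g : R -> X.

Definition gshift (tau : R) : R -> X := fun s => g (s + tau).

Definition usol (t tau : R) (w : path_space H) (u0 : X) : X :=
  vsol t tau w g (u0 - z (theta tau w)) + z (theta t w).

Definition Phi (t tau : R) (w : path_space H) (u0 : X) : X :=
  usol (t + tau) tau (theta (- tau) w) u0.

Variable mu : R.

Definition Sspace : set (R -> X) :=
  [set xi : R -> X | {within `]-oo, (0 : R)], continuous xi} /\
    exists C : R, forall t, t <= 0 -> expR (mu * t) * `|xi t| <= C].

Definition Mset (tau : R) (w : path_space H) : set X :=
  [set xi 0 | xi in [set xi : R -> X | Sspace xi /\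
    forall r t, r <= t -> t <= 0 -> vsol t r w (gshift tau) (xi r) = xi t]].

Variable n : nat.

Definition lyapunov_perron (tau : R) (w : path_space H) (x : X)
    (xi : R -> X) : Prop :=
  Sspace xi /\
  forall t, t <= 0 -> (xi t : H) = semigroup A t x
    - bochner_integral leb `[t, 0%R] (fun s => semigroup A (t - s)
        (proj A n (F (xi s + z (theta s w)) + (g (s + tau) : H))))
    + bochner_integral leb `]-oo, t] (fun s => semigroup A (t - s)
        (let u := F (xi s + z (theta s w)) + (g (s + tau) : H) in
         u - proj A n u)).

Definition xistar (x : X) (w : path_space H) (tau : R) : R -> X :=
  xget (cst 0) [set xi | lyapunov_perron tau w x xi].

Definition mmap (tau : R) (w : path_space H) (x : X) : X :=
  QnX n (xistar x w tau 0).

End dynamics.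

Definition is_subspace (R : realType) (V : lmodType R) (E : set V) : Prop :=
  E 0 /\ forall (a : R) u v, E u -> E v -> E (a *: u + v).

Definition finite_dim_subspace (R : realType) (V : lmodType R)
    (E : set V) : Prop :=
  exists (m : nat) (b : 'I_m -> V),
    E = range (fun c : 'I_m -> R => \sum_(i < m) c i *: b i).

(* X = E1 (+) E2, as a topological direct sum *)
Definition direct_sum (R : realType) (V : normedModType R)
    (E1 E2 : set V) : Prop :=
  [/\ is_subspace E1 /\ is_subspace E2, closed E1 /\ closed E2,
      E1 `&` E2 = [set 0] &
      forall x, exists x1 x2, [/\ E1 x1, E2 x2 & x = x1 + x2]].

Definition random_closed_set d (T : measurableType d) (R : realType)
    (V : normedModType R) (N : T -> set V) : Prop :=
  (forall w, closed (N w) /\ N w !=set0) /\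
  forall x, measurable_fun [set: T] (fun w => edist_inf (N w) x).

Record random_inertial_manifold d (T : measurableType d) (R : realType)
    (V : completeNormedModType R) (theta : R -> T -> T)
    (Phi : R -> R -> T -> V -> V) (N : R -> T -> set V) : Prop := {
  rim_measurable : forall tau, random_closed_set (N tau) ;
  rim_graph : exists (E1 E2 : set V) (q : R -> T -> V -> V),
    [/\ finite_dim_subspace E1 /\ direct_sum E1 E2,
        forall tau w x, E1 x -> E2 (q tau w x),
        forall tau w, N tau w = [set x + q tau w x | x in E1],
        forall tau x, E1 x -> borel_measurable setT (fun w => q tau w x) &
        forall tau w, exists k : R, k.-lipschitz_E1 (q tau w)] ;
  rim_invariant : forall t tau w, 0 <= t ->
    Phi t tau w @` N tau w = N (tau + t) (theta t w) ;
  rim_attracting : forall tau w x, exists2 y, N tau w y &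
    exists c1 c2 : R, [/\ 0 < c1, 0 < c2 & forall t, 0 <= t ->
      `|Phi t tau w x - Phi t tau w y| <= c1 * expR (- c2 * t)] }.

(* Main.v *)
(* In the basis of eigenvectors the mild equation becomes, mode by mode, a scalar
   variation of constants formula.  Solutions on the past, solutions on the
   future, and the distance of a solution to the manifold are then all fixpoints
   of a convolution with a family of kernels [K j], where the modes [j < n] may be
   solved backward in time.  In the supremum norm weighted by [e^(mu t)] this
   convolution gains the power A^alpha at the cost of the factor
   [lam_n^a / (mu - lam_n) + lam_(n+1)^a / (lam_(n+1) - mu) +
   c_alpha (lam_(n+1) - mu)^(a - 1)], and the gap condition bounds [L] times this
   factor by [k], so that the fixpoint map is a contraction.  Running the
   contraction with [omega] as a parameter gives measurability of the graph, on
   the past it gives the graph and its Lipschitz constant, and on the whole line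
   it gives an orbit on the manifold that a given solution approaches at the rate
   [e^(- mu t)]. *)

From HB Require Import structures.
From mathcomp Require Import all_boot all_order all_algebra.
From mathcomp Require Import all_classical all_reals all_analysis.
From mathcomp Require Import measurable_realfun.
From mathcomp Require Import ring lra zify.
Require Import Defs.

Set Implicit Arguments.
Unset Strict Implicit.
Unset Printing Implicit Defensive.

Import Order.TTheory GRing.Theory Num.Theory.
Import numFieldNormedType.Exports.

Local Open Scope classical_set_scope.
Local Open Scope ring_scope.

(** * Lebesgue integrals on the line *)

(** The nonlinearity maps D(A^alpha) only into H, so every convolution has to gain A^alpha, and
    [lam ^ a * expR (- lam u)] has no bound uniform in the mode that stays regular at [u = 0]. The
    profile [(sing a u + l ^ a) * expR (- l u)] is such a bound; it is integrable because alpha < 1,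
    and its integral is where c_alpha comes from. The forcing g is only integrable in time, but has
    values in D(A^alpha): for it no gain is required and a bounded kernel suffices. This is why
    [kernel] carries two bounds. Multiplying mode j by [expR (lam j * t)] turns the mild equation
    into [voc], which contains no semigroup, can be cut, glued and shifted, and makes sense in both
    directions of time. Continuity in D(A^alpha) is not visible in the coordinates and is recovered
    from uniform smallness of the high modes. Integrals, solutions and the graph are chosen by
    [xget], so nothing is known about them before existence, and for solutions and the graph also
    uniqueness, is available. The noise enters only through the continuous path [z (theta s w)]: for
    fixed [w] everything is deterministic, and [w] returns as a parameter for measurability. *)

Section affine.
Context {R : realType}.
Notation leb := (@lebesgue_measure R).
Implicit Types f : R -> \bar R.

Lemma measurable_affine (c d : R) :
  measurable_fun setT ((fun s => c * s + d) : measurableTypeR R -> measurableTypeR R).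
Proof.
by apply: measurable_funD => //; exact: mulrl_measurable.
Qed.

(** Lebesgue measure is the only measure that gives every []a, b]] its length. The preimage of []a,
    b]] under the affine map has length [(b - a) / c], so [c] times the image measure does so. *)
Lemma lebesgue_measure_affine (c d : R) (A : set R) : 0 < c -> measurable A ->
  (c%:E * pushforward leb
    ((fun s => c * s + d)%R : measurableTypeR R -> measurableTypeR R) A)%E = leb A.
Proof.
move=> c0 mA; have c0' := ltW c0.
pose aff : measurableTypeR R -> measurableTypeR R := fun s => c * s + d.
have maff : measurable_fun setT aff by exact: measurable_affine.
pose m := mscale (NngNum c0') (pushforward leb aff).
rewrite -[LHS]/(m maff A); apply/esym/(@lebesgue_measure_unique R (m maff)) => //= _ [[a b] _ <-].
rewrite /m /mscale/= /pushforward/=.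
have -> : aff @^-1` [set` `]a, b]%R] = [set` `](a - d) / c, (b - d) / c]%R].
  apply/seteqP; split => x /=; rewrite /aff !in_itv/= ltr_pdivrMr// ler_pdivlMr//.
    by move=> /andP[? ?]; apply/andP; split; lra.
  by move=> /andP[? ?]; apply/andP; split; lra.
rewrite !lebesgue_measure_itv/= !lte_fin ltr_pM2r ?invr_gt0// ltrD2r.
case: ifPn => _; last by rewrite mule0.
rewrite -!EFinB -EFinM -mulrBl mulrC divfK ?gt_eqF//; congr EFin; lra.
Qed.

Lemma ge0_integral_affine (c d : R) f : 0 < c -> measurable_fun setT f ->
  (forall x, 0 <= f x)%E ->
  (\int[leb]_s f (c * s + d)%R = (c^-1)%:E * \int[leb]_s f s)%E.
Proof.
move=> c0 mf f0; have c0' := ltW c0.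
pose aff : measurableTypeR R -> measurableTypeR R := fun s => c * s + d.
have maff : measurable_fun setT aff by exact: measurable_affine.
pose m := mscale (NngNum c0') (pushforward leb aff).
have -> : (\int[leb]_s f s)%E =
    (\int[m maff]_s f s)%E.
  apply: eq_measure_integral => A mA _; exact/esym/(lebesgue_measure_affine d c0 mA).
by rewrite ge0_integral_mscale//= ge0_integral_pushforward// muleA -EFinM mulVf ?gt_eqF// mul1e.
Qed.

Lemma ge0_integral_opp f : measurable_fun setT f -> (forall x, 0 <= f x)%E ->
  (\int[leb]_s f (- s)%R = \int[leb]_s f s)%E.
Proof.
move=> mf f0.
have mN : measurable_fun setT (-%R : measurableTypeR R -> measurableTypeR R).
  exact: oppr_measurable.
rewrite -[LHS](@ge0_integral_pushforward _ _ _ _ _ _ mN leb setT)//.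
by apply: eq_measure_integral => A mA _; exact: lebesgue_measureN.
Qed.

(** No integrability is assumed: the integral is the difference of those of the positive and
    negative parts, and each of them is invariant. *)
Lemma integral_shift (d : R) f : measurable_fun setT f ->
  (\int[leb]_s f (s + d)%R = \int[leb]_s f s)%E.
Proof.
move=> mf; rewrite integralE [RHS]integralE; congr (_ - _)%E.
  rewrite -[RHS]mul1e -[X in (X%:E * _)%E]invr1 -(@ge0_integral_affine 1 d)//.
    by apply: eq_integral => s _; rewrite mul1r funepos_comp.
  exact: measurable_funepos.
rewrite -[RHS]mul1e -[X in (X%:E * _)%E]invr1 -(@ge0_integral_affine 1 d)//.
  by apply: eq_integral => s _; rewrite mul1r funeneg_comp.
exact: measurable_funeneg.
Qed.

Lemma integral_opp f : measurable_fun setT f ->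
  (\int[leb]_s f (- s)%R = \int[leb]_s f s)%E.
Proof.
move=> mf; rewrite integralE [RHS]integralE; congr (_ - _)%E.
  rewrite -[RHS]ge0_integral_opp//; last exact: measurable_funepos.
  by apply: eq_integral => s _; rewrite funepos_comp.
rewrite -[RHS]ge0_integral_opp//; last exact: measurable_funeneg.
  by apply: eq_integral => s _; rewrite funeneg_comp.
Qed.

Lemma integral_reflect (t : R) f : measurable_fun setT f ->
  (\int[leb]_s f (t - s)%R = \int[leb]_s f s)%E.
Proof.
move=> mf; rewrite -[RHS](integral_shift t mf) -[RHS]integral_opp//.
  by apply: eq_integral => s _; rewrite addrC.
by apply: (measurableT_comp mf); exact: measurable_funD.
Qed.

Lemma measurable_reflect (t : R) :
  measurable_fun setT ((fun s => t - s) : measurableTypeR R -> measurableTypeR R).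
Proof. exact: measurable_funB. Qed.

Lemma measurable_shift (t : R) :
  measurable_fun setT ((fun s => s + t) : measurableTypeR R -> measurableTypeR R).
Proof. exact: measurable_funD. Qed.

Lemma integrable_shift (d : R) (f : R -> R) : leb.-integrable setT (EFin \o f) ->
  leb.-integrable setT (EFin \o (fun s => f (s + d))).
Proof.
move=> /integrableP[mf fi]; apply/integrableP; split.
  by apply: (measurableT_comp mf); exact: measurable_shift.
rewrite (integral_shift d (f := fun x => `|(EFin \o f) x|%E))//.
exact: measurableT_comp.
Qed.

Lemma integrable_reflect (d : R) (f : R -> R) : leb.-integrable setT (EFin \o f) ->
  leb.-integrable setT (EFin \o (fun s => f (d - s))).
Proof.
move=> /integrableP[mf fi]; apply/integrableP; split.
  by apply: (measurableT_comp mf); exact: measurable_reflect.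
rewrite (integral_reflect d (f := fun x => `|(EFin \o f) x|%E))//.
exact: measurableT_comp.
Qed.

Lemma Rintegral_shift (d : R) (f : R -> R) : measurable_fun setT f ->
  \int[leb]_s f (s + d) = \int[leb]_s f s.
Proof.
by move=> mf; rewrite /Rintegral (integral_shift d (f := EFin \o f))//; exact: measurableT_comp.
Qed.

Lemma Rintegral_reflect (d : R) (f : R -> R) : measurable_fun setT f ->
  \int[leb]_s f (d - s) = \int[leb]_s f s.
Proof.
by move=> mf; rewrite /Rintegral (integral_reflect d (f := EFin \o f))//; exact: measurableT_comp.
Qed.

End affine.

(** * The Gamma integral behind c_alpha *)

Section gamma.
Context {R : realType}.
Notation leb := (@lebesgue_measure R).

Lemma measurable_expRM (d : R) : measurable_fun setT (fun s : R => expR (- (d * s))).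
Proof.
apply: measurableT_comp => //; apply: measurableT_comp; first exact: oppr_measurable.
exact: mulrl_measurable.
Qed.

(** The exponential density of rate [d] has total mass one; divide by [d]. *)
Lemma integral_expR_decay (d : R) : 0 < d ->
  (\int[leb]_(s in `[0%R, +oo[) (expR (- (d * s)))%:E = (d^-1)%:E)%E.
Proof.
move=> d0.
have := integral_exponential_pdf d0.
rewrite (_ : (fun x => _) = (fun x : R => (d%:E * (expR (- (d * x)))%:E)%E) \_ `[0%R, +oo[); last first.
  apply/funext => x; rewrite /exponential_pdf !patchE; case: ifPn => // _.
  by rewrite EFinM mulNr.
rewrite -integral_mkcond ge0_integralZl//=; last 2 first.
- by apply: measurable_funTS; apply/measurable_EFinP; exact: measurable_expRM.
- exact: ltW.
move=> /(congr1 (fun y => d^-1%:E * y)%E).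
by rewrite muleA -EFinM mulVf ?gt_eqF// mul1e mule1.
Qed.

(** The integrand is singular at 0, so []0, 1]] is exhausted by compact intervals on which the
    primitive [(1 - a)^-1 * s ^ (1 - a)] is available; its increments never exceed its value at
    1. *)
Lemma integral_powR01 (a : R) : 0 <= a -> a < 1 ->
  (\int[leb]_(s in `]0%R, 1%R]) (s `^ (- a))%:E <= ((1 - a)^-1)%:E)%E.
Proof.
move=> a0 a1; have b0 : 0 < 1 - a by rewrite subr_gt0.
(* With [k.+2] the left end is strictly below 1, as the fundamental theorem of calculus requires. *)
pose E (k : nat) : set R := `[k.+2%:R^-1, 1]%classic.
have -> : `]0%R, 1%R]%classic = \bigcup_k E k.
  apply/seteqP; split => [x|x [k _]]; rewrite /E/= !in_itv/=.
    move=> /andP[x0 x1]; exists (Num.truncn x^-1) => //=.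
    rewrite in_itv/= x1 andbT invf_ple ?posrE//.
    by rewrite (le_trans (ltW (truncnS_gt _)))// ler_nat.
  by move=> /andP[x0 x1]; rewrite x1 andbT (lt_le_trans _ x0)// invr_gt0.
have mp : measurable_fun setT (fun s : R => (s `^ (- a))%:E).
  by apply/measurable_EFinP; exact: measurable_powR.
have cE : (\int[leb]_(s in E k) (s `^ (- a))%:E)%E @[k --> \oo] -->
    (\int[leb]_(s in \bigcup_k E k) (s `^ (- a))%:E)%E.
  apply: ge0_nondecreasing_set_cvg_integral.
  - move=> m n mn; apply/subsetPset => x; rewrite /E/= !in_itv/= => /andP[h ->].
    rewrite andbT (le_trans _ h)// lef_pV2 ?posrE// ler_nat; lia.
  - by move=> i; exact: measurable_itv.
  - by move=> i; exact: measurable_funTS.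
  - by move=> i x _; rewrite lee_fin powR_ge0.
rewrite -(cvg_lim _ cE)//.
apply: lime_le.
  apply: ereal_nondecreasing_is_cvgn => m n mn.
  apply: ge0_subset_integral => //.
  - exact: measurable_itv.
  - exact: measurable_itv.
  - exact: measurable_funTS.
  - by move=> x _; rewrite lee_fin powR_ge0.
  - move=> x; rewrite /E/= !in_itv/= => /andP[h ->].
    rewrite andbT (le_trans _ h)// lef_pV2 ?posrE// ler_nat; lia.
near=> k.
have dF (x : R) : 0 < x ->
    is_derive x 1 (fun s => (1 - a)^-1 * s `^ (1 - a)) (x `^ (- a)).
  move=> x0; have dP := is_derive1_powR (1 - a) x0.
  have := is_deriveZ (1 - a)^-1 dP => /is_derive_eq; apply; rewrite /GRing.scale/= mulrA mulVf ?gt_eqF// mul1r.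
  by congr (_ `^ _); lra.
have cp (r x : R) : 0 < x -> {for x, continuous (fun s : R => s `^ r)}.
  move=> x0; apply: differentiable_continuous; apply/derivable1_diffP.
  by have [] := is_derive1_powR r x0.
have k0 : 0 < k.+2%:R^-1 :> R by rewrite invr_gt0.
have k1 : k.+2%:R^-1 < 1 :> R by rewrite invf_lt1// ltr1n.
rewrite /E (@continuous_FTC2 _ _ (fun s => (1 - a)^-1 * s `^ (1 - a)))//.
- by rewrite powR1 mulr1 lee_fin gerBl mulr_ge0 ?powR_ge0// invr_ge0 ltW.
- apply: continuous_in_subspaceT => x; rewrite inE/= in_itv/= => /andP[h _].
  by apply: cp; exact: lt_le_trans h.
- split.
  + by move=> x; rewrite in_itv/= => /andP[h _]; have [] := dF x (lt_trans k0 h).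
  + by apply: cvg_at_right_filter; apply: cvgMr; exact: cp.
  + by apply: cvg_at_left_filter; apply: cvgMr; exact: cp.
- move=> x; rewrite in_itv/= => /andP[h _]; rewrite derive1E.
  by have [_ ->] := dF x (lt_trans k0 h).
Unshelve. all: by end_near. Qed.

(** The integrand of Gamma(1 - a), the one occurring in [c_alpha]. *)
Definition gammaf (a s : R) : R := s `^ (- a) * expR (- s).

Lemma measurable_gammaf a : measurable_fun setT (gammaf a).
Proof.
apply: measurable_funM; first exact: measurable_powR.
by apply: measurableT_comp => //; exact: oppr_measurable.
Qed.

Lemma gammaf_ge0 a s : 0 <= gammaf a s.
Proof. by rewrite mulr_ge0 ?powR_ge0 ?expR_ge0. Qed.

(** Comparison with [s ^ (- a)] on []0, 1]] and with [expR (- s)] beyond 1. *)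
Lemma gamma_lty (a : R) : 0 <= a -> a < 1 ->
  (\int[leb]_(s in `]0%R, +oo[) (gammaf a s)%:E < +oo)%E.
Proof.
move=> a0 a1.
have mg : measurable_fun setT (EFin \o gammaf a).
  by apply/measurable_EFinP; exact: measurable_gammaf.
have -> : `]0%R, +oo[%classic = `]0%R, 1%R] `|` `]1%R, +oo[ :> set R.
  by rewrite -itv_bndbnd_setU// bnd_simp.
have mU : measurable_fun (`]0%R, 1%R] `|` `]1%R, +oo[ : set R) (EFin \o gammaf a).
  exact: measurable_funTS.
rewrite ge0_integral_setU//=; last 2 first.
- by move=> x _; rewrite lee_fin gammaf_ge0.
- by apply/disj_setPS => x [/=]; rewrite !in_itv/= => /andP[_ h] /andP[h' _]; lra.
apply: lte_add_pinfty.
  apply: le_lt_trans (ltry (1 - a)^-1); apply: le_trans (integral_powR01 a0 a1).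
  apply: ge0_le_integral => //=.
  - by move=> x _; rewrite lee_fin gammaf_ge0.
  - exact: measurable_funTS.
  - apply: measurable_funTS; apply/measurable_EFinP; exact: measurable_powR.
  - move=> x; rewrite in_itv/= => /andP[x0 _].
    by rewrite lee_fin /gammaf ler_piMr ?powR_ge0// expR_le1 oppr_le0 ltW.
apply: le_lt_trans (ltry (1^-1)); rewrite -(integral_expR_decay ltr01).
apply: (@le_trans _ _ (\int[leb]_(s in `]1%R, +oo[) (expR (- (1 * s)))%:E)%E).
  apply: ge0_le_integral => //=.
  - by move=> x _; rewrite lee_fin gammaf_ge0.
  - exact: measurable_funTS.
  - apply: measurable_funTS; apply/measurable_EFinP.
    exact: measurable_expRM.
  - move=> x; rewrite in_itv/= andbT => x1; have x0 : 0 < x by lra.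
    rewrite lee_fin /gammaf mul1r ler_piMl ?expR_ge0// powRN invf_le1 ?powR_gt0//.
    by rewrite -(powRr0 x) ler_powR// ltW.
apply: ge0_subset_integral => //.
- apply: measurable_funTS; apply/measurable_EFinP; exact: measurable_expRM.
- by move=> x; rewrite /= !in_itv/= !andbT => h; lra.
Qed.

End gamma.

(** * Weighted profiles dominating all modes, and their mass *)

Section kernel_profile.
Context {R : realType}.
Notation leb := (@lebesgue_measure R).
Implicit Types a b d p : R.

(* [lam ^ a e^(- lam u) <= (sing a u + l ^ a) e^(- l u)] for [lam >= l] *)
Definition sing a (u : R) : R := if a == 0 then 0 else a `^ a * u `^ (- a).

Lemma sing_ge0 a u : 0 <= sing a u.
Proof. by rewrite /sing; case: ifP => // _; rewrite mulr_ge0 ?powR_ge0. Qed.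

Lemma measurable_sing a : measurable_fun setT (sing a).
Proof.
have -> : sing a = fun u => (if a == 0 then 0 else a `^ a) * u `^ (- a).
  by apply/funext => u; rewrite /sing; case: ifP => // _; rewrite mul0r.
by apply: measurable_funM => //; exact: measurable_powR.
Qed.

(** Shape of the common bound for the weighted kernels. The branch [0 < u] serves modes solved
    forward: [p] is the lowest rate to the power a, and [d] the distance from the weight up to that
    rate. The branch [u <= 0] serves modes solved backward: [b] bounds their A^alpha factors, and
    [d'] is the distance from their rates up to the weight. *)
Definition wprofile a p b d d' (u : R) : R :=
  if 0 < u then (sing a u + p) * expR (- (d * u)) else b * expR (d' * u).

Lemma wprofile_ge0 a p b d d' u : 0 <= p -> 0 <= b -> 0 <= wprofile a p b d d' u.
Proof.
move=> p0 b0; rewrite /wprofile; case: ifP => _; rewrite mulr_ge0 ?expR_ge0//.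
by rewrite addr_ge0 ?sing_ge0.
Qed.

Lemma measurable_wprofile a p b d d' : measurable_fun setT (wprofile a p b d d').
Proof.
have mE e : measurable_fun setT (fun s : R => expR (e * s)).
  have := measurable_expRM (- e); congr measurable_fun.
  by apply/funext => s; rewrite mulNr opprK.
apply: measurable_fun_ifT.
- exact: measurable_fun_ltr.
- apply: measurable_funM; last exact: measurable_expRM.
  by apply: measurable_funD => //; exact: measurable_sing.
- exact: measurable_funM.
Qed.

(** Scaling: [gammaf a (d * u)] is [d ^ (- a)] times the integrand, and the substitution contributes
    [d^-1]. *)
Lemma integral_powR_expR a d : 0 <= a -> a < 1 -> 0 < d ->
  (\int[leb]_(u in `]0%R, +oo[) (u `^ (- a) * expR (- (d * u)))%:E =
  (d `^ (a - 1) * \int[leb]_(u in `]0%R, +oo[) gammaf a u)%:E)%E.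
Proof.
move=> a0 a1 d0.
have mg : measurable_fun setT (EFin \o @gammaf R a).
  by apply/measurable_EFinP; exact: measurable_gammaf.
have dn0 : d != 0 by rewrite gt_eqF.
pose f := (EFin \o gammaf a) \_ `]0%R, +oo[ : R -> \bar R.
have mf : measurable_fun setT f.
  by apply/(measurable_restrictT _ _).1 => //; exact: measurable_funTS.
have f0 x : (0 <= f x)%E.
  by rewrite /f patchE; case: ifP => //= _; rewrite lee_fin gammaf_ge0.
have := ge0_integral_affine 0 d0 mf f0.
rewrite -[in RHS]integral_mkcond.
have -> : (\int[leb]_(s in `]0%R, +oo[) (EFin \o gammaf a) s)%E =
    (\int[leb]_(s in `]0%R, +oo[) gammaf a s)%:E.
  rewrite /Rintegral fineK// ge0_fin_numE ?gamma_lty//.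
  by apply: integral_ge0 => x _; rewrite lee_fin gammaf_ge0.
have -> : (fun s => f (d * s + 0)) = (fun u => ((d `^ (- a))%:E * (u `^ (- a) * expR (- (d * u)))%:E)%E)
    \_ `]0%R, +oo[.
  apply/funext => u; rewrite addr0 /f !patchE.
  have -> : (d * u \in `]0%R, +oo[%classic) = (u \in `]0%R, +oo[%classic).
    by apply/idP/idP; rewrite !inE/= !in_itv/= !andbT pmulr_rgt0.
  case: ifPn => //; rewrite inE/= in_itv/= andbT => u0.
  by rewrite -EFinM mulrA -powRM// ltW.
rewrite -[in LHS]integral_mkcond ge0_integralZl//=; last 3 first.
- apply: measurable_funTS; apply/measurable_EFinP; apply: measurable_funM.
    exact: measurable_powR.
  exact: measurable_expRM.
- by move=> x _; rewrite lee_fin mulr_ge0 ?powR_ge0 ?expR_ge0.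
- by rewrite lee_fin powR_ge0.
move=> /(congr1 (fun x => (d `^ a)%:E * x)%E).
rewrite muleA -EFinM -powRD ?dn0 ?implybT// subrr powRr0 mul1e => ->.
rewrite -!EFinM mulrA -[X in _ * X * _]powR_inv1 ?ltW//.
by rewrite -powRD// dn0 implybT.
Qed.

(** The three terms are the integrals of the singular part, of the constant part and of the backward
    branch. For [a = 0] the singular part and [c_alpha] vanish together by convention. *)
Lemma integral_wprofile a p b d d' : 0 <= a -> a < 1 -> 0 <= p -> 0 <= b ->
  0 < d -> 0 < d' ->
  (\int[leb]_u (wprofile a p b d d' u)%:E =
  (c_alpha a * d `^ (a - 1) + p / d + b / d')%:E)%E.
Proof.
move=> a0 a1 p0 b0 d0 d'0.
have mw : measurable_fun setT (EFin \o wprofile a p b d d').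
  by apply/measurable_EFinP; exact: measurable_wprofile.
have w0 x : (0 <= (wprofile a p b d d' x)%:E)%E by rewrite lee_fin wprofile_ge0.
have mE e (D : set R) : measurable_fun D (fun s : R => (expR (- (e * s)))%:E).
  by apply: measurable_funTS; apply/measurable_EFinP; exact: measurable_expRM.
have I0 e : 0 < e ->
    (\int[leb]_(s in `]0%R, +oo[) (expR (- (e * s)))%:E = (e^-1)%:E)%E.
  by move=> e0; rewrite integral_itv_obnd_cbnd// integral_expR_decay.
have UT : setT = `]0%R, +oo[ `|` `]-oo, 0%R] :> set R.
  by rewrite -[in `]-oo, 0%R]%classic]setCitvr setUv.
have mU : measurable_fun (`]0%R, +oo[ `|` `]-oo, 0%R] : set R) (EFin \o wprofile a p b d d').
  by rewrite -UT.
rewrite UT ge0_integral_setU//=; last first.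
  by rewrite -setCitvr; exact/disj_setPCl.
rewrite EFinD; congr (_ + _)%E.
  transitivity (\int[leb]_(u in `]0%R, +oo[)
      ((sing a u * expR (- (d * u)))%:E + (p%:E * (expR (- (d * u)))%:E)))%E.
    apply: eq_integral => u; rewrite inE/= in_itv/= andbT => u0.
    by rewrite /wprofile u0 mulrDl EFinD EFinM.
  rewrite ge0_integralD//=; last 4 first.
  - by move=> x _; rewrite lee_fin mulr_ge0 ?sing_ge0 ?expR_ge0.
  - apply: measurable_funTS; apply/measurable_EFinP; apply: measurable_funM.
      exact: measurable_sing.
    exact: measurable_expRM.
  - by move=> x _; rewrite mule_ge0.
  - by apply: emeasurable_funM => //; exact: mE.
  rewrite ge0_integralZl//; last exact: mE.
  rewrite I0// -EFinM EFinD; congr (_ + _)%E.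
  rewrite /sing /c_alpha; case: ifPn => [_|an0].
    by rewrite mul0r integral0_eq// => x _; rewrite mul0r.
  transitivity (\int[leb]_(u in `]0%R, +oo[)
      ((a `^ a)%:E * (u `^ (- a) * expR (- (d * u)))%:E))%E.
    by apply: eq_integral => u _; rewrite -EFinM mulrA.
  rewrite ge0_integralZl//=; last 3 first.
  - apply: measurable_funTS; apply/measurable_EFinP; apply: measurable_funM.
      exact: measurable_powR.
    exact: measurable_expRM.
  - by move=> x _; rewrite lee_fin mulr_ge0 ?powR_ge0 ?expR_ge0.
  - by rewrite lee_fin powR_ge0.
  rewrite integral_powR_expR// -EFinM; congr EFin.
  by rewrite -mulrA; congr (_ * _); rewrite mulrC.
transitivity (\int[leb]_(u in `]-oo, 0%R]) (b%:E * (expR (d' * u))%:E))%E.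
  apply: eq_integral => u; rewrite inE/= in_itv/= => u0.
  by rewrite /wprofile ltNge u0.
have := @ge0_integration_by_substitution0 R (fun s => (expR (- (d' * s)))%:E).
rewrite integral_expR_decay// => H.
under eq_integral do rewrite -[_ * _]opprK -mulrN.
rewrite ge0_integralZl//=; last first.
  apply: measurable_funTS; apply/measurable_EFinP.
  have := measurable_expRM (- d'); congr measurable_fun.
  by apply/funext => s; rewrite mulrN mulNr.
by rewrite -H.
Qed.

Lemma integrable_wprofile a p b d d' : 0 <= a -> a < 1 -> 0 <= p -> 0 <= b ->
  0 < d -> 0 < d' -> leb.-integrable setT (EFin \o wprofile a p b d d').
Proof.
move=> a0 a1 p0 b0 d0 d'0; apply/integrableP; split.
  by apply/measurable_EFinP; exact: measurable_wprofile.
under eq_integral => x _ do rewrite /= ger0_norm ?wprofile_ge0//.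
by rewrite integral_wprofile// ltry.
Qed.

Lemma Rintegral_wprofile a p b d d' : 0 <= a -> a < 1 -> 0 <= p -> 0 <= b ->
  0 < d -> 0 < d' ->
  \int[leb]_u wprofile a p b d d' u = c_alpha a * d `^ (a - 1) + p / d + b / d'.
Proof. by move=> *; rewrite /Rintegral integral_wprofile. Qed.

Lemma c_alpha_ge0 a : 0 <= c_alpha a.
Proof.
rewrite /c_alpha; case: ifP => // _; rewrite mulr_ge0 ?powR_ge0//.
by apply: Rintegral_ge0 => x _; rewrite mulr_ge0 ?powR_ge0 ?expR_ge0.
Qed.

(** The fractions [x / (x + y)] and [y / (x + y)] add up to 1, and [t <= t ^ a] for [t] in
    [0, 1]. *)
Lemma powR_subadd a (x y : R) : 0 <= a -> a <= 1 -> 0 <= x -> 0 < y ->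
  (x + y) `^ a <= x `^ a + y `^ a.
Proof.
move=> a0 a1 x0 y0; have xy0 : 0 < x + y by lra.
have key t : 0 <= t -> t <= 1 -> t <= t `^ a.
  move=> t0 t1; have [->|tn0] := eqVneq t 0; first exact: powR_ge0.
  by rewrite ger1_powR// t1 andbT lt0r tn0.
rewrite -[leLHS]mul1r -[X in X * _](_ : x / (x + y) + y / (x + y) = 1); last first.
  by rewrite -mulrDl divff ?gt_eqF.
have split t : 0 <= t -> t `^ a = (t / (x + y)) `^ a * (x + y) `^ a.
  move=> t0; rewrite -powRM; last exact: ltW.
    by rewrite divfK// gt_eqF.
  by rewrite divr_ge0// ltW.
rewrite mulrDl (split _ x0) (split _ (ltW y0)); apply: lerD.
  rewrite ler_wpM2r ?powR_ge0// key//; first by rewrite divr_ge0// ltW.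
  by rewrite ler_pdivrMr// mul1r lerDl ltW.
rewrite ler_wpM2r ?powR_ge0// key//; first by rewrite divr_ge0// ltW.
by rewrite ler_pdivrMr// mul1r lerDr.
Qed.

(* [x ^ a e^(- x)] is largest at [x = a] *)
Lemma powR_expRN_le a (x : R) : 0 < a -> 0 <= x -> x `^ a * expR (- x) <= a `^ a.
Proof.
move=> a0 x0; have [->|xn0] := eqVneq x 0.
  by rewrite powR0 ?gt_eqF// mul0r powR_ge0.
have -> : expR (- x) = expR (- (x / a)) `^ a.
  by rewrite -expRM mulNr divfK ?gt_eqF.
rewrite -powRM ?expR_ge0//; apply: ge0_ler_powR; rewrite ?nnegrE; first exact: ltW.
- by rewrite mulr_ge0 ?expR_ge0.
- exact: ltW.
rewrite expRN ler_pdivrMr ?expR_gt0// mulrC -ler_pdivrMr//.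
by apply: le_trans (expR_ge1Dx _); rewrite lerDr.
Qed.

(** Split [l'] into [(l' - l) + l]. By subadditivity only [(l' - l) ^ a * expR (- ((l' - l) * u))]
    needs a bound uniform in [l'], and the maximum of [x ^ a * expR (- x)] gives
    [a ^ a * u ^ (- a)]. This is the origin of the factor [a ^ a] in [c_alpha]. *)
Lemma powR_expRN_profile a (l l' u : R) : 0 <= a -> a <= 1 -> 0 < l -> l <= l' ->
  0 < u -> l' `^ a * expR (- (l' * u)) <= (sing a u + l `^ a) * expR (- (l * u)).
Proof.
move=> a0 a1 l0 ll' u0; rewrite /sing; case: ifPn => [/eqP ->|an0].
  rewrite !powRr0 add0r !mul1r ler_expR lerN2 ler_pM2r//.
have {an0}a_gt0 : 0 < a by rewrite lt0r an0.
have -> : l' = (l' - l) + l by rewrite subrK.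
set d := l' - l; have d0 : 0 <= d by rewrite subr_ge0.
apply: le_trans (_ : (d `^ a + l `^ a) * expR (- ((d + l) * u)) <= _).
  by rewrite ler_wpM2r ?expR_ge0// powR_subadd.
rewrite [(d + l) * u]mulrDl opprD expRD mulrA ler_wpM2r ?expR_ge0// mulrDl; apply: lerD.
  rewrite powRN -ler_pdivrMr ?invr_gt0 ?powR_gt0// invrK mulrAC -powRM//; last exact: ltW.
  by rewrite powR_expRN_le// mulr_ge0// ltW.
by rewrite ler_piMr ?powR_ge0// expR_le1 oppr_le0 mulr_ge0// ltW.
Qed.

End kernel_profile.

(** * Cauchy-Schwarz, Minkowski, and integrals depending on a parameter *)

Section real_lemmas.
Context {R : realType}.

(** Expand [0 <= sum (N f_j - phi c_j)^2] and cancel [N * phi]; the cases where this factor vanishes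
    are treated separately. *)
Lemma sum_mul_le_of_sqr m (c f : nat -> R) (N phi : R) : 0 <= N -> 0 <= phi ->
  \sum_(j < m) c j ^+ 2 <= N ^+ 2 -> \sum_(j < m) f j ^+ 2 <= phi ^+ 2 ->
  \sum_(j < m) c j * f j <= N * phi.
Proof.
move=> N0 phi0 cN fphi.
have zero (g : nat -> R) : \sum_(j < m) g j ^+ 2 <= 0 -> forall j : 'I_m, g j = 0.
  move=> g0 j; apply/eqP; rewrite -sqrf_eq0 eq_le sqr_ge0 andbT.
  by apply: le_trans g0; rewrite (bigD1 j)//= lerDl sumr_ge0// => i _; exact: sqr_ge0.
have [N_eq0|Nn0] := eqVneq N 0.
  rewrite N_eq0 mul0r big1// => j _.
  by rewrite (zero c) ?mul0r// (le_trans cN)// N_eq0 expr0n.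
have [phi_eq0|phin0] := eqVneq phi 0.
  rewrite phi_eq0 mulr0 big1// => j _.
  by rewrite (zero f) ?mulr0// (le_trans fphi)// phi_eq0 expr0n.
have Np : 0 < N * phi by rewrite mulr_gt0 ?lt0r ?Nn0 ?phin0.
have : 0 <= \sum_(j < m) (N * f j - phi * c j) ^+ 2.
  by apply: sumr_ge0 => j _; exact: sqr_ge0.
have -> : \sum_(j < m) (N * f j - phi * c j) ^+ 2 =
    N ^+ 2 * (\sum_(j < m) f j ^+ 2) - 2 * (N * phi) * (\sum_(j < m) c j * f j)
    + phi ^+ 2 * (\sum_(j < m) c j ^+ 2).
  rewrite !mulr_sumr -sumrN -!big_split/=; apply: eq_bigr => j _; ring.
move=> H; rewrite -(ler_pM2l Np) -(@ler_pM2l _ 2)//.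
have h1 : N ^+ 2 * (\sum_(j < m) f j ^+ 2) <= N ^+ 2 * phi ^+ 2.
  by rewrite ler_wpM2l// sqr_ge0.
have h2 : phi ^+ 2 * (\sum_(j < m) c j ^+ 2) <= phi ^+ 2 * N ^+ 2.
  by rewrite ler_wpM2l// sqr_ge0.
have h3 : N * phi * (N * phi) = N ^+ 2 * phi ^+ 2 by ring.
rewrite h3; lra.
Qed.

(** The supremum S of [d] satisfies [S <= B + q * S]. The a priori bound [C] only makes S finite and
    is absent from the result. With [B = 0] this is uniqueness, with [B] the distance of the data it
    is Lipschitz dependence. *)
Lemma contraction_bound (T : Type) (D : set T) (d : T -> R) (B q C : R) :
  0 <= q -> q < 1 -> (forall t, D t -> 0 <= d t) -> (forall t, D t -> d t <= C) ->
  (forall C', 0 <= C' -> (forall t, D t -> d t <= C') ->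
    forall t, D t -> d t <= B + q * C') ->
  forall t, D t -> d t <= B / (1 - q).
Proof.
move=> q0 q1 d0 dC dB t Dt; have q1' : 0 < 1 - q by rewrite subr_gt0.
pose E := d @` D.
have supE : has_sup E.
  by split; [exists (d t); exists t|exists C => _ [s Ds <-]; exact: dC].
have dS s : D s -> d s <= sup E.
  by move=> Ds; apply: ub_le_sup; [exact: supE.2|exists s].
have S0 : 0 <= sup E by apply: le_trans (dS _ Dt); exact: d0.
have SB : sup E <= B + q * sup E.
  by apply: ge_sup; [exact: supE.1|move=> _ [s Ds <-]; exact: dB].
rewrite (le_trans (dS _ Dt))// ler_pdivlMr// mulrBr mulr1; lra.
Qed.

End real_lemmas.

Section integral_lemmas.
Context {R : realType}.

(** Minkowski's integral inequality for finite sequences. With [c] the vector of integrals and N its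
    norm, pairing with [c] itself gives [N^2 <= N * \int phi]. *)
Lemma sum_sqr_Rintegral_le d (T : measurableType d) (mu : measure T R)
    (D : set T) m (f : nat -> T -> R) (phi : T -> R) :
  measurable D ->
  (forall j, mu.-integrable D (EFin \o f j)) -> mu.-integrable D (EFin \o phi) ->
  (forall x, D x -> 0 <= phi x) ->
  (forall x, D x -> \sum_(j < m) f j x ^+ 2 <= phi x ^+ 2) ->
  \sum_(j < m) (\int[mu]_(x in D) f j x) ^+ 2 <= (\int[mu]_(x in D) phi x) ^+ 2.
Proof.
move=> mD fi phii phi0 fphi.
pose c j := \int[mu]_(x in D) f j x.
pose N := Num.sqrt (\sum_(j < m) c j ^+ 2).
have cs0 : 0 <= \sum_(j < m) c j ^+ 2 by apply: sumr_ge0 => j _; exact: sqr_ge0.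
have N2 : N ^+ 2 = \sum_(j < m) c j ^+ 2 by rewrite sqr_sqrtr.
have N0 : 0 <= N by exact: sqrtr_ge0.
have I0 : 0 <= \int[mu]_(x in D) phi x by exact: Rintegral_ge0.
have cfi j : mu.-integrable D (EFin \o (fun x => c j * f j x)).
  by have := integrableZl mD (c j) (fi j).
have sfi k : mu.-integrable D (EFin \o (fun x => \sum_(j < k) c j * f j x)).
  rewrite (_ : _ \o _ = (fun x => (\sum_(j < k) (c j * f j x)%R%:E)%E)).
    by apply: (integrable_sum mD) => j _; exact: cfi.
  by apply/funext => x /=; rewrite sumEFin.
have sumE k : \sum_(j < k) c j ^+ 2 = \int[mu]_(x in D) (\sum_(j < k) c j * f j x).
  elim: k => [|k IH].
    rewrite big_ord0; under eq_Rintegral do rewrite big_ord0.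
    by rewrite Rintegral_cst// mul0r.
  rewrite big_ord_recr/= IH; under [RHS]eq_Rintegral do rewrite big_ord_recr/=.
  rewrite (RintegralD mD (sfi k) (cfi k)).
  by rewrite (RintegralZl _ mD (fi k)).
have : N ^+ 2 <= N * \int[mu]_(x in D) phi x.
  rewrite N2 sumE -(RintegralZl _ mD phii); apply: le_Rintegral => //.
    by have := integrableZl mD N phii.
  by move=> x Dx; apply: (@sum_mul_le_of_sqr _ m c (f ^~ x)); rewrite ?phi0 ?fphi ?N2.
rewrite -/(c _) -N2 expr2; have [->|Nn0] := eqVneq N 0; first by rewrite !mul0r sqr_ge0.
by rewrite ler_pM2l ?lt0r ?Nn0// => NI; rewrite expr2 ler_pM.
Qed.

Lemma measurable_fun_Rintegral d (T : measurableType d) (f : T * R -> R) :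
  measurable_fun setT f ->
  measurable_fun setT (fun x => \int[@lebesgue_measure R]_s f (x, s)).
Proof.
move=> mf; have mE : measurable_fun setT (EFin \o f) by exact/measurable_EFinP.
have -> : (fun x => \int[@lebesgue_measure R]_s f (x, s)) =
    (fun x => fine (\int[@lebesgue_measure R]_s (EFin \o f)^\+%E (x, s)
              - \int[@lebesgue_measure R]_s (EFin \o f)^\-%E (x, s))%E).
  apply/funext => x; rewrite /Rintegral integralE; congr fine.
  by congr (_ - _)%E; apply: eq_integral => s _; rewrite ?funeposE ?funenegE.
apply: measurableT_comp; first exact: fine_measurable.
apply: emeasurable_funB.
  apply: (@measurable_fun_fubini_tonelli_F _ _ _ _ R lebesgue_measure (EFin \o f)^\+%E) => //.
  exact: measurable_funepos.
apply: (@measurable_fun_fubini_tonelli_F _ _ _ _ R lebesgue_measure (EFin \o f)^\-%E) => //.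
exact: measurable_funeneg.
Qed.

(** Round the second argument down to a multiple of [1 / (n + 1)]. On each strip of constant
    rounding the function depends on the first argument alone, and continuity gives convergence as n
    grows. *)
Lemma measurable_fun_caratheodory d (T : measurableType d) (f : T -> R -> R) :
  (forall s, measurable_fun setT (f ^~ s)) -> (forall x, continuous (f x)) ->
  measurable_fun setT (fun p : T * R => f p.1 p.2).
Proof.
move=> mf cf.
pose q (n : nat) (s : R) : R := (Num.floor (s * n.+1%:R))%:~R / n.+1%:R.
have q_cvg s : q ^~ s @ \oo --> s.
  apply/cvgrPdist_le => /= e e0.
  near=> n.
  have n0 : 0 < n.+1%:R :> R by rewrite ltr0n.
  rewrite -(ler_pM2r n0) -[X in `|_| * X]gtr0_norm// -normrM mulrBl divfK ?gt_eqF//.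
  have /andP[h1 h2] := floor_itv (s * n.+1%:R).
  rewrite ger0_norm ?subr_ge0// lerBlDl (le_trans (ltW h2))//.
  rewrite intrD lerD2l// -ler_pdivrMr// mul1r ltW//.
  near: n; exact: near_infty_natSinv_lt (PosNum e0).
have fq_cvg (p : T * R) : f p.1 (q n p.2) @[n --> \oo] --> f p.1 p.2.
  exact: (cvg_comp _ _ (q_cvg p.2) (cf p.1 p.2)).
apply: (@measurable_fun_cvg _ _ _ _ (fun n p => f p.1 (q n p.2))); last first.
  by move=> p _; exact: fq_cvg.
move=> n.
pose E (i : int) : set (T * R) := [set p | Num.floor (p.2 * n.+1%:R) = i].
have mE i : measurable (E i).
  have -> : E i = setT `&` (fun p : T * R => p.2 * n.+1%:R) @^-1` `[i%:~R, (i + 1)%:~R[.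
    apply/seteqP; split => [p <-|p [_]]; rewrite /E/=.
      by split => //=; rewrite in_itv/= floor_itv.
    by rewrite in_itv/= => h; exact: floor_def.
  have mm : measurable_fun setT (fun p : T * R => p.2 * n.+1%:R).
    apply: measurable_funM => //; exact: measurable_snd.
  by apply: mm => //; exact: measurable_itv.
(* The strips are indexed by integers; the coding by naturals makes the cover a sequence, with empty
   sets at the numbers that code nothing. *)
pose e (k : nat) : set (T * R) := if unpickle k is Some i then E i else set0.
have -> : [set: T * R] = \bigcup_k e k.
  apply/seteqP; split; last by move=> p _; exact: I.
  move=> p _; exists (pickle (Num.floor (p.2 * n.+1%:R))); first exact: I.
  by rewrite /e pickleK.
apply/measurable_fun_bigcup => k.
  by rewrite /e; case: unpickle.
rewrite /e; case: unpickle => [i|]; last exact: measurable_fun_set0.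
apply: (eq_measurable_fun (fun p : T * R => f p.1 (i%:~R / n.+1%:R))).
  by move=> p; rewrite inE /E/= /q => ->.
apply: measurable_funTS; apply: (measurableT_comp (mf (i%:~R / n.+1%:R))).
exact: measurable_fst.
Unshelve. all: by end_near. Qed.

End integral_lemmas.

(** * Spectral coordinates *)

Section borel.
Context {R : realType} d (T : measurableType d) (V : normedModType R).

(** In a separable space an open set is a countable union of balls with dense centres and radii
    [1 / (k + 1)], and the preimage of a ball is a sublevel set of a distance function. Squared
    distances are used because Parseval's identity delivers them. *)
Lemma borel_measurable_dist (q : nat -> V) (D : set T) (f : T -> V) :
  (forall x e, 0 < e -> exists i, `|x - q i| < e) -> measurable D ->
  (forall i, measurable_fun D (fun s => `|f s - q i| ^+ 2)) ->
  borel_measurable D f.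
Proof.
move=> q_dense mD mf; rewrite /borel_measurable.
apply: (@measurability _ _ _ (g_sigma_algebraType (@open V)) D f (@open V)) => //.
move=> _ [Y oY <-].
pose r (k : nat) : R := k.+1%:R^-1.
pose B (i k : nat) : set T :=
  if `[< ball (q i) (r k) `<=` Y >] then D `&` [set s | `|f s - q i| ^+ 2 < r k ^+ 2]
  else set0.
have r0 k : 0 < r k by rewrite invr_gt0.
have -> : D `&` f @^-1` Y = \bigcup_i \bigcup_k B i k.
  apply/seteqP; split => [s [Ds /= Yfs]|s [i _ [k _]]]; last first.
    rewrite /B; case: asboolP => // BY [Ds /= fr]; split => //; apply: BY.
    rewrite -ball_normE/= distrC.
    by rewrite -(@ltr_pXn2r _ 2)// ?nnegrE// ltW.
  have /nbhs_ballP[e /= e0 eY] : nbhs (f s) Y by exact: open_nbhs_nbhs.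
  have [k ke] : exists k, r k < e / 2.
    exists (Num.truncn (e / 2)^-1); rewrite /r.
    by rewrite -[ltRHS]invrK ltf_pV2 ?posrE ?invr_gt0 ?divr_gt0// truncnS_gt.
  have [i fi] := q_dense (f s) (r k) (r0 k).
  exists i => //; exists k => //; rewrite /B; case: asboolP => [_|].
    by split => //=; rewrite ltr_pXn2r ?nnegrE// ltW.
  case=> y; rewrite -ball_normE/= => qy; apply: eY; rewrite -ball_normE/=.
  rewrite -(subrKA (q i)) (le_lt_trans (ler_normD _ _))//.
  by rewrite (splitr e) ltrD// (lt_trans _ ke).
apply: bigcupT_measurable => i; apply: bigcupT_measurable => k.
rewrite /B; case: ifPn => // _.
rewrite -[X in D `&` X]/((fun s => `|f s - q i| ^+ 2) @^-1` [set x | x < r k ^+ 2]).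
rewrite (_ : [set x | _] = `]-oo, r k ^+ 2[%classic); last first.
  by apply/seteqP; split => x; rewrite /= in_itv.
by apply: mf => //; exact: measurable_itv.
Qed.

Lemma borel_measurable_continuous (U : ptopologicalType) (D : set T) (f : T -> U) (phi : U -> V) :
  borel_measurable D f -> continuous phi -> borel_measurable D (phi \o f).
Proof.
move=> bf cphi mD.
apply: (@measurability _ _ _ (g_sigma_algebraType (@open V)) D (phi \o f) (@open V)) => //.
move=> _ [Y oY <-]; rewrite -[X in D `&` X]/(f @^-1` (phi @^-1` Y)); apply: bf => //.
by apply: sub_gen_smallest; move/continuousP : cphi; exact.
Qed.

Lemma measurable_fun_borel (U : ptopologicalType) (D : set T) (f : T -> U) (phi : U -> R) :
  borel_measurable D f -> continuous phi -> measurable_fun D (phi \o f).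
Proof.
move=> bf cphi mD.
apply: (measurability _ (RGenOpens.measurableE R)) => //.
move=> _ [_ [a [b ->]] <-].
rewrite -[X in D `&` X]/(f @^-1` (phi @^-1` `]a, b[%classic)); apply: bf => //.
apply: sub_gen_smallest; move/continuousP : cphi; apply; exact: interval_open.
Qed.

End borel.

Section coordinates.
Context {R : realType} {H : hilbertType R} (A : spectral_operator H).
Implicit Types (u v : H) (c : nat -> R).
Notation lam := (eigval A).

Definition cr u (j : nat) : R := inner u (eigvec A j).

Lemma crD u v j : cr (u + v) j = cr u j + cr v j.
Proof. exact: innerDl. Qed.

Lemma crN u j : cr (- u) j = - cr u j.
Proof. exact: innerNl. Qed.

Lemma crB u v j : cr (u - v) j = cr u j - cr v j.
Proof. exact: innerBl. Qed.

Lemma crZ a u j : cr (a *: u) j = a * cr u j.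
Proof. exact: innerZl. Qed.

Lemma cr0 j : cr 0 j = 0.
Proof. exact: inner0l. Qed.

Lemma cr_continuous j : continuous (cr ^~ j).
Proof.
move=> u; apply/cvgrPdist_le => /= e e0; near=> v.
rewrite -crB (le_trans (inner_CauchySchwarz _ _))//.
have -> : `|eigvec A j| = 1.
  apply/eqP; rewrite -(@pexpr_eq1 _ _ 2)// -inner_normE.
  by rewrite (eigvec_basis A).1 eqxx.
rewrite mulr1; near: v; exact: cvgr_dist_le.
Unshelve. all: by end_near. Qed.

Lemma cr_cvg u : series (fun j => cr u j *: eigvec A j) @ \oo --> u.
Proof. exact: (eigvec_basis A).2. Qed.
Arguments cr_cvg : clear implicits.

Lemma norm_partial_sum c m :
  `|series (fun j => c j *: eigvec A j) m| ^+ 2 = \sum_(j < m) c j ^+ 2.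
Proof. by rewrite (norm_orthonormal_sum (eigvec_basis A)) big_mkord. Qed.

(** The partial sum p satisfies [|p|^2 = <u, p> <= |u| |p|]. *)
Lemma bessel u m : \sum_(j < m) cr u j ^+ 2 <= `|u| ^+ 2.
Proof.
pose p := series (fun j => cr u j *: eigvec A j) m.
have pE : `|p| ^+ 2 = \sum_(j < m) cr u j ^+ 2 by exact: norm_partial_sum.
have pu : `|p| ^+ 2 = inner u p.
  rewrite pE /p /series/= big_mkord inner_sumr; apply: eq_bigr => j _.
  by rewrite innerC innerZl innerC expr2.
rewrite -pE; have [->|p0] := eqVneq p 0; first by rewrite normr0 expr0n sqr_ge0.
rewrite ler_pXn2r ?nnegrE// -(@ler_pM2r _ `|p|) ?normr_gt0// -expr2 pu.
by rewrite (le_trans (ler_norm _))// inner_CauchySchwarz.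
Qed.

Lemma parseval u : \sum_(j < m) cr u j ^+ 2 @[m --> \oo] --> (`|u| ^+ 2 : R).
Proof.
have cn : `|series (fun j => cr u j *: eigvec A j) m| @[m --> \oo] --> (`|u| : R).
  by apply: cvg_norm; exact: cr_cvg.
rewrite (_ : (fun m => _) = (fun m => `|series (fun j => cr u j *: eigvec A j) m| *
    `|series (fun j => cr u j *: eigvec A j) m|)); first by rewrite expr2; exact: cvgM.
by apply/funext => m; rewrite -norm_partial_sum expr2.
Qed.
Arguments parseval : clear implicits.

Lemma norm_le_cr u (M : R) : 0 <= M ->
  (forall m, \sum_(j < m) cr u j ^+ 2 <= M ^+ 2) -> `|u| <= M.
Proof.
move=> M0 uM.
rewrite -(@ler_pXn2r _ 2) ?nnegrE//.
by apply: (cvgr_to_le (parseval u)); exact: nearW.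
Qed.

Lemma cr_inj u v : (forall j, cr u j = cr v j) -> u = v.
Proof.
move=> uv; apply/eqP; rewrite -subr_eq0 -normr_le0; apply: norm_le_cr => // m.
by rewrite big1 ?expr0n// => j _; rewrite crB uv subrr expr0n.
Qed.

(** Riesz-Fischer. Vectors are constructed from their coordinates in this way throughout. *)
Lemma cr_exists c (M : R) : (forall m, \sum_(j < m) c j ^+ 2 <= M) ->
  exists u, forall j, cr u j = c j.
Proof.
move=> cM.
suff /cvg_ex[u cu] : cvgn (series (fun j => c j *: eigvec A j)).
  by exists u => j; exact: (inner_orthonormal_series (eigvec_basis A) j cu).
have cc : cvgn (series (fun j => c j ^+ 2)).
  apply: nondecreasing_is_cvgn.
    apply/nondecreasing_seqP => m.
    by rewrite /series/= big_nat_recr//= lerDl sqr_ge0.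
  by exists M => _ [m _ <-]; rewrite /series/= big_mkord.
apply/cauchy_cvgP/cauchy_seriesP => e e0.
have /cauchy_cvgP/cauchy_seriesP/(_ (e ^+ 2)) := cc.
rewrite exprn_gt0// => /(_ isT); apply: filterS => -[m n]/= h.
rewrite -(@ltr_pXn2r _ 2) ?nnegrE//; last exact: ltW.
rewrite (norm_orthonormal_sum (eigvec_basis A)).
by apply: le_lt_trans h; rewrite ler_norm.
Qed.

Lemma cr_basis i j : cr (eigvec A i) j = (i == j)%:R.
Proof. exact: (eigvec_basis A).1. Qed.

Lemma cr_proj n u j : cr (proj A n u) j = if (j < n)%N then cr u j else 0.
Proof.
rewrite /proj /cr inner_suml; case: ifPn => jn.
  rewrite (bigD1 (Ordinal jn))//= innerZl (eigvec_basis A).1 eqxx mulr1.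
  rewrite big1 ?addr0// => i ij; rewrite innerZl (eigvec_basis A).1.
  by rewrite (_ : (i == j :> nat) = false) ?mulr0//; apply: negbTE.
rewrite big1// => i _; rewrite innerZl (eigvec_basis A).1.
have /negPf -> : (i : nat) != j by apply: contraNneq jn => <-.
by rewrite mulr0.
Qed.

Lemma semigroupE t u v : (forall j, cr v j = expR (- lam j * t) * cr u j) ->
  semigroup A t u = v.
Proof.
move=> vE; rewrite /semigroup; apply/cvg_lim => //.
rewrite (_ : (fun j => _) = (fun j => cr v j *: eigvec A j)); first exact: cr_cvg.
by apply/funext => j; rewrite vE.
Qed.

Lemma cr_semigroup t u j : 0 <= t ->
  cr (semigroup A t u) j = expR (- lam j * t) * cr u j.
Proof.
move=> t0; pose c i := expR (- lam i * t) * cr u i.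
have [v vc] : exists v, forall i, cr v i = c i.
  apply: (@cr_exists _ (`|u| ^+ 2)) => m; apply: le_trans (bessel u m).
  apply: ler_sum => i _; rewrite /c exprMn ler_piMl ?sqr_ge0//.
  rewrite exprn_ile1 ?expR_ge0// expR_le1 mulNr oppr_le0 mulr_ge0//.
  exact/ltW/eigval_gt0.
by rewrite (semigroupE vc).
Qed.

(** For negative [t] the factors [expR (- lam j * t)] are unbounded in [j]; with finitely many
    nonzero coordinates the series still converges. *)
Lemma cr_semigroup_fin t u n j : (forall i, (n <= i)%N -> cr u i = 0) ->
  cr (semigroup A t u) j = expR (- lam j * t) * cr u j.
Proof.
move=> un; pose c i := expR (- lam i * t) * cr u i.
have [v vc] : exists v, forall i, cr v i = c i.
  apply: (@cr_exists _ (\sum_(i < n) c i ^+ 2)) => m.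
  have [mn|nm] := leqP m n.
    rewrite -(big_mkord predT (fun i => c i ^+ 2)) -(big_mkord predT (fun i => c i ^+ 2)).
    rewrite (big_cat_nat (n := m) _ mn)//= lerDl; apply: sumr_ge0 => i _; exact: sqr_ge0.
  rewrite -(big_mkord predT (fun i => c i ^+ 2)) -(big_mkord predT (fun i => c i ^+ 2)).
  rewrite (big_cat_nat (n := n) _ (ltnW nm))//= gerDl big_nat big1// => i /andP[ni _].
  by rewrite /c un// mulr0 expr0n.
by rewrite (semigroupE vc).
Qed.

(** Finite rational combinations of the basis, coded as sequences of rationals. Half of [e] pays for
    truncating at m modes, and [e / 2 / (m + 1)] for rounding each of them. *)
Lemma hilbert_dense : exists q : nat -> H, forall u (e : R), 0 < e ->
  exists i, `|u - q i| < e.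
Proof.
pose comb (s : seq rat) : H := \sum_(j < size s) (ratr (nth 0 s j) : R) *: eigvec A j.
pose pk : seq rat -> nat := pickle; pose uk : nat -> option (seq rat) := unpickle.
have pkK : pcancel pk uk by exact: pickleK.
exists (fun k => if uk k is Some s then comb s else 0).
move=> u e e0; have e20 : 0 < e / 2 by rewrite divr_gt0.
have /cvgrPdist_lt/(_ _ e20)[m _ um0] := cr_cvg u.
have um := um0 m (leqnn m).
have ratP (x dd : R) : 0 < dd -> exists r : rat, `|x - ratr r| < dd.
  move=> dd0; have ltc : x < x + dd by rewrite ltrDl.
  have [r rj] := rat_in_itvoo ltc; exists r.
  move: rj; rewrite in_itv/= => /andP[h1 h2]; rewrite ltr_norml; apply/andP; split; lra.
have qP (j : nat) : exists r : rat, `|cr u j - ratr r| < e / 2 / m.+1%:R.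
  by apply: ratP; rewrite divr_gt0.
have [r rE] := choice qP.
exists (pk (mkseq r m)); rewrite pkK.
rewrite -(subrKA (series (fun j => cr u j *: eigvec A j) m)).
rewrite (le_lt_trans (ler_normD _ _))// (splitr e) ltrD//.
rewrite /comb /series/= size_mkseq big_mkord -sumrB.
rewrite (le_lt_trans (ler_norm_sum _ _ _))//.
apply: (@le_lt_trans _ _ (\sum_(j < m) e / 2 / m.+1%:R)).
  apply: ler_sum => j _; rewrite nth_mkseq// -scalerBl normrZ.
  have -> : `|eigvec A j| = 1.
    by apply/eqP; rewrite -(@pexpr_eq1 _ _ 2)// -inner_normE (eigvec_basis A).1 eqxx.
  by rewrite mulr1 ltW.
by rewrite sumr_const card_ord -[_ *+ m]mulr_natr mulrAC ltr_pdivrMr// ltr_pM2l// ltr_nat.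
Qed.

(** By Parseval the distance to a fixed vector is a limit of functions of the coordinates, so all
    later measurability questions reduce to real functions. *)
Lemma borel_measurable_cr d (T : measurableType d) (D : set T) (f : T -> H) :
  measurable D -> (forall j, measurable_fun D (fun s => cr (f s) j)) ->
  borel_measurable D f.
Proof.
move=> mD mf; have [q qd] := hilbert_dense.
apply: (borel_measurable_dist qd) => // i.
apply: (@measurable_fun_cvg _ _ _ _ (fun m s => \sum_(j < m) cr (f s - q i) j ^+ 2)).
  move=> m; apply: (@measurable_sum _ _ _ D _ _ (fun (j : 'I_m) s => cr (f s - q i) j ^+ 2)) => j.
  by apply: measurable_funX; under eq_fun do rewrite crB; apply: measurable_funB.
by move=> s _; exact: parseval.
Qed.

Lemma measurable_cr d (T : measurableType d) (D : set T) (f : T -> H) j :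
  borel_measurable D f -> measurable_fun D (fun s => cr (f s) j).
Proof. by move=> bf; exact: (measurable_fun_borel bf (@cr_continuous j)). Qed.

End coordinates.

Section fractional_coordinates.
Context {R : realType} {H : hilbertType R} (A : spectral_operator H).
Context {alpha : {nonneg R}}.
Notation X := (fracdom A alpha).
Notation lam := (eigval A).
Notation wt j := (lam j `^ alpha%:num).
Implicit Types (x y : X) (c : nat -> R).

Lemma wt_gt0 j : 0 < wt j.
Proof. by rewrite powR_gt0// eigval_gt0. Qed.

Lemma cr_fpow x j : cr A (fpow A alpha%:num x) j = wt j * cr A x j.
Proof.
have h : fpow_series A alpha%:num x @ \oo --> fpow A alpha%:num x by exact: fracdomP.
exact: (@inner_orthonormal_series _ _ _ (eigvec_basis A)
  (fun j => wt j * inner (x : H) (eigvec A j)) _ j h).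
Qed.

Lemma crXD x y j : cr A (x + y : X) j = cr A x j + cr A y j.
Proof. exact: crD. Qed.

Lemma crXB x y j : cr A (x - y : X) j = cr A x j - cr A y j.
Proof. exact: crB. Qed.

Lemma crXZ a x j : cr A (a *: x : X) j = a * cr A x j.
Proof. exact: crZ. Qed.

Lemma crX0 j : cr A (0 : X) j = 0.
Proof. exact: cr0. Qed.

Lemma besselX x m : \sum_(j < m) (wt j * cr A x j) ^+ 2 <= `|x| ^+ 2.
Proof.
apply: le_trans (bessel A (fpow A alpha%:num x) m).
by under [leRHS]eq_bigr do rewrite cr_fpow.
Qed.

Lemma normX_le x (M : R) : 0 <= M ->
  (forall m, \sum_(j < m) (wt j * cr A x j) ^+ 2 <= M ^+ 2) -> `|x| <= M.
Proof.
move=> M0 xM; rewrite fracdom_normE; apply: (@norm_le_cr _ _ A) => // m.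
by under eq_bigr do rewrite cr_fpow.
Qed.

Lemma crX_inj x y : (forall j, cr A x j = cr A y j) -> x = y.
Proof. by move=> xy; apply: val_inj; exact: (cr_inj xy). Qed.

Lemma crX_exists c (M : R) : (forall m, \sum_(j < m) (wt j * c j) ^+ 2 <= M) ->
  exists x : X, forall j, cr A x j = c j.
Proof.
move=> /(@cr_exists _ _ A (fun j => wt j * c j))[y yE]; have [x xy] := @fracdom_fpow_surj _ _ A alpha y.
exists x => j; apply: (mulfI (lt0r_neq0 (wt_gt0 j))).
by rewrite -cr_fpow xy yE.
Qed.

Lemma norm_cr_le x j : `|cr A x j| <= (wt j)^-1 * `|x|.
Proof.
rewrite ler_pdivlMl ?wt_gt0// -(@ler_pXn2r _ 2) ?nnegrE ?mulr_ge0 ?powR_ge0//.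
rewrite exprMn real_normK ?num_real// -exprMn.
by apply: le_trans (besselX x j.+1); rewrite big_ord_recr/= lerDr sumr_ge0// => i _; exact: sqr_ge0.
Qed.

Lemma crX_continuous j : continuous (fun x : X => cr A x j).
Proof.
move=> x; apply: (@cvgrPdist_le _ _ _ (nbhs x) (nbhs_filter x) _ _).2 => e e0.
apply/nbhs_ballP.
exists (wt j * e) => [|y]; first by rewrite /= mulr_gt0 ?wt_gt0.
rewrite -ball_normE/= => /ltW xy; rewrite -crXB (le_trans (norm_cr_le _ _))//.
by rewrite ler_pdivrMl ?wt_gt0.
Qed.

Lemma norm_fd_val_le x : `|x : H| <= (wt 0)^-1 * `|x|.
Proof.
apply: (@norm_le_cr _ _ A) => [|m]; first by rewrite mulr_ge0// invr_ge0 powR_ge0.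
rewrite exprMn exprVn ler_pdivlMl ?exprn_gt0 ?wt_gt0//.
apply: le_trans (besselX x m); rewrite mulr_sumr; apply: ler_sum => j _.
rewrite exprMn ler_wpM2r ?sqr_ge0// ler_pXn2r ?nnegrE ?powR_ge0//.
apply: ge0_ler_powR; rewrite ?nnegrE//; [exact/ltW/eigval_gt0..|].
exact: eigval_nondecreasing.
Qed.

(** A^alpha is an isometry of D(A^alpha) onto H, so a dense sequence of H can be pulled back. *)
Lemma fracdom_dense : exists q : nat -> X, forall x (e : R), 0 < e ->
  exists i, `|x - q i| < e.
Proof.
have [q qd] := hilbert_dense A.
have /choice[r rE] := fun i => @fracdom_fpow_surj _ _ A alpha (q i).
exists r => x e e0; have [i qi] := qd (fpow A alpha%:num x) e e0; exists i.
suff -> : `|x - r i| = `|fpow A alpha%:num x - q i| by [].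
rewrite fracdom_normE; congr (`|_|); apply: (@cr_inj _ _ A) => j.
by rewrite cr_fpow crXB crB -(rE i) !cr_fpow mulrBr.
Qed.

Lemma borel_measurable_crX d (T : measurableType d) (D : set T) (f : T -> X) :
  measurable D -> (forall j, measurable_fun D (fun s => cr A (f s) j)) ->
  borel_measurable D f.
Proof.
move=> mD mf; have [q qd] := fracdom_dense.
apply: (borel_measurable_dist qd) => // i.
apply: (@measurable_fun_cvg _ _ _ _
    (fun m s => \sum_(j < m) cr A (fpow A alpha%:num (f s - q i)) j ^+ 2)); last first.
  by move=> s _; exact: parseval.
move=> m; apply: (@measurable_sum _ _ _ D _ _
  (fun (j : 'I_m) s => cr A (fpow A alpha%:num (f s - q i)) j ^+ 2)) => j.
apply: measurable_funX; under eq_fun do rewrite cr_fpow crXB.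
by apply: measurable_funM => //; apply: measurable_funB.
Qed.

Lemma measurable_crX d (T : measurableType d) (D : set T) (f : T -> X) j :
  borel_measurable D f -> measurable_fun D (fun s => cr A (f s) j).
Proof. by move=> bf; exact: (measurable_fun_borel bf (@crX_continuous j)). Qed.

Lemma measurable_normX d (T : measurableType d) (D : set T) (f : T -> X) :
  measurable D -> (forall j, measurable_fun D (fun s => cr A (f s) j)) ->
  measurable_fun D (fun s => `|f s|).
Proof.
move=> mD mf; apply: (measurable_fun_borel (borel_measurable_crX mD mf)).
exact: norm_continuous.
Qed.

Lemma cr_PnX n x j : cr A (PnX n x) j = if (j < n)%N then cr A x j else 0.
Proof. exact: cr_proj. Qed.

Lemma cr_QnX n x j : cr A (QnX n x) j = if (j < n)%N then 0 else cr A x j.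
Proof. by rewrite crXB cr_PnX; case: ifP; rewrite ?subrr ?subr0. Qed.

(** The norm of the tail is the distance in H from A^alpha x to a partial sum of its defining
    series. *)
Lemma QnX_cvg0 x : `|QnX n x| @[n --> \oo] --> (0 : R).
Proof.
rewrite -(@normr0 _ X); apply: (@cvg_norm _ X _ \oo _ (fun n => QnX n x) 0).
rewrite -(subrr x); apply: cvgB; first exact: cvg_cst.
apply/cvgrPdist_lt => /= e e0.
have /cvgrPdist_lt/(_ _ e0) : fpow_series A alpha%:num x @ \oo --> fpow A alpha%:num x.
  exact: fracdomP.
apply: filterS => n; rewrite fracdom_normE.
rewrite (_ : fpow A alpha%:num x - _ = fpow A alpha%:num (x - PnX n x))//.
apply: (@cr_inj _ _ A) => j; rewrite crB !cr_fpow crXB cr_PnX mulrBr; congr (_ - _).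
rewrite /fpow_series /series/= /cr inner_suml big_mkord.
case: ifPn => jn.
  rewrite (bigD1 (Ordinal jn))//= innerZl (eigvec_basis A).1 eqxx mulr1.
  rewrite big1 ?addr0// => i ij; rewrite innerZl (eigvec_basis A).1.
  by rewrite (_ : (i == j :> nat) = false) ?mulr0//; apply: negbTE.
rewrite mulr0 big1// => i _; rewrite innerZl (eigvec_basis A).1.
have /negPf -> : (i : nat) != j by apply: contraNneq jn => <-.
by rewrite mulr0.
Qed.

End fractional_coordinates.

Section bochner_coordinates.
Context {R : realType} {H : hilbertType R} (A : spectral_operator H).
Context d (T : measurableType d) (mu : measure T R).

Lemma measurable_normH (D : set T) (f : T -> H) : measurable D ->
  (forall j, measurable_fun D (fun s => cr A (f s) j)) ->
  measurable_fun D (fun s => `|f s|).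
Proof.
move=> mD mf; apply: (measurable_fun_borel (borel_measurable_cr mD mf)).
exact: norm_continuous.
Qed.

(** The candidate is built from its coordinates by Minkowski and Riesz-Fischer. Its pairing with [y]
    is the integral of the pairings, clear for finite combinations of the basis and then for all [y]
    by density. Hence the set searched by [xget] is not empty, and every member has these
    coordinates. *)
Lemma bochner_integral_cr (D : set T) (f : T -> H) (phi : T -> R) : measurable D ->
  (forall j, measurable_fun D (fun s => cr A (f s) j)) ->
  mu.-integrable D (EFin \o phi) -> (forall s, D s -> `|f s| <= phi s) ->
  bochner_integrable mu D f /\
  forall j, cr A (bochner_integral mu D f) j = \int[mu]_(s in D) cr A (f s) j.
Proof.
move=> mD mf phii fphi.
have bf : borel_measurable D f := borel_measurable_cr mD mf.
have mn : measurable_fun D (fun s => `|f s|) by exact: measurable_normH.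
have ni : mu.-integrable D (EFin \o (fun s => `|f s|)).
  apply: le_integrable phii => //; first exact/measurable_EFinP.
  move=> s Ds /=; rewrite lee_fin normr_id (le_trans (fphi s Ds))// ler_norm//.
have my y : measurable_fun D (fun s => inner (f s) y).
  apply: (measurable_fun_borel (phi := fun u => inner u y) bf).
  move=> u; apply/cvgrPdist_le => /= e e0; near=> v.
  rewrite -innerBl (le_trans (inner_CauchySchwarz _ _))//.
  apply: (@le_trans _ _ (`|u - v| * (`|y| + 1))); first by rewrite ler_wpM2l// lerDl.
  rewrite -ler_pdivlMr ?ltr_wpDl//; near: v; apply: cvgr_dist_le; first exact: cvg_id.
  by rewrite divr_gt0// ltr_wpDl.
have iy y : mu.-integrable D (EFin \o (fun s => inner (f s) y)).
  apply: (@le_integrable _ _ _ _ _ mD _ (EFin \o (fun s => `|y| * `|f s|))).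
  - exact/measurable_EFinP.
  - move=> s Ds /=; rewrite lee_fin (le_trans (inner_CauchySchwarz _ _))//.
    by rewrite mulrC ler_norm.
  - exact: (integrableZl mD `|y| ni).
have [I IE] : exists I, forall j, cr A I j = \int[mu]_(s in D) cr A (f s) j.
  apply: (@cr_exists _ _ A _ ((\int[mu]_(s in D) `|f s|) ^+ 2)) => m.
  apply: (@sum_sqr_Rintegral_le _ _ _ _ _ _ (fun j s => cr A (f s) j)) => //.
  - by move=> j; exact: iy.
  - by move=> s Ds; exact: bessel.
have Iy y : inner I y = \int[mu]_(s in D) inner (f s) y.
  pose p m := \sum_(j < m) cr A y j *: eigvec A j.
  have py : p @ \oo --> y.
    rewrite (_ : p = series (fun j => cr A y j *: eigvec A j)); first exact: cr_cvg.
    by apply/funext => m; rewrite /series/= big_mkord.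
  have Ip m : inner I (p m) = \int[mu]_(s in D) inner (f s) (p m).
    rewrite /p; transitivity (\sum_(j < m) cr A y j * \int[mu]_(s in D) cr A (f s) j).
      rewrite inner_sumr; apply: eq_bigr => j _.
      by rewrite -IE innerC innerZl innerC.
    elim: m => [|m IH].
      rewrite big_ord0; under eq_Rintegral do rewrite big_ord0 innerC inner0l.
      by rewrite Rintegral_cst// mul0r.
    rewrite big_ord_recr/= IH; under [RHS]eq_Rintegral do
      rewrite big_ord_recr/= innerC innerDl innerC innerZl (innerC (eigvec A m)).
    rewrite (RintegralD mD); last 2 first.
    - exact: iy.
    - exact: (integrableZl mD (cr A y m) (iy (eigvec A m))).
    by rewrite (RintegralZl _ mD (iy (eigvec A m))).
  have c1 : (fun m => inner I (p m)) @ \oo --> inner I y.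
    under eq_fun do rewrite innerC; rewrite innerC; exact: cvg_innerl.
  have c2 : (fun m => inner I (p m)) @ \oo --> \int[mu]_(s in D) inner (f s) y.
    under eq_fun do rewrite Ip.
    apply/cvgrPdist_le => /= e e0.
    pose K := \int[mu]_(s in D) `|f s|.
    have K0 : 0 <= K by apply: Rintegral_ge0.
    near=> m.
    rewrite -(RintegralB mD (iy _) (iy _)).
    have -> : \int[mu]_(s in D) (inner (f s) y - inner (f s) (p m)) =
        \int[mu]_(s in D) inner (f s) (y - p m).
      apply: eq_Rintegral => s _.
      by rewrite ![inner (f s) _]innerC innerBl.
    rewrite (le_trans (le_normr_Rintegral mD (iy _)))//.
    apply: (@le_trans _ _ (`|y - p m| * K)).
      rewrite -(RintegralZl _ mD ni); apply: le_Rintegral => //.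
      - exact: integrable_norm.
      - exact: (integrableZl mD _ ni).
      - by move=> s Ds; rewrite mulrC inner_CauchySchwarz.
    apply: (@le_trans _ _ (`|y - p m| * (K + 1))); first by rewrite ler_wpM2l// lerDl.
    rewrite -ler_pdivlMr ?ltr_wpDl//; near: m; apply: cvgr_dist_le => //.
    by rewrite divr_gt0// ltr_wpDl.
  exact: (cvg_unique _ c1 c2).
have bi : bochner_integrable mu D f by split.
split=> // j; rewrite /bochner_integral.
case: xgetP => [J _ [_ JE]|/(_ I)]; first by rewrite /cr JE.
by case; split.
Unshelve. all: by end_near. Qed.

End bochner_coordinates.

Lemma cauchy_geometric_cvg (R : realType) (V : completeNormedModType R)
    (u : nat -> V) (q C : R) : 0 <= q -> q < 1 ->
  (forall n i, `|u (n + i)%N - u i| <= q ^+ i * C) ->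
  exists l, u @ \oo --> l /\ forall i, `|l - u i| <= q ^+ i * C.
Proof.
move=> q0 q1 uC.
have C0 : 0 <= C by have := uC 0 0; rewrite expr0 mul1r add0n subrr normr0.
have qC0 : q ^+ i * C @[i --> \oo] --> (0 : R).
  rewrite -(mul0r C); apply: cvgMl; apply: cvg_expr.
  by rewrite ger0_norm.
have /cvg_ex[l ul] : cvgn u.
  apply/cauchy_cvgP; apply/cauchy_ballP => e e0.
  have e20 : 0 < e / 2 by rewrite divr_gt0.
  have /cvgrPdist_lt/(_ _ e20)[i _ ie] := qC0.
  have dist n : (i <= n)%N -> `|u i - u n| < e / 2.
    move=> ni; rewrite -(subnK ni) distrC (le_lt_trans (uC _ _))//.
    by have := ie i (leqnn i); rewrite /= sub0r normrN ger0_norm// mulr_ge0 ?exprn_ge0.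
  exists (u @` [set n | (i <= n)%N], u @` [set n | (i <= n)%N]) => /=.
    by split; exists i => // n ni; exists n.
  move=> _/= [[m mi <-] [n ni <-]]; rewrite -ball_normE/=.
  rewrite -(subrKA (u i)) (le_lt_trans (ler_normD _ _))// (splitr e) ltrD//.
    by rewrite distrC dist.
  exact: dist.
exists l; split=> // i.
have dl : `|u n - u i| @[n --> \oo] --> (`|l - u i| : R).
  by apply: cvg_norm; apply: cvgB => //; exact: cvg_cst.
apply: (cvgr_to_le dl); exists i => // n ni.
by rewrite -(subnK ni).
Qed.

(** * Convolution with mode-dependent kernels *)

Section convolution.
Context {R : realType} {H : hilbertType R} (A : spectral_operator H).
Context {alpha : {nonneg R}}.
Notation X := (fracdom A alpha).
Notation lam := (eigval A).
Notation wt j := (lam j `^ alpha%:num).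
Notation leb := (@lebesgue_measure R).
Variables (K : nat -> R -> R) (k : R -> R) (nu : R).

(* [k] is one integrable weighted bound for all the modes: this makes convolution
   with [K] a map from H-valued to D(A^alpha)-valued functions of norm [kmass k]
   in the supremum norm weighted by [expR (nu * t)]. *)
Record kernel : Prop := Kernel {
  kernel_meas : forall j, measurable_fun setT (K j) ;
  kernel_int : leb.-integrable setT (EFin \o k) ;
  kernel_bound : forall j u, wt j * `|K j u| * expR (nu * u) <= k u ;
  kernel_bound1 : forall j u, `|K j u| * expR (nu * u) <= 1 }.

Hypothesis kP : kernel.

Definition kmass := \int[leb]_u k u.

Lemma kernel_ge0 u : 0 <= k u.
Proof.
apply: le_trans (kernel_bound kP 0 u).
by rewrite !mulr_ge0 ?powR_ge0 ?expR_ge0.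
Qed.

Lemma kmass_ge0 : 0 <= kmass.
Proof. by apply: Rintegral_ge0 => u _; exact: kernel_ge0. Qed.

Lemma expR_shift (t s : R) : expR (- (nu * t)) * expR (nu * (t - s)) * expR (nu * s) = 1.
Proof. by rewrite -!expRD (_ : _ + _ = 0) ?expR0//; ring. Qed.

Lemma measurable_kernel_shift (t : R) j : measurable_fun setT (fun s : R => K j (t - s)).
Proof. by apply: (measurableT_comp (kernel_meas kP j)); exact: measurable_reflect. Qed.

(** Common core of the two convolution estimates: a pointwise bound of the weighted coordinates by
    one integrable [phi] passes to the integrals by Minkowski. *)
Lemma conv_dominated (t : R) (f : nat -> R -> R) (phi : R -> R) :
  (forall j, measurable_fun setT (f j)) ->
  leb.-integrable setT (EFin \o phi) -> (forall s, 0 <= phi s) ->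
  (forall m s, \sum_(j < m) (wt j * (K j (t - s) * f j s)) ^+ 2 <= phi s ^+ 2) ->
  (forall j, leb.-integrable setT (EFin \o (fun s => K j (t - s) * f j s))) /\
  forall m, \sum_(j < m) (wt j * \int[leb]_s (K j (t - s) * f j s)) ^+ 2 <=
    (\int[leb]_s phi s) ^+ 2.
Proof.
move=> mf iphi phi0 sumphi.
have int j : leb.-integrable setT (EFin \o (fun s => K j (t - s) * f j s)).
  apply: (@le_integrable _ _ _ leb setT measurableT _ (EFin \o (fun s => (wt j)^-1 * phi s))).
  - apply/measurable_EFinP; apply: measurable_funM; [exact: (measurable_kernel_shift t j)|exact: mf].
  - move=> s _ /=; rewrite lee_fin.
    rewrite [leRHS]ger0_norm ?mulr_ge0 ?invr_ge0 ?powR_ge0//.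
    rewrite ler_pdivlMl ?wt_gt0// -[wt j]ger0_norm ?powR_ge0// -normrM.
    rewrite -(@ler_pXn2r _ 2) ?nnegrE// real_normK ?num_real//.
    apply: le_trans (sumphi j.+1 s); rewrite big_ord_recr/= lerDr sumr_ge0// => i _.
    exact: sqr_ge0.
  - exact: (integrableZl measurableT _ iphi).
split=> // m.
have -> : \sum_(j < m) (wt j * \int[leb]_s (K j (t - s) * f j s)) ^+ 2 =
    \sum_(j < m) (\int[leb]_s (wt j * (K j (t - s) * f j s))) ^+ 2.
  by apply: eq_bigr => j _; rewrite (RintegralZl _ measurableT (int j)).
apply: (@sum_sqr_Rintegral_le _ _ _ leb setT m (fun j s => wt j * (K j (t - s) * f j s))) => //.
by move=> j; exact: (integrableZl measurableT _ (int j)).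
Qed.

(** For inputs that are only H-valued: [kernel_bound] absorbs A^alpha into [k], so the input has to
    be bounded in the weighted supremum norm. *)
Lemma convH (t : R) (f : R -> H) (B : R) :
  (forall j, measurable_fun setT (fun s => cr A (f s) j)) ->
  (forall s, expR (nu * s) * `|f s| <= B) ->
  (forall j, leb.-integrable setT (EFin \o (fun s => K j (t - s) * cr A (f s) j))) /\
  forall m, \sum_(j < m) (wt j * \int[leb]_s (K j (t - s) * cr A (f s) j)) ^+ 2 <=
    (expR (- (nu * t)) * (kmass * B)) ^+ 2.
Proof.
move=> mf fB.
have B0 : 0 <= B by apply: le_trans (fB 0); rewrite mulr_ge0 ?expR_ge0.
have ik : leb.-integrable setT (EFin \o (fun s => k (t - s))).
  exact: (integrable_reflect t (kernel_int kP)).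
have := @conv_dominated t (fun j s => cr A (f s) j)
  (fun s => expR (- (nu * t)) * B * k (t - s)) mf.
move=> /(_ (integrableZl measurableT (expR (- (nu * t)) * B) ik)).
rewrite (RintegralZl _ measurableT ik) Rintegral_reflect; last first.
  by have /measurable_int/measurable_EFinP := kernel_int kP.
rewrite -/kmass [kmass * B]mulrC mulrA; apply => [s|m s].
  by rewrite !mulr_ge0 ?expR_ge0 ?kernel_ge0.
apply: (@le_trans _ _ ((expR (- (nu * t)) * expR (nu * s) * k (t - s)) ^+ 2 * `|f s| ^+ 2)).
  apply: (@le_trans _ _ ((expR (- (nu * t)) * expR (nu * s) * k (t - s)) ^+ 2 *
      \sum_(j < m) cr A (f s) j ^+ 2)); last first.
    by rewrite ler_wpM2l ?sqr_ge0// bessel.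
  rewrite mulr_sumr; apply: ler_sum => j _.
  rewrite mulrA exprMn ler_wpM2r ?sqr_ge0//.
  rewrite -(real_normK (num_real (wt j * K j (t - s)))) ler_pXn2r ?nnegrE//; last first.
    by rewrite !mulr_ge0 ?expR_ge0 ?kernel_ge0.
  rewrite normrM (ger0_norm (powR_ge0 _ _)).
  rewrite -[leLHS]mul1r -(expR_shift t s) -!mulrA ler_wpM2l ?expR_ge0//.
  rewrite mulrCA ler_wpM2l ?expR_ge0//.
  by apply: le_trans (kernel_bound kP j (t - s)); rewrite mulrC.
rewrite -exprMn ler_pXn2r ?nnegrE ?mulr_ge0 ?expR_ge0 ?kernel_ge0//.
rewrite mulrAC ler_wpM2r ?kernel_ge0// -mulrA ler_wpM2l ?expR_ge0//.
Qed.

(** For inputs with values in D(A^alpha): no gain is required, so [kernel_bound1] suffices and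
    weighted integrability in time is enough. *)
Lemma convX (t : R) (h : R -> X) :
  (forall j, measurable_fun setT (fun s => cr A (h s) j)) ->
  leb.-integrable setT (EFin \o (fun s => expR (nu * s) * `|h s|)) ->
  (forall j, leb.-integrable setT (EFin \o (fun s => K j (t - s) * cr A (h s) j))) /\
  forall m, \sum_(j < m) (wt j * \int[leb]_s (K j (t - s) * cr A (h s) j)) ^+ 2 <=
    (expR (- (nu * t)) * \int[leb]_s (expR (nu * s) * `|h s|)) ^+ 2.
Proof.
move=> mh ih.
have := @conv_dominated t (fun j s => cr A (h s) j)
  (fun s => expR (- (nu * t)) * (expR (nu * s) * `|h s|)) mh.
move=> /(_ (integrableZl measurableT (expR (- (nu * t))) ih)).
rewrite (RintegralZl _ measurableT ih); apply => [s|m s].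
  by rewrite !mulr_ge0 ?expR_ge0.
rewrite mulrA exprMn.
apply: (@le_trans _ _ ((expR (- (nu * t)) * expR (nu * s)) ^+ 2 *
    \sum_(j < m) (wt j * cr A (h s) j) ^+ 2)); last first.
  by rewrite ler_wpM2l ?sqr_ge0// besselX.
rewrite mulr_sumr; apply: ler_sum => j _.
rewrite mulrCA exprMn ler_wpM2r ?sqr_ge0//.
rewrite -(real_normK (num_real (K j (t - s)))) ler_pXn2r ?nnegrE ?mulr_ge0 ?expR_ge0//.
rewrite -[leLHS]mul1r -(expR_shift t s) -!mulrA ler_wpM2l ?expR_ge0//.
rewrite mulrCA -[leRHS]mulr1 ler_wpM2l ?expR_ge0//.
by apply: le_trans (kernel_bound1 kP j (t - s)); rewrite mulrC.
Qed.

Lemma convH_dist (t : R) (x y : X) (f : R -> H) (B : R) :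
  (forall j, measurable_fun setT (fun s => cr A (f s) j)) ->
  (forall s, expR (nu * s) * `|f s| <= B) ->
  (forall j, cr A x j - cr A y j = \int[leb]_s (K j (t - s) * cr A (f s) j)) ->
  expR (nu * t) * `|x - y| <= kmass * B.
Proof.
move=> mf fB xy.
have B0 : 0 <= B by apply: le_trans (fB 0); rewrite mulr_ge0 ?expR_ge0.
rewrite mulrC -ler_pdivlMr ?expR_gt0// -expRN mulrC.
apply: normX_le => [|m]; first by rewrite !mulr_ge0 ?expR_ge0 ?kmass_ge0.
under eq_bigr do rewrite crXB xy.
exact: (convH t mf fB).2.
Qed.

End convolution.

(** * Picard iteration with a measurable parameter *)

Section fixpoint.
Context {R : realType} {H : hilbertType R} (A : spectral_operator H).
Context {alpha : {nonneg R}} d (T : measurableType d).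
Notation X := (fracdom A alpha).
Notation leb := (@lebesgue_measure R).

(** Joint measurability in parameter and time, required of the coordinates so that Fubini applies to
    real functions. *)
Definition jmeasX (f : T -> R -> X) : Prop :=
  forall j, measurable_fun setT (fun p : T * R => cr A (f p.1 p.2) j).

Definition jmeasH (f : T -> R -> H) : Prop :=
  forall j, measurable_fun setT (fun p : T * R => cr A (f p.1 p.2) j).

Lemma jmeasX1 f w j : jmeasX f -> measurable_fun setT (fun s => cr A (f w s) j).
Proof.
move=> /(_ j) mf.
exact: (measurable_fun_pair2 w mf).
Qed.

Lemma jmeasH1 f w j : jmeasH f -> measurable_fun setT (fun s => cr A (f w s) j).
Proof.
move=> /(_ j) mf.
exact: (measurable_fun_pair2 w mf).
Qed.

Lemma measurable_convolution (K : R -> R) (f : T * R -> R) : measurable_fun setT K ->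
  measurable_fun setT f ->
  measurable_fun setT (fun p : T * R => \int[leb]_s (K (p.2 - s) * f (p.1, s))).
Proof.
move=> mK mf.
apply: (@measurable_fun_Rintegral R _ _ (fun q : (T * R) * R => K (q.1.2 - q.2) * f (q.1.1, q.2))).
apply: measurable_funM.
  apply: (measurableT_comp mK); apply: measurable_funB; last exact: measurable_snd.
  by apply: (measurableT_comp measurable_snd); exact: measurable_fst.
apply: (measurableT_comp mf); apply: measurable_fun_pair; last exact: measurable_snd.
by apply: (measurableT_comp measurable_fst); exact: measurable_fst.
Qed.

Variables (K : nat -> R -> R) (k : R -> R) (nu L : R).
Hypothesis kP : @kernel _ _ A alpha K k nu.
Let q := kmass k * L.
Hypotheses (L0 : 0 <= L) (q1 : q < 1).
Variables (b : T -> R -> X) (N : T -> R -> X -> H).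
Hypothesis mb : jmeasX b.
Hypothesis bB : forall w, exists B, forall t, expR (nu * t) * `|b w t| <= B.
Hypothesis mN : forall f, jmeasX f -> jmeasH (fun w s => N w s (f w s)).
Hypothesis N0 : forall w s, N w s 0 = 0.
Hypothesis NL : forall w s x y, `|N w s x - N w s y| <= L * `|x - y|.

Let q0 : 0 <= q. Proof. by rewrite mulr_ge0 ?(kmass_ge0 kP). Qed.

Let good (f : T -> R -> X) :=
  jmeasX f /\ forall w, exists B, forall t, expR (nu * t) * `|f w t| <= B.

(** One Picard step as a relation between coordinates; that a vector with these coordinates exists
    is the separate fact [step]. *)
Let eqn (f f' : T -> R -> X) := forall w t j,
  cr A (f' w t) j = cr A (b w t) j + \int[leb]_s (K j (t - s) * cr A (N w s (f w s)) j).

Let NLw (f g : T -> R -> X) w s B : expR (nu * s) * `|f w s - g w s| <= B ->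
  expR (nu * s) * `|N w s (f w s) - N w s (g w s)| <= L * B.
Proof.
move=> fB; apply: (@le_trans _ _ (L * (expR (nu * s) * `|f w s - g w s|))).
  by rewrite mulrCA ler_wpM2l ?expR_ge0.
by rewrite ler_wpM2l.
Qed.

Let NBw (f : T -> R -> X) w s B : expR (nu * s) * `|f w s| <= B ->
  expR (nu * s) * `|N w s (f w s)| <= L * B.
Proof.
move=> fB; rewrite -[N w s (f w s)]subr0 -(N0 w s).
by apply: (@NLw f (fun _ _ => 0)); rewrite subr0.
Qed.

Let eqn_contract (f g f' g' : T -> R -> X) w B : good f -> good g ->
  eqn f f' -> eqn g g' ->
  (forall t, expR (nu * t) * `|f w t - g w t| <= B) ->
  forall t, expR (nu * t) * `|f' w t - g' w t| <= q * B.
Proof.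
move=> [mf fB] [mg gB] ff' gg' fgB t.
have mNf := mN mf; have mNg := mN mg.
rewrite /q -mulrA.
apply: (convH_dist kP (f := fun s => N w s (f w s) - N w s (g w s))).
- move=> j; under eq_fun do rewrite crB.
  by apply: measurable_funB; [exact: (@jmeasH1 (fun w s => N w s (f w s)))|
    exact: (@jmeasH1 (fun w s => N w s (g w s)))].
- by move=> s; exact: NLw.
- move=> j; rewrite ff' gg' opprD addrACA subrr add0r.
  have [Bf Bfw] := fB w; have [Bg Bgw] := gB w.
  have [if_ _] := convH kP t (fun j => @jmeasH1 (fun w s => N w s (f w s)) w j mNf)
    (fun s => NBw (Bfw s)).
  have [ig_ _] := convH kP t (fun j => @jmeasH1 (fun w s => N w s (g w s)) w j mNg)
    (fun s => NBw (Bgw s)).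
  rewrite -(RintegralB measurableT (if_ j) (ig_ j)).
  by apply: eq_Rintegral => s _; rewrite crB mulrBr.
Qed.

(** Since [N] vanishes at 0, the image of the zero function is [b]; the contraction estimate against
    it bounds the image of [f]. *)
Let eqn_good (f f' : T -> R -> X) : good f -> eqn f f' -> good f'.
Proof.
move=> gf ff'; split=> [j|w].
  apply: (eq_measurable_fun (fun p : T * R => cr A (b p.1 p.2) j +
     \int[leb]_s (K j (p.2 - s) * cr A (N p.1 s (f p.1 s)) j))).
    by move=> p _; rewrite ff'.
  apply: measurable_funD; first exact: mb.
  apply: (measurable_convolution (f := fun p : T * R => cr A (N p.1 p.2 (f p.1 p.2)) j)).
    exact: (kernel_meas kP).
  exact: (mN gf.1).
have [Bb bBw] := bB w; have [B fB] := gf.2 w.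
exists (q * B + Bb) => t.
have g0 : good (fun _ _ => 0).
  split=> [j|w']; first by under eq_fun do rewrite crX0; exact: measurable_cst.
  by exists 0 => s; rewrite normr0 mulr0.
have e0 : eqn (fun _ _ => 0) b.
  move=> w' t' j; under eq_Rintegral do rewrite N0 cr0 mulr0.
  by rewrite Rintegral_cst// mul0r addr0.
rewrite -[f' w t](subrK (b w t)).
apply: (@le_trans _ _ (expR (nu * t) * (`|f' w t - b w t| + `|b w t|))).
  by rewrite ler_wpM2l ?expR_ge0// ler_normD.
rewrite mulrDr lerD//; apply: (eqn_contract gf g0 ff' e0) => s.
by rewrite subr0.
Qed.

Let step (f : T -> R -> X) : good f -> exists f', eqn f f'.
Proof.
move=> gf.
have ex w t : exists x : X, forall j, cr A x j = cr A (b w t) j +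
    \int[leb]_s (K j (t - s) * cr A (N w s (f w s)) j).
  have [B fB] := gf.2 w.
  have [_ sB] := convH kP t (fun j => @jmeasH1 (fun w s => N w s (f w s)) w j (mN gf.1))
    (fun s => NBw (fB s)).
  have [y yE] := @crX_exists _ _ A alpha
    (fun j => \int[leb]_s (K j (t - s) * cr A (N w s (f w s)) j)) _ sB.
  by exists (b w t + y) => j; rewrite crXD yE.
have ex' w : exists g : R -> X, forall t j, cr A (g t) j = cr A (b w t) j +
    \int[leb]_s (K j (t - s) * cr A (N w s (f w s)) j).
  by have [g gE] := choice (ex w); exists g.
by have [g gE] := choice ex'; exists g.
Qed.

Let next (f : T -> R -> X) : T -> R -> X := xget f [set f' | eqn f f'].

Let nextP f : good f -> eqn f (next f).
Proof. by move=> /step[f' ff']; rewrite /next; case: xgetP => // /(_ f'). Qed.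

Let u (i : nat) : T -> R -> X := iter i next (fun _ _ => 0).

Let ug i : good (u i).
Proof.
elim: i => [|i IH]; last exact: (eqn_good IH (nextP IH)).
split=> [j|w']; first by under eq_fun do rewrite crX0; exact: measurable_cst.
by exists 0 => s; rewrite normr0 mulr0.
Qed.

Let uS i : eqn (u i) (u i.+1). Proof. exact: nextP. Qed.

Let ub w : exists C, forall n i t,
  expR (nu * t) * `|u (n + i)%N w t - u i w t| <= q ^+ i * C.
Proof.
have [B bBw] := bB w.
have B0 : 0 <= B by apply: le_trans (bBw 0); rewrite mulr_ge0 ?expR_ge0.
have q1' : 0 < 1 - q by rewrite subr_gt0.
(* This constant solves [C = q * C + B], so it bounds every iterate; the induction on [i] then gains
   a factor [q] per step. *)
exists (B / (1 - q)) => n i; elim: i => [|i IH] t.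
  rewrite expr0 mul1r addn0 [u 0 w t]/= subr0.
  elim: n t => [|n IH] t; first by rewrite [u 0 w t]/= normr0 mulr0 divr_ge0// ltW.
  have e0 : eqn (fun _ _ => 0) b.
    move=> w' t' j; under eq_Rintegral do rewrite N0 cr0 mulr0.
    by rewrite Rintegral_cst// mul0r addr0.
  rewrite -[u n.+1 w t](subrK (b w t)).
  apply: (@le_trans _ _ (expR (nu * t) * (`|u n.+1 w t - b w t| + `|b w t|))).
    by rewrite ler_wpM2l ?expR_ge0// ler_normD.
  have -> : B / (1 - q) = q * (B / (1 - q)) + B by field; rewrite gt_eqF.
  rewrite mulrDr lerD//; apply: (eqn_contract (ug n) (ug 0) (uS n) e0) => s.
  by rewrite [u 0 w s]/= subr0.
rewrite addnS exprS -mulrA.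
exact: (eqn_contract (ug (n + i)%N) (ug i) (uS _) (uS _)).
Qed.

(** Banach's argument run for all [w] together: the bounds may depend on [w], but the solution is a
    pointwise limit of jointly measurable iterates and is therefore jointly measurable. *)
Lemma fixpoint_exists : exists f : T -> R -> X,
  [/\ jmeasX f, forall w, exists C, forall t, expR (nu * t) * `|f w t| <= C &
      forall w t j, cr A (f w t) j = cr A (b w t) j +
        \int[leb]_s (K j (t - s) * cr A (N w s (f w s)) j)].
Proof.
(* The limit is taken at each time separately, with an error bound for every valid constant, so that
   the constant uniform in weighted time can be inserted afterwards. *)
have lim1 w t : exists l, u ^~ w ^~ t @ \oo --> l /\
    forall C, (forall n i, `|u (n + i)%N w t - u i w t| <= q ^+ i * C) ->
    forall i, `|l - u i w t| <= q ^+ i * C.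
  have [C uC] := ub w.
  have uC' n i : `|u (n + i)%N w t - u i w t| <= q ^+ i * (expR (- (nu * t)) * C).
    by rewrite mulrCA expRN -ler_pdivrMl ?invr_gt0 ?expR_gt0// invrK.
  have [l [ul _]] := cauchy_geometric_cvg q0 q1 uC'.
  exists l; split=> // C' uC'' i.
  have [l' [ul' l'C]] := cauchy_geometric_cvg q0 q1 uC''.
  by rewrite (cvg_unique _ ul ul').
have lim2 w : exists g : R -> X, forall t, u ^~ w ^~ t @ \oo --> g t /\
    forall C, (forall n i, `|u (n + i)%N w t - u i w t| <= q ^+ i * C) ->
    forall i, `|g t - u i w t| <= q ^+ i * C.
  by have [g gE] := choice (lim1 w); exists g.
have [f fE] := choice lim2.
have fu w : exists C, forall i t, expR (nu * t) * `|f w t - u i w t| <= q ^+ i * C.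
  have [C uC] := ub w; exists C => i t.
  rewrite -ler_pdivlMl ?expR_gt0// -expRN mulrCA; apply: (fE w t).2 => n i'.
  by rewrite mulrCA expRN -ler_pdivrMl ?invr_gt0 ?expR_gt0// invrK.
have gf : good f.
  split=> [j|w].
    apply: (@measurable_fun_cvg _ _ _ _ (fun i p => cr A (u i p.1 p.2) j)).
      by move=> i; exact: (ug i).1.
    move=> p _.
    exact: (@continuous_cvg _ X R \oo _ (fun i => u i p.1 p.2) (fun x : X => cr A x j) _
      (@crX_continuous _ _ A alpha j (f p.1 p.2)) (fE p.1 p.2).1).
  by have [C fC] := fu w; exists C => t; have := fC 0 t; rewrite expr0 mul1r [u 0 w t]/= subr0.
exists f; split; [exact: gf.1|exact: gf.2|].
(* The image [f'] of the limit is also the limit of the iterates [u i.+1], hence equals [f]. *)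
have [f' ff'] := step gf.
suff f'f w t : f' w t = f w t by move=> w t j; rewrite -ff' f'f.
have [C fC] := fu w.
have f'u i : expR (nu * t) * `|f' w t - u i.+1 w t| <= q ^+ i.+1 * C.
  rewrite exprS -mulrA; exact: (eqn_contract gf (ug i) ff' (uS i)).
have cu : (fun i => u i.+1 w t) @ \oo --> f' w t.
  apply/cvgrPdist_le => /= e e0.
  have qC0 : q ^+ i.+1 * C @[i --> \oo] --> (0 : R).
    rewrite -(mul0r C); apply: cvgMl.
    by rewrite (cvg_shiftS (fun i => q ^+ i)); apply: cvg_expr; rewrite ger0_norm.
  have e0' : 0 < expR (nu * t) * e by rewrite mulr_gt0 ?expR_gt0.
  have /cvgrPdist_le/(_ _ e0') := qC0; apply: filterS => i /=.
  rewrite sub0r normrN => h.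
  have := le_trans (f'u i) (le_trans (ler_norm _) h).
  by rewrite ler_pM2l ?expR_gt0.
have cu' : (fun i => u i.+1 w t) @ \oo --> f w t.
  by have := (fE w t).1; rewrite -(@cvg_shiftS X (fun i => u i w t)).
exact: (cvg_unique _ cu cu').
Qed.

End fixpoint.
Arguments jmeasX1 {R H A alpha d T f} w j _.
Arguments jmeasH1 {R H A d T f} w j _.

(** * The kernels of the semigroup and the size of their mass *)

Section spectral_kernel.
Context {R : realType} {H : hilbertType R} (A : spectral_operator H).
Context {alpha : {nonneg R}}.
Notation X := (fracdom A alpha).
Notation lam := (eigval A).
Notation a := (alpha%:num).
Notation wt j := (lam j `^ alpha%:num).
Notation leb := (@lebesgue_measure R).
Hypothesis a_lt1 : a < 1.

(* For [sgm], the Green kernel of [d/dt + A] whose first [n] modes are solved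
   backward in time; otherwise these modes are dropped. *)
Definition skernel (sgm : bool) (n j : nat) (u : R) : R :=
  if 0 < u then (if (j < n)%N then 0 else expR (- lam j * u))
  else (if sgm && (j < n)%N then - expR (- lam j * u) else 0).

Lemma measurable_skernel sgm n j : measurable_fun setT (skernel sgm n j).
Proof.
have mE : measurable_fun setT (fun s : R => expR (- lam j * s)).
  by under eq_fun do rewrite mulNr; exact: measurable_expRM.
apply: measurable_fun_ifT; first exact: measurable_fun_ltr.
  by case: (j < n)%N.
by case: (sgm && (j < n)%N) => //; exact: measurableT_comp.
Qed.

(** The weight exponent [nu] has to separate the rates: below [l] for the modes that decay forward,
    above the rates of those solved backward. The two distances become the exponents of the
    profile. *)
Lemma skernel_kernel (sgm : bool) n (nu l b d' : R) : 0 < l -> nu < l -> 0 <= b -> 0 < d' ->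
  (forall j, (n <= j)%N -> l <= lam j) ->
  (forall j, sgm -> (j < n)%N -> wt j <= b /\ d' <= nu - lam j) ->
  @kernel _ _ A alpha (skernel sgm n) (wprofile a (l `^ a) b (l - nu) d') nu.
Proof.
move=> l0 nul b0 d'0 nl jn.
have a0 : 0 <= a by [].
have d0 : 0 < l - nu by rewrite subr_gt0.
split.
- exact: measurable_skernel.
- by apply: integrable_wprofile => //; exact: powR_ge0.
- move=> j u; rewrite /skernel /wprofile; case: ltP => u0.
    case: ltnP => nj.
      by rewrite normr0 mulr0 mul0r !mulr_ge0 ?expR_ge0// addr_ge0 ?sing_ge0 ?powR_ge0.
    rewrite ger0_norm ?expR_ge0// mulNr.
    apply: (@le_trans _ _ ((sing a u + l `^ a) * expR (- (l * u)) * expR (nu * u))).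
      rewrite ler_wpM2r ?expR_ge0// powR_expRN_profile ?nl//; exact: ltW.
    by rewrite -mulrA -expRD (_ : - (l * u) + nu * u = - ((l - nu) * u))//; ring.
  case: ifP => [/andP[s nj]|_]; last first.
    by rewrite normr0 mulr0 mul0r mulr_ge0 ?expR_ge0.
  have [wb dd] := jn j s nj.
  rewrite normrN ger0_norm ?expR_ge0// -mulrA -expRD ler_pM ?powR_ge0 ?expR_ge0//.
  rewrite ler_expR mulNr -mulNr -mulrDl ler_wnM2r//.
  by rewrite addrC.
- move=> j u; rewrite /skernel; case: ltP => u0.
    case: ltnP => nj; first by rewrite normr0 mul0r ler01.
    rewrite ger0_norm ?expR_ge0// -expRD expR_le1 -mulrDl pmulr_lle0//.
    by have := nl j nj; lra.
  case: ifP => [/andP[s nj]|_]; last by rewrite normr0 mul0r ler01.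
  have [wb dd] := jn j s nj.
  rewrite normrN ger0_norm ?expR_ge0// -expRD expR_le1 -mulrDl mulr_ge0_le0//.
  lra.
Qed.

Lemma kmass_wprofile p b d d' : 0 <= p -> 0 <= b -> 0 < d -> 0 < d' ->
  kmass (wprofile a p b d d') = c_alpha a * d `^ (a - 1) + p / d + b / d'.
Proof. by move=> *; rewrite /kmass Rintegral_wprofile. Qed.

Hypothesis a_lt12 : a < 2^-1.

(** As [a < 1/2], the exponent is below [- 1/2]. Choosing rates as squares thus gives explicit
    constants below. *)
Lemma powR_sqr_le (D : R) : 1 <= D -> (D ^+ 2) `^ (a - 1) <= D^-1.
Proof.
move=> D1; have D0 : 0 < D by lra.
have D21 : 1 <= D ^+ 2 by rewrite exprn_ege1.
apply: (@le_trans _ _ ((D ^+ 2) `^ (- 2^-1))); first by apply: ler_powR => //; move: a_lt12; move: (a) => x hx; lra.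
rewrite -powR_mulrn; last exact: ltW.
rewrite -powRrM (_ : _ * _ = -1); last by field.
by rewrite powR_inv1// ltW.
Qed.

(** With all modes solved forward, a sufficiently negative weight exponent makes the mass small for
    any Lipschitz constant: the usual weighted norm that gives solvability without a smallness
    condition. *)
Lemma forward_kernel (L : R) : 0 <= L -> exists nu k,
  [/\ nu < 0, @kernel _ _ A alpha (skernel false 0) k nu & kmass k * L < 1].
Proof.
move=> L0; have l0 := eigval_gt0 A 0; have c0 := c_alpha_ge0 a.
pose M := c_alpha a + wt 0.
have M0 : 0 < M by rewrite ltr_wpDl// wt_gt0.
(* The mass is at most [M / D], so [D > L * M] makes the map a contraction; [D > lam 0] together
   with [D <= D^2] makes the weight exponent negative. *)
pose D := 2 * L * M + 1 + lam 0.
have LM : 0 <= 2 * L * M by rewrite !mulr_ge0// ltW.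
have D1 : 1 <= D by rewrite /D; lra.
have D0 : 0 < D by lra.
have DD : D <= D ^+ 2 by rewrite expr2 ler_peMl// ltW.
(* The values 0 and 1 fill the backward branch of the profile, where there are no modes. *)
exists (lam 0 - D ^+ 2), (wprofile a (wt 0) 0 (lam 0 - (lam 0 - D ^+ 2)) 1); split.
- by rewrite subr_lt0; apply: lt_le_trans DD; rewrite /D; lra.
- apply: skernel_kernel => //.
  + by rewrite ltrBlDr ltrDl exprn_gt0.
  + by move=> j _; exact: eigval_nondecreasing.
rewrite subKr kmass_wprofile ?powR_ge0 ?exprn_gt0// mul0r addr0.
apply: (@le_lt_trans _ _ (M / D * L)).
  rewrite ler_wpM2r// mulrDl lerD//.
    by rewrite ler_wpM2l// powR_sqr_le.
  by rewrite ler_wpM2l ?powR_ge0// lef_pV2 ?posrE ?exprn_gt0.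
by rewrite mulrAC ltr_pdivrMr// mul1r /D; lra.
Qed.

(** With the first [m] modes dropped and no weight the mass is [(c_alpha a + 1) * lam m ^ (a - 1)],
    which tends to 0. It controls the high modes of solutions in the proof of continuity. *)
Lemma tail_kernel (e : R) : 0 < e -> exists m0, forall m, (m0 <= m)%N -> exists k,
  @kernel _ _ A alpha (skernel false m) k 0 /\ kmass k <= e.
Proof.
move=> e0; have c0 := c_alpha_ge0 a.
pose D := (c_alpha a + 1) / e + 1.
have D1 : 1 <= D by rewrite /D lerDr divr_ge0// ?ltW//; lra.
have D0 : 0 < D by lra.
have [m0 _ m0D] : \forall m \near \oo, D ^+ 2 <= lam m.
  by move/cvgryPge : (@eigval_cvgy _ _ A); exact.
exists m0 => m m0m; have lm := m0D m m0m; have l0 := eigval_gt0 A m.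
exists (wprofile a (wt m) 0 (lam m - 0) 1); split.
  apply: skernel_kernel => // j mj; exact: eigval_nondecreasing.
rewrite subr0 kmass_wprofile ?powR_ge0// mul0r addr0.
have -> : wt m / lam m = lam m `^ (a - 1).
  by rewrite -[X in _ / X](powRr1 (ltW l0)) -powRB// lt0r_neq0 ?implybT.
rewrite -[X in _ + X]mul1r -mulrDl.
have lmD : lam m `^ (a - 1) <= D^-1.
  apply: le_trans (powR_sqr_le D1).
  have -> : a - 1 = - (1 - a) by ring.
  rewrite !powRN lef_pV2 ?posrE ?powR_gt0 ?exprn_gt0//.
  apply: ge0_ler_powR => //; first by rewrite subr_ge0 ltW.
    by rewrite nnegrE exprn_ge0// ltW.
  by rewrite nnegrE ltW.
apply: (@le_trans _ _ ((c_alpha a + 1) * D^-1)).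
  by rewrite ler_wpM2l// addr_ge0.
rewrite ler_pdivrMr// /D mulrDr mulr1 mulrCA divff ?gt_eqF// mulr1 lerDl.
exact: ltW.
Qed.

Section lyapunov_perron_kernel.
Variables (L k : R) (n : nat).
Hypotheses (L0 : 0 < L) (k0 : 0 < k) (n0 : (0 < n)%N).
Let lam_n := lam n.-1.
Let lam_n1 := lam n.
Hypothesis gap : lam_n1 - lam_n >= 2 * L / k *
    (lam_n1 `^ a + lam_n `^ a + c_alpha a * (lam_n1 - lam_n) `^ a).
Let mu := lam_n + 2 * L / k * lam_n `^ a.
Let Lk0 : 0 < 2 * L / k. Proof. by rewrite !mulr_gt0 ?invr_gt0. Qed.
Let d' := 2 * L / k * lam_n `^ a.
Let d'0 : 0 < d'. Proof. by rewrite mulr_gt0 ?wt_gt0. Qed.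

(** [mu] cuts the spectral gap in two: the term with [lam_n ^ a] is the part below it, the remaining
    terms fit above. *)
Lemma lyapunov_perron_gap : lam_n < mu /\
  mu + 2 * L / k * (lam_n1 `^ a + c_alpha a * (lam_n1 - lam_n) `^ a) <= lam_n1.
Proof.
by split; [rewrite /mu ltrDl; exact: d'0|move: gap; rewrite /mu !mulrDr; lra].
Qed.

Lemma lyapunov_perron_mu_lt : mu < lam_n1.
Proof.
have [_ h] := lyapunov_perron_gap.
apply: lt_le_trans h; rewrite ltrDl mulr_gt0// ltr_wpDr ?wt_gt0//.
by rewrite mulr_ge0 ?c_alpha_ge0 ?powR_ge0.
Qed.

(** The backward modes contribute exactly [k / (2 * L)], because [mu - lam_n] was chosen
    proportional to [lam_n ^ a]; the gap condition bounds the contribution of the forward modes by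
    the same amount. *)
Lemma lyapunov_perron_kernel : exists kp,
  @kernel _ _ A alpha (skernel true n) kp mu /\ kmass kp * L <= k.
Proof.
have [nmu h] := lyapunov_perron_gap; have mun := lyapunov_perron_mu_lt.
have d0 : 0 < lam_n1 - mu by rewrite subr_gt0.
exists (wprofile a (lam_n1 `^ a) (lam_n `^ a) (lam_n1 - mu) d'); split.
  apply: skernel_kernel => //; rewrite ?powR_ge0//.
  - exact: eigval_gt0.
  - by move=> j nj; exact: eigval_nondecreasing.
  - move=> j _ jn; have jl : lam j <= lam_n by apply: eigval_nondecreasing; rewrite -ltnS prednK.
    split; last by rewrite /d' /mu; lra.
    by apply: ge0_ler_powR => //; rewrite ?nnegrE; exact/ltW/eigval_gt0.
rewrite kmass_wprofile ?powR_ge0//.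
have -> : lam_n `^ a / d' = k / (2 * L).
  rewrite /d'; field; rewrite !gt_eqF ?wt_gt0//.
set d := lam_n1 - mu in d0 *.
have dd : d <= lam_n1 - lam_n by rewrite /d; lra.
have da : d `^ (a - 1) = d `^ a / d.
  by rewrite -[X in _ / X](powRr1 (ltW d0)) -powRB// lt0r_neq0 ?implybT.
(* The gap condition speaks of the whole gap; replacing it by the smaller [d] inside the power only
   weakens the left side. *)
have key : 2 * L / k * (lam_n1 `^ a + c_alpha a * d `^ a) <= d.
  apply: (@le_trans _ _ (2 * L / k * (lam_n1 `^ a + c_alpha a * (lam_n1 - lam_n) `^ a))).
    rewrite (ler_wpM2l (ltW Lk0))// lerD2l ler_wpM2l ?c_alpha_ge0//.
    by apply: ge0_ler_powR => //; rewrite nnegrE ltW// (lt_le_trans d0 dd).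
  by rewrite /d lerBrDl.
have key2 : c_alpha a * d `^ (a - 1) + lam_n1 `^ a / d <= k / (2 * L).
  rewrite da mulrA -mulrDl ler_pdivrMr// addrC.
  have kL : 0 <= k / (2 * L) by rewrite divr_ge0 ?ltW// mulr_gt0.
  have := ler_wpM2l kL key; apply: le_trans.
  rewrite le_eqVlt; apply/orP; left; apply/eqP; field; rewrite !gt_eqF//.
rewrite -ler_pdivlMr//; apply: (@le_trans _ _ (k / (2 * L) + k / (2 * L))).
  exact: lerD.
by rewrite le_eqVlt; apply/orP; left; apply/eqP; field; rewrite gt_eqF.
Qed.

End lyapunov_perron_kernel.

End spectral_kernel.

(** * The semilinear equation on the whole line *)

Section line_equation.
Context {R : realType} {H : hilbertType R} (A : spectral_operator H).
Context {alpha : {nonneg R}} d (T : measurableType d).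
Notation X := (fracdom A alpha).
Notation leb := (@lebesgue_measure R).
Variables (F : X -> H) (L : R).
Hypothesis L0 : 0 <= L.
Hypothesis FL : forall x y : X, `|F x - F y| <= L * `|x - y|.

Lemma lipschitz_F_continuous : continuous F.
Proof.
move=> x; apply: (@cvgrPdist_le _ _ _ (nbhs x) (nbhs_filter x) _ _).2 => e e0.
have L1 : 0 < L + 1 by rewrite ltr_wpDl.
apply/nbhs_ballP; exists (e / (L + 1)) => [|y]; first by rewrite /= divr_gt0.
rewrite -ball_normE/= => /ltW xy; rewrite (le_trans (FL _ _))//.
apply: (@le_trans _ _ ((L + 1) * `|x - y|)); first by rewrite ler_wpM2r// lerDl.
by rewrite -ler_pdivlMl// mulrC.
Qed.

Lemma measurable_comp_F d' (T' : measurableType d') (D : set T') (f : T' -> X) j :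
  measurable D -> (forall j, measurable_fun D (fun s => cr A (f s) j)) ->
  measurable_fun D (fun s => cr A (F (f s)) j).
Proof.
move=> mD mf; apply: (@measurable_cr _ _ A _ _ D (F \o f)).
apply: borel_measurable_continuous; last exact: lipschitz_F_continuous.
exact: borel_measurable_crX.
Qed.

Lemma jmeasX_add (f g : T -> R -> X) : jmeasX f -> jmeasX g -> jmeasX (fun w s => f w s + g w s).
Proof.
move=> mf mg j; under eq_fun do rewrite crXD.
by apply: measurable_funD; [exact: mf|exact: mg].
Qed.

Lemma jmeasH_comp_F (f : T -> R -> X) : jmeasX f -> jmeasH A (fun w s => F (f w s)).
Proof. by move=> mf j; apply: (measurable_comp_F (f := fun p : T * R => f p.1 p.2)). Qed.

Lemma measurable_snd_bool (D : R -> bool) : measurable_fun setT D ->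
  measurable_fun setT (fun p : T * R => D p.2).
Proof. by move=> mD; apply: (measurableT_comp mD); exact: measurable_snd. Qed.

Variables (K : nat -> R -> R) (k : R -> R) (nu : R).
Hypothesis kP : @kernel _ _ A alpha K k nu.
Hypothesis q1 : kmass k * L < 1.
Variables (D : R -> bool) (b0 a h : T -> R -> X) (f : T -> R -> H).
Hypothesis mD : measurable_fun setT D.
Hypotheses (mb0 : jmeasX b0) (ma : jmeasX a) (mh : jmeasX h) (mf : jmeasH A f).
Hypothesis b0B : forall w, exists B, forall t, expR (nu * t) * `|b0 w t| <= B.
Hypothesis fB : forall w, exists B, forall t, expR (nu * t) * `|f w t| <= B.
Hypothesis hI : forall w,
  leb.-integrable setT (EFin \o (fun s => expR (nu * s) * `|h w s|)).

(** Subtracting [F (a w s)] makes the nonlinearity vanish at 0, so that the iteration can start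
    there; the cut [D] selects the times at which it acts. A bounded interval, a half line and the
    whole line all occur later. *)
Definition cutdiff w s (x : X) : H := if D s then F (x + a w s) - F (a w s) else 0.

Lemma cutdiff_lip w s x y : `|cutdiff w s x - cutdiff w s y| <= L * `|x - y|.
Proof.
rewrite /cutdiff; case: ifP => _; last by rewrite subr0 normr0 mulr_ge0.
rewrite opprB addrA subrK (le_trans (FL _ _))//.
by rewrite opprD addrACA subrr addr0.
Qed.

Lemma cutdiff0 w s : cutdiff w s 0 = 0.
Proof. by rewrite /cutdiff add0r subrr if_same. Qed.

Lemma jmeasH_cutdiff (x : T -> R -> X) : jmeasX x -> jmeasH A (fun w s => cutdiff w s (x w s)).
Proof.
move=> mx j.
apply: (eq_measurable_fun (fun p : T * R => if D p.2 then
    cr A (F (x p.1 p.2 + a p.1 p.2)) j - cr A (F (a p.1 p.2)) j else 0)).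
  by move=> p _; rewrite /cutdiff; case: ifP => _; rewrite ?cr0 ?crB.
apply: measurable_fun_ifT => //; first exact: measurable_snd_bool.
apply: measurable_funB; last exact: (jmeasH_comp_F ma).
by apply: (jmeasH_comp_F (f := fun w s => x w s + a w s)); exact: jmeasX_add.
Qed.

Lemma cutdiff_bound w (x : R -> X) C :
  (forall t, expR (nu * t) * `|x t| <= C) ->
  forall t, expR (nu * t) * `|cutdiff w t (x t)| <= L * C.
Proof.
move=> xC t; rewrite -[cutdiff _ _ _]subr0 -(cutdiff0 w t).
apply: (@le_trans _ _ (expR (nu * t) * (L * `|x t|))).
  by rewrite ler_wpM2l ?expR_ge0// (le_trans (cutdiff_lip _ _ _ _))// subr0.
by rewrite mulrCA ler_wpM2l.
Qed.

Lemma line_equation : exists x : T -> R -> X,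
  [/\ jmeasX x, forall w, exists C, forall t, expR (nu * t) * `|x w t| <= C &
      forall w t j,
        leb.-integrable setT (EFin \o (fun s => K j (t - s) *
          cr A (cutdiff w s (x w s) + f w s + (h w s : H)) j)) /\
        cr A (x w t) j = cr A (b0 w t) j +
        \int[leb]_s (K j (t - s) * cr A (cutdiff w s (x w s) + f w s + (h w s : H)) j)].
Proof.
have intf w t j : leb.-integrable setT (EFin \o (fun s => K j (t - s) * cr A (f w s) j)).
  by have [B fBw] := fB w; apply: (convH kP t (jmeasH1 w ^~ mf) fBw).1.
have inth w t j : leb.-integrable setT (EFin \o (fun s => K j (t - s) * cr A (h w s) j)).
  exact: (convX kP t (jmeasX1 w ^~ mh) (hI w)).1.
(* The bound is stated for arbitrary [B] and [Bf], so that constants independent of [t] can be used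
   once [b] is chosen. *)
have ex w : exists b : R -> X, forall t,
    (forall j, cr A (b t) j = cr A (b0 w t) j + \int[leb]_s (K j (t - s) * cr A (f w s) j)
      + \int[leb]_s (K j (t - s) * cr A (h w s) j)) /\
    forall B Bf, expR (nu * t) * `|b0 w t| <= B ->
      (forall s, expR (nu * s) * `|f w s| <= Bf) ->
      expR (nu * t) * `|b t| <= B + kmass k * Bf + \int[leb]_s (expR (nu * s) * `|h w s|).
  suff /choice[b bE] : forall t, exists b : X,
    (forall j, cr A b j = cr A (b0 w t) j + \int[leb]_s (K j (t - s) * cr A (f w s) j)
      + \int[leb]_s (K j (t - s) * cr A (h w s) j)) /\
    forall B Bf, expR (nu * t) * `|b0 w t| <= B ->
      (forall s, expR (nu * s) * `|f w s| <= Bf) ->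
      expR (nu * t) * `|b| <= B + kmass k * Bf + \int[leb]_s (expR (nu * s) * `|h w s|).
    by exists b.
  move=> t; have [B fBw] := fB w.
  have [y yE] := @crX_exists _ _ A alpha (fun j => \int[leb]_s (K j (t - s) * cr A (f w s) j))
    _ (convH kP t (jmeasH1 w ^~ mf) fBw).2.
  have sh := (convX kP t (jmeasX1 w ^~ mh) (hI w)).2.
  have [y' y'E] := @crX_exists _ _ A alpha
    (fun j => \int[leb]_s (K j (t - s) * cr A (h w s) j)) _ sh.
  exists (b0 w t + y + y'); split => [j|B1 Bf b0B1 fBf].
    by rewrite !crXD yE y'E.
  have Bf0 : 0 <= Bf by apply: le_trans (fBf 0); rewrite mulr_ge0 ?expR_ge0.
  have ny : expR (nu * t) * `|y| <= kmass k * Bf.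
    rewrite -ler_pdivlMl ?expR_gt0// -expRN; apply: normX_le => [|m].
      by rewrite !mulr_ge0 ?expR_ge0 ?(kmass_ge0 kP).
    under eq_bigr do rewrite yE.
    exact: (convH kP t (jmeasH1 w ^~ mf) fBf).2.
  have ny' : expR (nu * t) * `|y'| <= \int[leb]_s (expR (nu * s) * `|h w s|).
    rewrite -ler_pdivlMl ?expR_gt0// -expRN; apply: normX_le => [|m].
      rewrite mulr_ge0 ?expR_ge0//; apply: Rintegral_ge0 => s _.
      by rewrite mulr_ge0 ?expR_ge0.
    by under eq_bigr do rewrite y'E.
  apply: (@le_trans _ _ (expR (nu * t) * (`|b0 w t| + `|y| + `|y'|))).
    rewrite ler_wpM2l ?expR_ge0// (le_trans (ler_normD _ _))// lerD2r.
    exact: ler_normD.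
  by rewrite !mulrDr !lerD.
have [b bE] := choice ex.
have mb : jmeasX b.
  move=> j; apply: (eq_measurable_fun (fun p : T * R => cr A (b0 p.1 p.2) j +
     \int[leb]_s (K j (p.2 - s) * cr A (f p.1 s) j) +
     \int[leb]_s (K j (p.2 - s) * cr A (h p.1 s) j))).
    by move=> p _; rewrite (bE p.1 p.2).1.
  have mK := kernel_meas kP j.
  apply: measurable_funD; first apply: measurable_funD; first exact: mb0.
    exact: (measurable_convolution (f := fun p : T * R => cr A (f p.1 p.2) j) mK (mf j)).
  exact: (measurable_convolution (f := fun p : T * R => cr A (h p.1 p.2) j) mK (mh j)).
have bB w : exists B, forall t, expR (nu * t) * `|b w t| <= B.
  have [B b0Bw] := b0B w; have [Bf fBw] := fB w.
  exists (B + kmass k * Bf + \int[leb]_s (expR (nu * s) * `|h w s|)) => t.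
  exact: (bE w t).2.
have [x [mx xB xE]] := fixpoint_exists kP L0 q1 mb bB jmeasH_cutdiff cutdiff0 cutdiff_lip.
exists x; split => // w t j.
have [C xC] := xB w.
have intN := (convH kP t (jmeasH1 w ^~ (jmeasH_cutdiff mx)) (cutdiff_bound w xC)).1 j.
have splitE : (fun s => K j (t - s) * cr A (cutdiff w s (x w s) + f w s + (h w s : H)) j) =
    (fun s => K j (t - s) * cr A (cutdiff w s (x w s)) j + K j (t - s) * cr A (f w s) j
       + K j (t - s) * cr A (h w s) j).
  by apply/funext => s; rewrite !crD !mulrDr.
have int2 := integrableD measurableT intN (intf w t j).
split.
  by rewrite splitE; exact: (integrableD measurableT int2 (inth w t j)).
rewrite xE (bE w t).1 splitE (RintegralD measurableT int2 (inth w t j)).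
by rewrite (RintegralD measurableT intN (intf w t j)); ring.
Qed.

End line_equation.

(** * Mild solutions *)

Section variation_of_constants.
Context {R : realType} {H : hilbertType R} (A : spectral_operator H).
Notation lam := (eigval A).
Notation leb := (@lebesgue_measure R).
Implicit Types (G : R -> H) (xi : R -> H).

Lemma lebesgue_RintegralZl (D : set R) (c : R) (f : R -> R) : measurable D ->
  leb.-integrable D (EFin \o f) ->
  \int[leb]_(x in D) (c * f x) = c * \int[leb]_(x in D) f x.
Proof. by move=> mD i_f; exact: (@RintegralZl _ _ _ leb D f c mD i_f). Qed.

Lemma Rintegral_itv_co_cc (a : itv_bound R) (r : R) (f : R -> R) :
  measurable_fun [set` Interval a (BLeft r)] f ->
  \int[leb]_(x in [set` Interval a (BLeft r)]) f x =
  \int[leb]_(x in [set` Interval a (BRight r)]) f x.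
Proof.
by move=> mf; rewrite /Rintegral integral_itv_bndo_bndc//; exact/measurable_EFinP.
Qed.

Lemma Rintegral_itv_oc_cc (b : itv_bound R) (r : R) (f : R -> R) :
  measurable_fun [set` Interval (BRight r) b] f ->
  \int[leb]_(x in [set` Interval (BRight r) b]) f x =
  \int[leb]_(x in [set` Interval (BLeft r) b]) f x.
Proof.
by move=> mf; rewrite /Rintegral integral_itv_obnd_cbnd//; exact/measurable_EFinP.
Qed.

(** The bridge from convolutions to [voc]: [expR (lam j * u)] times the kernel at [u - s] is
    [expR (lam j * s)] times a step function of [u], with jump 1 at [s] in either direction of
    solution. Dropped modes have no jump and are excluded by the first condition. *)
Lemma skernel_diff (sgm : bool) n j (r t : R) (f : R -> R) :
  sgm || (n <= j)%N -> r <= t -> measurable_fun setT f ->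
  leb.-integrable setT (EFin \o (fun s => skernel A sgm n j (t - s) * f s)) ->
  leb.-integrable setT (EFin \o (fun s => skernel A sgm n j (r - s) * f s)) ->
  expR (lam j * t) * (\int[leb]_s (skernel A sgm n j (t - s) * f s)) -
  expR (lam j * r) * (\int[leb]_s (skernel A sgm n j (r - s) * f s)) =
  \int[leb]_(s in `[r, t]) (expR (lam j * s) * f s).
Proof.
move=> snj rt mf it ir.
rewrite -(RintegralZl _ measurableT it) -(RintegralZl _ measurableT ir).
have it' := integrableZl measurableT (expR (lam j * t)) it.
have ir' := integrableZl measurableT (expR (lam j * r)) ir.
rewrite -(RintegralB measurableT it' ir').
rewrite -(@Rintegral_itv_co_cc (BLeft r) t); last first.
  apply: measurable_funTS; apply: measurable_funM => //.
  have := measurable_expRM (- lam j); congr measurable_fun.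
  by apply/funext => s; rewrite mulNr opprK.
rewrite [RHS]Rintegral_mkcond; apply: eq_Rintegral => s _.
have E u : expR (lam j * u) * expR (- lam j * (u - s)) = expR (lam j * s).
  by rewrite -expRD; congr expR; ring.
have E2 u g : expR (lam j * u) * (- expR (- lam j * (u - s)) * g) = - (expR (lam j * s) * g).
  by rewrite -(E u); ring.
rewrite patchE.
have -> : (s \in `[r, t[%classic) = (r <= s < t).
  by apply/idP/idP; rewrite inE/= in_itv/=.
rewrite /skernel !subr_gt0; case: (ltP s r) => sr /=.
  have st : s < t by exact: lt_le_trans rt.
  by rewrite st; case: ifP => _; rewrite ?mul0r ?mulr0 ?subr0// !mulrA !E subrr.
case: (ltP s t) => st /=.
  case: ltnP snj => nj; rewrite ?orbF ?orbT/= => snj.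
    by rewrite snj/= mul0r mulr0 sub0r E2 opprK.
  by rewrite andbF mul0r mulr0 subr0 mulrA E.
by case: ifP => _; rewrite ?mul0r ?mulr0 ?subr0// !E2 subrr.
Qed.

Definition admissible G (D : set R) : Prop :=
  (forall j, measurable_fun D (fun s => cr A (G s) j)) /\
  leb.-integrable D (EFin \o (fun s => `|G s|)).

Lemma norm_cr1_le (u : H) j : `|cr A u j| <= `|u|.
Proof.
rewrite -(@ler_pXn2r _ 2) ?nnegrE// real_normK ?num_real//.
apply: le_trans (bessel A u j.+1); rewrite big_ord_recr/= lerDr sumr_ge0// => i _.
exact: sqr_ge0.
Qed.

Lemma admissible_cr_integrable G (D : set R) j (w : R -> R) (C : R) : measurable D ->
  admissible G D -> measurable_fun D w -> (forall s, D s -> `|w s| <= C) ->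
  leb.-integrable D (EFin \o (fun s => w s * cr A (G s) j)).
Proof.
move=> mD [mG iG] mw wC.
apply: (@le_integrable _ _ _ leb D mD _ (EFin \o (fun s => C * `|G s|))).
- by apply/measurable_EFinP; apply: measurable_funM; [exact: mw|exact: mG].
- move=> s Ds /=; rewrite lee_fin normrM (le_trans _ (ler_norm _))//.
  by rewrite ler_pM ?wC// norm_cr1_le.
- exact: (@integrableZl _ _ _ leb D mD C _ iG).
Qed.

Lemma measurable_expRMr (c : R) (D : set R) : measurable_fun D (fun s : R => expR (c * s)).
Proof.
apply: measurable_funTS; have := measurable_expRM (- c); congr measurable_fun.
by apply/funext => s; rewrite mulNr opprK.
Qed.

Lemma expR_itv_bound (c r t s : R) : s \in `[r, t] ->
  `|expR (c * s)| <= expR (`|c| * (`|r| + `|t|)).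
Proof.
rewrite in_itv/= => /andP[rs st]; rewrite ger0_norm ?expR_ge0// ler_expR.
rewrite (le_trans (ler_norm _))// normrM ler_wpM2l//.
have := ler_norm t; have := ler_norm (- r); rewrite normrN => h1 h2.
rewrite ler_norml; apply/andP; split.
  by have := normr_ge0 t; lra.
by have := normr_ge0 r; lra.
Qed.

Lemma voc_integrable G (r t : R) j : admissible G `[r, t] ->
  leb.-integrable `[r, t] (EFin \o (fun s => expR (lam j * s) * cr A (G s) j)).
Proof.
move=> aG; apply: (@admissible_cr_integrable _ _ _ _ (expR (`|lam j| * (`|r| + `|t|)))) => //.
  exact: measurable_expRMr.
by move=> s /= h; exact: expR_itv_bound.
Qed.

(* Variation of constants in the coordinates, in the form that extends to both
   directions of time. *)
Definition voc xi G (r t : R) : Prop := forall j,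
  expR (lam j * t) * cr A (xi t) j - expR (lam j * r) * cr A (xi r) j =
  \int[leb]_(s in `[r, t]) (expR (lam j * s) * cr A (G s) j).

Lemma Rintegral_itv_split (f : R -> R) (r s t : R) : r <= s -> s <= t ->
  leb.-integrable `[r, t] (EFin \o f) ->
  \int[leb]_(u in `[r, t]) f u =
  \int[leb]_(u in `[r, s]) f u + \int[leb]_(u in `[s, t]) f u.
Proof.
move=> rs st i_f.
have UE : `[r, t]%classic = `[r, s] `|` `]s, t] :> set R.
  by rewrite -itv_bndbnd_setU// bnd_simp.
have i1 : leb.-integrable `[s, t] (EFin \o f).
  by apply: integrableS i_f => //; apply: subset_itvr; rewrite bnd_simp.
have [mf1 _] := integrableP _ _ _ i1.
rewrite -[X in _ + X]Rintegral_itv_oc_cc; last first.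
  move/measurable_EFinP in mf1; apply: measurable_funS mf1 => //; exact: subset_itv_oc_cc.
rewrite UE Rintegral_setU//; first by rewrite -UE.
by apply/disj_setPS => x [/=]; rewrite !in_itv/= => /andP[_ h] /andP[h' _]; lra.
Qed.

Lemma voc_cat xi G (r s t : R) : r <= s -> s <= t -> admissible G `[r, t] ->
  voc xi G r s -> voc xi G s t -> voc xi G r t.
Proof.
move=> rs st aG v1 v2 j; rewrite (Rintegral_itv_split rs st); last exact: voc_integrable.
by rewrite -v1 -v2; ring.
Qed.

Lemma voc_cut xi G (r s t : R) : r <= s -> s <= t -> admissible G `[r, t] ->
  voc xi G r s -> voc xi G r t -> voc xi G s t.
Proof.
move=> rs st aG v1 v2 j; have := v2 j.
rewrite (Rintegral_itv_split rs st); last exact: voc_integrable.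
by rewrite -v1; lra.
Qed.

Lemma eq_voc xi G xi' G' (r t : R) : r <= t -> xi r = xi' r -> xi t = xi' t ->
  (forall s, s \in `[r, t] -> G s = G' s) -> voc xi G r t -> voc xi' G' r t.
Proof.
move=> rt xr xt GG v j; rewrite -xr -xt v; apply: eq_Rintegral => s.
by rewrite inE/= => /GG ->.
Qed.

Lemma duhamel_bochner G (r t : R) : admissible G `[r, t] ->
  bochner_integrable leb `[r, t] (fun s => semigroup A (t - s) (G s)) /\
  forall j, cr A (bochner_integral leb `[r, t] (fun s => semigroup A (t - s) (G s))) j =
    expR (- (lam j * t)) * \int[leb]_(s in `[r, t]) (expR (lam j * s) * cr A (G s) j).
Proof.
move=> aG; have [mG iG] := aG.
have crE s j : s \in `[r, t] ->
    cr A (semigroup A (t - s) (G s)) j = expR (- (lam j * t)) * (expR (lam j * s) * cr A (G s) j).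
  rewrite in_itv/= => /andP[rs st]; rewrite cr_semigroup ?subr_ge0//.
  by rewrite mulrA -expRD; congr (expR _ * _); ring.
have := @bochner_integral_cr _ _ A _ _ leb `[r, t]%classic
    (fun s => semigroup A (t - s) (G s)) (fun s => `|G s|) (measurable_itv _).
move=> /(_ _ iG _)[] => [j|s /= sD|bi bE].
- apply: (eq_measurable_fun (fun s => expR (- (lam j * t)) * (expR (lam j * s) * cr A (G s) j))).
    by move=> s; rewrite inE/= => /crE ->.
  apply: measurable_funM => //; apply: measurable_funM; last exact: mG.
  exact: measurable_expRMr.
- apply: (@norm_le_cr _ _ A) => // m; apply: le_trans (bessel A (G s) m).
  move: (sD); rewrite in_itv/= => /andP[rs st].
  apply: ler_sum => i _; rewrite cr_semigroup ?subr_ge0// exprMn ler_piMl ?sqr_ge0//.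
  rewrite exprn_ile1 ?expR_ge0// expR_le1 mulNr oppr_le0 mulr_ge0 ?subr_ge0//.
  exact/ltW/eigval_gt0.
split=> // j; rewrite bE -(lebesgue_RintegralZl _ (measurable_itv _) (voc_integrable j aG)).
by apply: eq_Rintegral => s; rewrite inE/= => /crE ->.
Qed.

(** Coordinate j of the Duhamel formula is multiplied by the nonzero number [expR (lam j * t)], so
    nothing is lost in either direction. *)
Lemma duhamel_voc G (r t : R) (x x0 : H) : r <= t -> admissible G `[r, t] ->
  x = semigroup A (t - r) x0 +
    bochner_integral leb `[r, t] (fun s => semigroup A (t - s) (G s)) <->
  forall j, expR (lam j * t) * cr A x j - expR (lam j * r) * cr A x0 j =
    \int[leb]_(s in `[r, t]) (expR (lam j * s) * cr A (G s) j).
Proof.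
move=> rt aG; have [_ bE] := duhamel_bochner aG.
have E j : expR (lam j * t) * (expR (- lam j * (t - r)) * cr A x0 j) =
    expR (lam j * r) * cr A x0 j.
  by rewrite mulrA -expRD; congr (expR _ * _); ring.
have E1 j y : expR (lam j * t) * (expR (- (lam j * t)) * y) = y.
  by rewrite mulrA -expRD subrr expR0 mul1r.
split=> [-> j|xE].
  by rewrite crD cr_semigroup ?subr_ge0// bE mulrDr E E1 addrAC subrr add0r.
apply: (@cr_inj _ _ A) => j; rewrite crD cr_semigroup ?subr_ge0// bE -xE.
apply: (@mulfI _ (expR (lam j * t))); first by rewrite gt_eqF ?expR_gt0.
by rewrite mulrDr (E j) (E1 j) addrC subrK.
Qed.

End variation_of_constants.

Section continuity_on.
Context {R : realType}.
Implicit Type V : normedModType R.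

(** Elementary form of continuity within [D], convenient for restricting, gluing and shifting
    intervals. *)
Definition cont_on V (D : set R) (f : R -> V) : Prop :=
  forall x, D x -> forall e, 0 < e -> exists2 dl, 0 < dl &
    forall y, D y -> `|x - y| < dl -> `|f x - f y| <= e.

Lemma within_cont_onP V (D : set R) (f : R -> V) :
  {within D, continuous f} <-> cont_on D f.
Proof.
split.
  move=> /subspace_continuousP cf x Dx e e0.
  have /(@cvgrPdist_le _ _ _ _ _ f (f x)).1/(_ e e0) := cf x Dx.
  move=> /nbhs_ballP[dl /= dl0 h]; exists dl => // y Dy xy.
  by apply: h => //; rewrite -ball_normE.
move=> cf; apply/subspace_continuousP => x Dx.
apply: (@cvgrPdist_le _ _ _ _ _ f (f x)).2 => e e0.
have [dl dl0 h] := cf x Dx e e0.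
apply/nbhs_ballP; exists dl => //= y; rewrite -ball_normE/= => xy Dy.
exact: h.
Qed.

Lemma cont_on_bounded V (f : R -> V) (r t : R) : cont_on `[r, t] f ->
  exists C, forall s, s \in `[r, t] -> `|f s| <= C.
Proof.
move=> cf; have [rt|tr] := leP r t; last first.
  by exists 0 => s; rewrite in_itv/= => /andP[h1 h2]; lra.
have cn : {within `[r, t], continuous (fun s => `|f s| : R)}.
  apply/within_cont_onP => x Dx e e0; have [dl dl0 h] := cf x Dx e e0.
  by exists dl => // y Dy xy; rewrite (le_trans (ler_dist_dist _ _))// h.
have [c _ h] := EVT_max rt cn.
by exists `|f c| => s; exact: h.
Qed.

End continuity_on.

Lemma cont_on_measurable (R : realType) (D : set R) (f : R -> R) : measurable D ->
  cont_on D f -> measurable_fun D f.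
Proof. by move=> mD /within_cont_onP; exact: subspace_continuous_measurable_fun. Qed.

(** * Continuity in D(A^alpha) recovered from the coordinates *)

Section continuity_of_solutions.
Context {R : realType} {H : hilbertType R} (A : spectral_operator H).
Context {alpha : {nonneg R}}.
Notation X := (fracdom A alpha).
Notation lam := (eigval A).
Notation wt j := (lam j `^ alpha%:num).
Notation leb := (@lebesgue_measure R).

Lemma cont_on_crX (D : set R) (f : R -> X) j : cont_on D f -> cont_on D (fun s => cr A (f s) j : R^o).
Proof.
move=> cf x Dx e e0.
have e0' : 0 < wt j * e by rewrite mulr_gt0 ?wt_gt0.
have [dl dl0 h] := cf x Dx _ e0'; exists dl => // y Dy xy.
by rewrite -crXB (le_trans (norm_cr_le _ _))// ler_pdivrMl ?wt_gt0// h.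
Qed.

Definition eigvecX (j : nat) : X := FracDom (mem_set (@eigvec_fpow_dom _ _ A alpha%:num j)).

Lemma cr_eigvecX j i : cr A (eigvecX j) i = (j == i)%:R.
Proof. exact: cr_basis. Qed.

Lemma cr_sum_eigvecX (c : nat -> R) k i :
  cr A (\sum_(j < k) c j *: eigvecX j : X) i = if (i < k)%N then c i else 0.
Proof.
elim: k => [|k IH]; first by rewrite big_ord0 crX0.
rewrite big_ord_recr/= crD IH crZ cr_basis ltnS [(i <= k)%N]leq_eqVlt eq_sym.
by case: eqVneq => [->|]; rewrite ?ltnn ?add0r ?mulr1 ?mulr0 ?addr0.
Qed.

Lemma PnX_norm_le m (x : X) : `|PnX m x| <= \sum_(j < m) wt j * `|cr A x j|.
Proof.
have -> : PnX m x = \sum_(j < m) cr A x j *: eigvecX j.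
  by apply: (@crX_inj _ _ A) => i; rewrite cr_PnX (cr_sum_eigvecX (fun j => cr A x j)).
rewrite (le_trans (ler_norm_sum _ _ _))//; apply: ler_sum => j _.
rewrite normrZ mulrC ler_wpM2r//; apply: normX_le => [|k]; first exact: powR_ge0.
have [jk|kj] := ltnP j k.
  rewrite (bigD1 (Ordinal jk))//= cr_eigvecX eqxx mulr1 big1 ?addr0// => i ij.
  rewrite cr_eigvecX (_ : (j == i :> nat) = false) ?mulr0 ?expr0n//.
  by rewrite eq_sym; apply: negbTE.
rewrite big1 ?sqr_ge0// => i _; rewrite cr_eigvecX.
by rewrite (_ : (j == i :> nat) = false) ?mulr0 ?expr0n//; apply/negP => /eqP; have := ltn_ord i; lia.
Qed.

Lemma normX_PnX_QnX m (x : X) : `|x| <= `|PnX m x| + `|QnX m x|.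
Proof. by rewrite -{1}[x](subrKC (PnX m x)) ler_normD. Qed.

Lemma QnX_B m (x y : X) : QnX m (x - y) = QnX m x - QnX m y.
Proof.
apply: (@crX_inj _ _ A) => j; rewrite crXB !cr_QnX crXB; case: ifP => //.
by rewrite subrr.
Qed.

Lemma norm_QnX_le m (x : X) : `|QnX m x| <= `|x|.
Proof.
apply: normX_le => // k; apply: le_trans (besselX x k).
by apply: ler_sum => j _; rewrite cr_QnX; case: ifP => _; rewrite ?mulr0 ?expr0n ?sqr_ge0.
Qed.

(** Finitely many coordinates handle [PnX m] up to [e / 2]; the two tails, at [x] and at [y], cost
    [e / 4] each. *)
Lemma cont_on_tails (D : set R) (f : R -> X) :
  (forall j, cont_on D (fun s => cr A (f s) j : R^o)) ->
  (forall e, 0 < e -> exists m, forall s, D s -> `|QnX m (f s)| <= e) ->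
  cont_on D f.
Proof.
move=> cf tf x Dx e e0; have e40 : 0 < e / 4 by rewrite divr_gt0.
have [m hm] := tf _ e40.
have [dl dl0 hP] : exists2 dl, 0 < dl & forall y, D y -> `|x - y| < dl ->
    \sum_(j < m) wt j * `|cr A (f x - f y) j| <= e / 2.
  have key k : forall e, 0 < e -> exists2 dl, 0 < dl & forall y, D y -> `|x - y| < dl ->
      \sum_(j < k) wt j * `|cr A (f x - f y) j| <= e.
    elim: k => [|k IH] e' e'0.
      by exists 1 => // y _ _; rewrite big_ord0 ltW.
    have e'20 : 0 < e' / 2 by rewrite divr_gt0.
    have ew : 0 < e' / 2 / wt k by rewrite divr_gt0 ?wt_gt0.
    have [d1 d10 h1] := IH _ e'20; have [d2 d20 h2] := cf k x Dx _ ew.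
    exists (Num.min d1 d2); first by rewrite lt_min d10.
    move=> y Dy; rewrite lt_min => /andP[/(h1 y Dy) k1 /(h2 y Dy) k2].
    rewrite big_ord_recr/= (splitr e') lerD// crXB mulrC -ler_pdivlMr ?wt_gt0//.
  by apply: key; rewrite divr_gt0.
exists dl => // y Dy xy; rewrite (le_trans (normX_PnX_QnX m _))//.
have -> : e = e / 2 + (e / 4 + e / 4) by field.
apply: lerD; first by rewrite (le_trans (PnX_norm_le _ _))// hP.
by rewrite QnX_B (le_trans (ler_normB _ _))// lerD// hm.
Qed.

End continuity_of_solutions.

Section solution_continuity.
Context {R : realType} {H : hilbertType R} (A : spectral_operator H).
Context {alpha : {nonneg R}}.
Notation X := (fracdom A alpha).
Notation lam := (eigval A).
Notation wt j := (lam j `^ alpha%:num).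
Notation leb := (@lebesgue_measure R).
Hypothesis a_lt1 : alpha%:num < 1.
Hypothesis a_lt12 : alpha%:num < 2^-1.

Lemma eq_cont_on (V : normedModType R) (D : set R) (f g : R -> V) :
  (forall x, D x -> f x = g x) -> cont_on D f -> cont_on D g.
Proof.
move=> fg cf x Dx e e0; have [dl dl0 h] := cf x Dx e e0.
by exists dl => // y Dy xy; rewrite -!fg// h.
Qed.

Lemma integrable_cst_itv (c r t : R) : leb.-integrable `[r, t] (EFin \o (fun=> c)).
Proof.
apply/integrableP; split; first exact: measurable_cst.
have mE : (leb `[r, t]%classic < +oo)%E.
  by rewrite lebesgue_measure_itv/=; case: ifP => _; rewrite ?ltry// -EFinB ltry.
by rewrite /= (@integral_cst _ _ _ leb _ (measurable_itv _)) lte_mul_pinfty// lee_fin.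
Qed.

(** A forward kernel sees only the past and [f] vanishes before [r], so the convolution at time [r]
    is zero and the difference formula leaves one term. *)
Lemma conv_cut m j (r T t : R) (f : R -> R) : (m <= j)%N -> r <= t -> measurable_fun setT f ->
  (forall s, ~~ (r <= s <= T) -> f s = 0) ->
  leb.-integrable setT (EFin \o (fun s => skernel A false m j (t - s) * f s)) ->
  expR (lam j * t) * (\int[leb]_s (skernel A false m j (t - s) * f s)) =
  \int[leb]_(s in `[r, t]) (expR (lam j * s) * f s).
Proof.
move=> mj rt mf f0 it.
have K0 : (fun s => skernel A false m j (r - s) * f s) = cst 0.
  apply/funext => s; rewrite /skernel subr_gt0 /=; case: ltP => sr; last by rewrite mul0r.
  by rewrite f0 ?mulr0// negb_and -ltNge sr.
have ir : leb.-integrable setT (EFin \o (fun s => skernel A false m j (r - s) * f s)).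
  by rewrite K0; exact: integrable0.
rewrite -(skernel_diff _ rt mf it ir) ?mj// K0.
by rewrite Rintegral_cst// mul0r mulr0 subr0.
Qed.

Section tail.
Variables (xi : R -> X) (Gf : R -> H) (h : R -> X) (r T B : R).
Hypothesis mGf : forall j, measurable_fun setT (fun s => cr A (Gf s) j).
Hypothesis mh : forall j, measurable_fun setT (fun s => cr A (h s) j).
Hypothesis Gf0 : forall s, ~~ (r <= s <= T) -> Gf s = 0.
Hypothesis h0 : forall s, ~~ (r <= s <= T) -> h s = 0.
Hypothesis GfB : forall s, `|Gf s| <= B.
Hypothesis ih : leb.-integrable setT (EFin \o (fun s => `|h s|)).
Hypothesis vxi : forall t, r <= t <= T -> voc A xi (fun s => Gf s + (h s : H)) r t.

Let B0 : 0 <= B. Proof. exact: le_trans (GfB 0). Qed.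

(** The solution splits into the decaying initial value, the response to the bounded H-valued part,
    and the response to [h]. The last is measured by the integral of the tails of [h], since [h]
    need not be bounded in time. *)
Lemma QnX_voc_le m k t : @kernel _ _ A alpha (skernel A false m) k 0 -> r <= t <= T ->
  `|QnX m (xi t)| <= `|QnX m (xi r)| + kmass k * B + \int[leb]_s `|QnX m (h s)|.
Proof.
move=> kP /andP[rt tT].
have mQh j : measurable_fun setT (fun s => cr A (QnX m (h s)) j).
  under eq_fun do rewrite cr_QnX.
  by case: (j < m)%N; [exact: measurable_cst|exact: mh].
have iQh : leb.-integrable setT (EFin \o (fun s => expR (0 * s) * `|QnX m (h s)|)).
  apply: (@le_integrable _ _ _ leb setT measurableT _ (EFin \o (fun s => `|h s|))) => //.
    apply/measurable_EFinP; under eq_fun do rewrite mul0r expR0 mul1r.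
    exact: measurable_normX.
  by move=> s _ /=; rewrite lee_fin mul0r expR0 mul1r !normr_id norm_QnX_le.
have GfB' s : expR (0 * s) * `|Gf s| <= B by rewrite mul0r expR0 mul1r.
have [i1 s1] := convH kP t mGf GfB'.
have [i2 s2] := convX kP t mQh iQh.
have [y0 y0E] : exists y : X, forall j, cr A y j =
    expR (- (lam j * (t - r))) * cr A (QnX m (xi r)) j.
  apply: (@crX_exists _ _ A alpha (fun j => expR (- (lam j * (t - r))) * cr A (QnX m (xi r)) j)
     (`|QnX m (xi r)| ^+ 2)) => k'.
  apply: le_trans (besselX _ k'); apply: ler_sum => j _.
  rewrite mulrCA exprMn ler_piMl ?sqr_ge0// exprn_ile1 ?expR_ge0// expR_le1 oppr_le0.
  by rewrite mulr_ge0 ?subr_ge0//; exact/ltW/eigval_gt0.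
have ny0 : `|y0| <= `|QnX m (xi r)|.
  apply: normX_le => // k'; apply: le_trans (besselX _ k'); apply: ler_sum => j _.
  rewrite y0E mulrCA exprMn ler_piMl ?sqr_ge0// exprn_ile1 ?expR_ge0// expR_le1 oppr_le0.
  by rewrite mulr_ge0 ?subr_ge0//; exact/ltW/eigval_gt0.
have [y1 y1E] := @crX_exists _ _ A alpha
  (fun j => \int[leb]_s (skernel A false m j (t - s) * cr A (Gf s) j)) _ s1.
have [y2 y2E] := @crX_exists _ _ A alpha
  (fun j => \int[leb]_s (skernel A false m j (t - s) * cr A (QnX m (h s)) j)) _ s2.
have ny1 : `|y1| <= kmass k * B.
  apply: normX_le => [|k']; first by rewrite mulr_ge0// (kmass_ge0 kP).
  under eq_bigr do rewrite y1E.
  by apply: (le_trans (s1 k')); rewrite mul0r oppr0 expR0 mul1r.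
have ny2 : `|y2| <= \int[leb]_s `|QnX m (h s)|.
  apply: normX_le => [|k']; first exact: Rintegral_ge0.
  under eq_bigr do rewrite y2E.
  apply: (le_trans (s2 k')); rewrite mul0r oppr0 expR0 mul1r.
  by under eq_Rintegral do rewrite mul0r expR0 mul1r.
suff -> : QnX m (xi t) = y0 + y1 + y2.
  rewrite (le_trans (ler_normD _ _))// lerD// (le_trans (ler_normD _ _))// lerD//.
apply: (@crX_inj _ _ A) => j.
have -> : cr A (y0 + y1 + y2 : X) j = cr A y0 j + cr A y1 j + cr A y2 j by rewrite !crXD.
rewrite y0E y1E y2E !cr_QnX.
case: ltnP => mj.
  have -> : (fun s => skernel A false m j (t - s) * cr A (Gf s) j) = cst 0.
    by apply/funext => s; rewrite /skernel mj /= if_same mul0r.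
  have -> : (fun s => skernel A false m j (t - s) * cr A (QnX m (h s)) j) = cst 0.
    by apply/funext => s; rewrite /skernel mj /= if_same mul0r.
  by rewrite Rintegral_cst// mul0r mulr0 !addr0.
have En0 : expR (lam j * t) != 0 by rewrite gt_eqF ?expR_gt0.
apply: (mulfI En0); rewrite !mulrDr.
have f10 s : ~~ (r <= s <= T) -> cr A (Gf s) j = 0 by move=> /Gf0 ->; rewrite cr0.
have f20 s : ~~ (r <= s <= T) -> cr A (QnX m (h s)) j = 0.
  by move=> /h0 hs; rewrite cr_QnX hs crX0 if_same.
rewrite (conv_cut mj rt (mGf j) f10 (i1 j)) (conv_cut mj rt (mQh j) f20 (i2 j)).
have := vxi (t := t); rewrite rt tT => /(_ isT j) vE.
rewrite [X in _ = X + _ + _]mulrA -expRD.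
rewrite (_ : lam j * t - (lam j * t + lam j * - r) = lam j * r); last by ring.
rewrite -addrA; apply/eqP; rewrite addrC -subr_eq; apply/eqP; rewrite vE.
have bnd s : s \in `[r, t] -> `|expR (lam j * s)| <= expR (`|lam j| * (`|r| + `|t|)).
  exact: expR_itv_bound.
have iGf : leb.-integrable `[r, t] (EFin \o (fun s => expR (lam j * s) * cr A (Gf s) j)).
  apply: (@le_integrable _ _ _ leb _ (measurable_itv _) _ (EFin \o (fun s => B * expR (`|lam j| * (`|r| + `|t|))))).
  - apply/measurable_EFinP; apply: measurable_funM; first exact: measurable_expRMr.
    apply: measurable_funTS; exact: mGf.
  - move=> s /= /bnd hs; rewrite lee_fin normrM (le_trans _ (ler_norm _))// mulrC ler_pM//.
    by rewrite (le_trans (norm_cr1_le _ _ _)).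
  - exact: integrable_cst_itv.
have iQh' : leb.-integrable `[r, t] (EFin \o (fun s => expR (lam j * s) * cr A (QnX m (h s)) j)).
  apply: (@le_integrable _ _ _ leb _ (measurable_itv _) _ (EFin \o (fun s => expR (`|lam j| * (`|r| + `|t|)) * ((wt j)^-1 * `|h s|)))).
  - apply/measurable_EFinP; apply: measurable_funM; first exact: measurable_expRMr.
    apply: measurable_funTS; exact: mQh.
  - move=> s /= /bnd hs; rewrite lee_fin normrM (le_trans _ (ler_norm _))// ler_pM//.
    rewrite -[leLHS]/(`|cr A (QnX m (h s)) j|) (le_trans (norm_cr_le _ _))//.
    by rewrite ler_wpM2l ?invr_ge0 ?powR_ge0// norm_QnX_le.
  - have ih' : leb.-integrable `[r, t] (EFin \o (fun s => `|h s|)).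
      exact: (@integrableS _ _ _ leb setT).
    have := @integrableZl _ _ _ leb _ (measurable_itv _) (wt j)^-1 _ ih'.
    exact: (@integrableZl _ _ _ leb _ (measurable_itv _)).
rewrite -(@RintegralD _ _ _ leb _ _ _ (measurable_itv _) iGf iQh').
by apply: eq_Rintegral => s _; rewrite crD cr_QnX ltnNge mj/= mulrDr.
Qed.

(** Each coordinate is continuous as an integral with a variable end. The three terms of the tail
    estimate fall below [e / 3] for large m: by the small mass of [tail_kernel], by convergence of
    the expansion of the initial value, and by dominated convergence for [h]. *)
Lemma voc_cont_on_cut : r <= T -> cont_on `[r, T] xi.
Proof.
move=> rT.
have cut s : s \in `[r, T] = (r <= s <= T) by rewrite in_itv.
have mGh i : measurable_fun `[r, T] (fun s => cr A (Gf s + (h s : H)) i).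
  apply: (eq_measurable_fun (fun s => cr A (Gf s) i + cr A (h s) i)).
    by move=> s _; rewrite crD.
  by apply: measurable_funTS; apply: measurable_funD; [exact: mGf|exact: mh].
apply: cont_on_tails => [j|e e0].
  have iG : leb.-integrable `[r, T] (EFin \o (fun s => expR (lam j * s) * cr A (Gf s + (h s : H)) j)).
    apply: voc_integrable; split.
      exact: mGh.
    have ih' : leb.-integrable `[r, T] (EFin \o (fun s => (wt 0)^-1 * `|h s|)).
      have ih' : leb.-integrable `[r, T] (EFin \o (fun s => `|h s|)).
        exact: (@integrableS _ _ _ leb setT).
      exact: (@integrableZl _ _ _ leb _ (measurable_itv _) (wt 0)^-1 _ ih').
    have iB := integrable_cst_itv B r T.
    apply: (@le_integrable _ _ _ leb _ (measurable_itv _) _ (EFin \o (fun s => B + (wt 0)^-1 * `|h s|))).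
    - apply/measurable_EFinP; by apply: (@measurable_normH _ _ A) => // i; exact: mGh.
    - move=> s _ /=; rewrite lee_fin normr_id (le_trans _ (ler_norm _))//.
      by rewrite (le_trans (ler_normD _ _))// lerD// norm_fd_val_le.
    - exact: (@integrableD _ _ _ leb _ (measurable_itv _) _ _ iB ih').
  have cP := parameterized_integral_continuous rT iG.
  have cE : continuous (fun s => expR (- lam j * s)).
    move=> s; apply: continuous_comp; last exact: continuous_expR.
    by apply: cvgMr; exact: cvg_id.
  pose g t := expR (- lam j * t) * (expR (lam j * r) * cr A (xi r) j +
    parameterized_integral leb r t (fun s => expR (lam j * s) * cr A (Gf s + (h s : H)) j)).
  apply: (@eq_cont_on _ _ (g : R -> R^o)).
    move=> t /= /[!cut] rtT; rewrite /g.
    have := vxi rtT j => /eqP; rewrite subr_eq addrC => /eqP <-.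
    by rewrite mulrA -expRD mulNr addNr expR0 mul1r.
  apply/within_cont_onP => s; apply: cvgM; first exact: (continuous_subspaceT cE).
  by apply: cvgD; [exact: cvg_cst|exact: cP].
have e30 : 0 < e / 3 by rewrite divr_gt0.
have eB0 : 0 < e / 3 / (B + 1) by rewrite divr_gt0// ltr_wpDl.
have [m1 hm1] := tail_kernel A a_lt1 a_lt12 eB0.
have [m2 _ hm2] : \forall m \near \oo, `|QnX m (xi r)| <= e / 3.
  have /cvgrPdist_le/(_ _ e30) := @QnX_cvg0 _ _ A alpha (xi r).
  by apply: filterS => m; rewrite sub0r normrN normr_id.
have [m3 _ hm3] : \forall m \near \oo, \int[leb]_s `|QnX m (h s)| <= e / 3.
  have mQ m : measurable_fun setT (fun s => `|QnX m (h s)|).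
    apply: measurable_normX => // j; under eq_fun do rewrite cr_QnX.
    by case: (j < m)%N; [exact: measurable_cst|exact: mh].
  have cvg0 : (\int[leb]_s (`|QnX m (h s)|)%:E)%E @[m --> \oo] --> (\int[leb]_s 0%:E)%E.
    apply: (@dominated_cvg _ _ _ leb setT measurableT
      (fun m s => (`|QnX m (h s)|)%:E) (fun=> 0%:E) (fun s => (`|h s|)%:E)) => //.
    - by move=> m; apply/measurable_EFinP; exact: mQ.
    - by move=> s _; apply: cvg_EFin; [exact: nearW|exact: QnX_cvg0].
    - by move=> m s _; rewrite /= lee_fin normr_id norm_QnX_le.
  move: cvg0; rewrite integral0 => /fine_cvg cvg0.
  have /cvgrPdist_le/(_ _ e30) := cvg0; apply: filterS => m /=.
  by rewrite sub0r normrN; apply: le_trans; exact: ler_norm.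
pose m := maxn m1 (maxn m2 m3); exists m => t /= /[!cut] rtT.
have [k [kP kB]] := hm1 m (leq_maxl _ _).
apply: (le_trans (QnX_voc_le kP rtT)).
have -> : e = e / 3 + e / 3 + e / 3 by field.
apply: lerD; last by apply: hm3; rewrite /= /m !leq_max leqnn !orbT.
apply: lerD; first by apply: hm2; rewrite /= /m !leq_max leqnn !orbT.
apply: (@le_trans _ _ (e / 3 / (B + 1) * B)); first by rewrite ler_wpM2r.
rewrite mulrAC ler_pdivrMr ?ltr_wpDl// ler_wpM2l ?ltW//.
by rewrite ltrDl.
Qed.

End tail.

(** Extension of the data by zero reduces this to functions on the whole line, where the
    convolutions live. *)
Lemma voc_cont_on (xi : R -> X) (Gf : R -> H) (h : R -> X) (r T B : R) : r <= T ->
  (forall j, measurable_fun `[r, T] (fun s => cr A (Gf s) j)) ->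
  (forall j, measurable_fun `[r, T] (fun s => cr A (h s) j)) ->
  (forall s, s \in `[r, T] -> `|Gf s| <= B) ->
  leb.-integrable `[r, T] (EFin \o (fun s => `|h s|)) ->
  (forall t, r <= t <= T -> voc A xi (fun s => Gf s + (h s : H)) r t) ->
  cont_on `[r, T] xi.
Proof.
move=> rT mGf mh GfB ih vxi.
have cut s : s \in `[r, T]%classic = (r <= s <= T).
  by apply/idP/idP; rewrite inE/= in_itv.
have B0 : 0 <= B by apply: le_trans (GfB r _); rewrite ?in_itv/= ?lexx.
pose Gf' s := if r <= s <= T then Gf s else 0.
pose h' s := if r <= s <= T then h s else 0.
apply: (@voc_cont_on_cut xi Gf' h' r T B) => //.
- move=> j; have /(measurable_restrictT _ _).1 := mGf j => /(_ (measurable_itv _)).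
  congr measurable_fun; apply/funext => s; rewrite patchE cut /Gf'.
  by case: ifP => // _; rewrite cr0.
- move=> j; have /(measurable_restrictT _ _).1 := mh j => /(_ (measurable_itv _)).
  congr measurable_fun; apply/funext => s; rewrite patchE cut /h'.
  by case: ifP => // _; rewrite crX0.
- by move=> s /negPf ns; rewrite /Gf' ns.
- by move=> s /negPf ns; rewrite /h' ns.
- by move=> s; rewrite /Gf'; case: ifP => [sD|_]; [apply: GfB; rewrite in_itv|rewrite normr0].
- have := (@integrable_mkcond _ _ _ leb _ (EFin \o (fun s => `|h s|)) (measurable_itv `[r, T])).1 ih.
  congr (_.-integrable _ _); apply/funext => s; rewrite patchE cut.
  have nE : `|h' s| = if r <= s <= T then `|h s| else 0.
    by rewrite /h'; case: ifP => // _; rewrite normr0.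
  by rewrite [RHS]/comp nE; case: ifP.
move=> t /andP[rt tT]; apply: eq_voc (vxi t _) => //; last by rewrite rt.
move=> s; rewrite in_itv/= => /andP[rs st].
by rewrite /Gf' /h' rs (le_trans st tT).
Qed.

End solution_continuity.

Section deterministic_line_equation.
Context {R : realType} {H : hilbertType R} (A : spectral_operator H).
Context {alpha : {nonneg R}}.
Notation X := (fracdom A alpha).
Notation leb := (@lebesgue_measure R).

(** The deterministic case, with the one-point type [unit] as parameter space. *)
Lemma line_equation1 (F : X -> H) (L : R) (K : nat -> R -> R) (k : R -> R) (nu : R)
    (D : R -> bool) (b0 a h : R -> X) (f : R -> H) :
  0 <= L -> (forall x y : X, `|F x - F y| <= L * `|x - y|) ->
  @kernel _ _ A alpha K k nu -> kmass k * L < 1 -> measurable_fun setT D ->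
  (forall j, measurable_fun setT (fun s => cr A (b0 s) j)) ->
  (forall j, measurable_fun setT (fun s => cr A (a s) j)) ->
  (forall j, measurable_fun setT (fun s => cr A (h s) j)) ->
  (forall j, measurable_fun setT (fun s => cr A (f s) j)) ->
  (exists B, forall t, expR (nu * t) * `|b0 t| <= B) ->
  (exists B, forall t, expR (nu * t) * `|f t| <= B) ->
  leb.-integrable setT (EFin \o (fun s => expR (nu * s) * `|h s|)) ->
  exists x : R -> X,
  [/\ forall j, measurable_fun setT (fun s => cr A (x s) j),
      exists C, forall t, expR (nu * t) * `|x t| <= C &
      forall t j,
        leb.-integrable setT (EFin \o (fun s => K j (t - s) *
          cr A ((if D s then F (x s + a s) - F (a s) else 0) + f s + (h s : H)) j)) /\
        cr A (x t) j = cr A (b0 t) j + \int[leb]_s (K j (t - s) *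
          cr A ((if D s then F (x s + a s) - F (a s) else 0) + f s + (h s : H)) j)].
Proof.
move=> L0 FL kP q1 mD mb0 ma mh mf b0B fB hI.
have ms (g : R -> R) : measurable_fun setT g -> measurable_fun setT (fun p : unit * R => g p.2).
  by move=> mg; apply: (measurableT_comp mg); exact: measurable_snd.
have [x [mx xC xE]] := @line_equation _ _ A alpha _ unit F L L0 FL K k nu kP q1 D
  (fun _ => b0) (fun _ => a) (fun _ => h) (fun _ => f) mD
  (fun j => ms _ (mb0 j)) (fun j => ms _ (ma j)) (fun j => ms _ (mh j)) (fun j => ms _ (mf j))
  (fun=> b0B) (fun=> fB) (fun=> hI).
exists (x tt); split; [|exact: xC|exact: xE].
by move=> j; exact: (jmeasX1 tt j mx).
Qed.

End deterministic_line_equation.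

(** * Forward solutions: existence and uniqueness *)

Section forward_solutions.
Context {R : realType} {H : hilbertType R} (A : spectral_operator H).
Context {alpha : {nonneg R}}.
Notation X := (fracdom A alpha).
Notation lam := (eigval A).
Notation wt j := (lam j `^ alpha%:num).
Notation leb := (@lebesgue_measure R).
Hypothesis a_lt1 : alpha%:num < 1.
Hypothesis a_lt12 : alpha%:num < 2^-1.
Variables (F : X -> H) (L : R).
Hypothesis L0 : 0 <= L.
Hypothesis FL : forall x y : X, `|F x - F y| <= L * `|x - y|.
Hypothesis F0 : F 0 = 0.

Definition loc_integrable (h : R -> X) : Prop :=
  (forall j, measurable_fun setT (fun s => cr A (h s) j)) /\
  forall r t : R, leb.-integrable `[r, t] (EFin \o (fun s => `|h s|)).

Definition force (y h xi : R -> X) (s : R) : H := F (xi s + y s) + (h s : H).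

Lemma F_le x : `|F x| <= L * `|x|.
Proof. by rewrite -[F x]subr0 -F0 (le_trans (FL _ _))// subr0. Qed.

Lemma cont_on_subset (V : normedModType R) (D E : set R) (f : R -> V) : D `<=` E ->
  cont_on E f -> cont_on D f.
Proof.
move=> DE cf x /DE Ex e e0; have [dl dl0 h] := cf x Ex e e0.
by exists dl => // y /DE Ey; exact: h.
Qed.

Lemma cont_on_cr_measurable (D : set R) (f : R -> X) j : measurable D ->
  cont_on D f -> measurable_fun D (fun s => cr A (f s) j).
Proof. by move=> mD cf; apply: cont_on_measurable => //; exact: cont_on_crX. Qed.

Lemma measurable_force_F (y xi : R -> X) (D : set R) j : measurable D ->
  cont_on D y -> (forall j, measurable_fun D (fun s => cr A (xi s) j)) ->
  measurable_fun D (fun s => cr A (F (xi s + y s)) j).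
Proof.
move=> mD cy mxi; apply: (@measurable_comp_F _ _ A alpha F L L0 FL _ _ _ (fun s => xi s + y s)) => // i.
apply: (eq_measurable_fun (fun s => cr A (xi s) i + cr A (y s) i)).
  by move=> s _; rewrite crXD.
by apply: measurable_funD => //; exact: cont_on_cr_measurable.
Qed.

Lemma loc_integrable_H (h : R -> X) (r t : R) : loc_integrable h ->
  leb.-integrable `[r, t] (EFin \o (fun s => `|h s : H|)).
Proof.
move=> [mh ih].
apply: (@le_integrable _ _ _ leb _ (measurable_itv _) _ (EFin \o (fun s => (wt 0)^-1 * `|h s|))).
- apply/measurable_EFinP; apply: (@measurable_normH _ _ A) => // j.
  by apply: measurable_funTS; exact: mh.
- move=> s _; rewrite /comp lee_fin normr_id (le_trans _ (ler_norm _))//.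
  exact: norm_fd_val_le.
- exact: (@integrableZl _ _ _ leb _ (measurable_itv _) (wt 0)^-1 _ (ih r t)).
Qed.

Lemma admissible_force (y h xi : R -> X) (r t C : R) : cont_on `[r, t] y ->
  loc_integrable h ->
  (forall j, measurable_fun `[r, t] (fun s => cr A (xi s) j)) ->
  (forall s, s \in `[r, t] -> `|xi s| <= C) -> admissible A (force y h xi) `[r, t].
Proof.
move=> cy hl mxi xiC.
have [mh ih] := hl; have [Cy yC] := cont_on_bounded cy.
have mF j : measurable_fun `[r, t] (fun s => cr A (F (xi s + y s)) j).
  exact: measurable_force_F.
have mG j : measurable_fun `[r, t] (fun s => cr A (force y h xi s) j).
  apply: (eq_measurable_fun (fun s => cr A (F (xi s + y s)) j + cr A (h s) j)).
    by move=> s _; rewrite crD.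
  by apply: measurable_funD => //; apply: measurable_funTS; exact: mh.
split=> //.
apply: (@le_integrable _ _ _ leb _ (measurable_itv _) _
  (EFin \o (fun s => L * (C + Cy) + `|h s : H|))).
- by apply/measurable_EFinP; exact: (@measurable_normH _ _ A).
- move=> s /= sD; rewrite lee_fin normr_id (le_trans _ (ler_norm _))//.
  rewrite (le_trans (ler_normD _ _))// lerD// (le_trans (F_le _))// ler_wpM2l//.
  by apply: (le_trans (ler_normD _ _)); apply: lerD; [exact: xiC|exact: yC].
- exact: (@integrableD _ _ _ leb _ (measurable_itv _) _ _ (integrable_cst_itv _ r t)
    (loc_integrable_H r t hl)).
Qed.

Lemma admissible_force_cont (y h xi : R -> X) (r t : R) : cont_on `[r, t] y ->
  loc_integrable h -> cont_on `[r, t] xi -> admissible A (force y h xi) `[r, t].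
Proof.
move=> cy hl cxi; have [C xiC] := cont_on_bounded cxi.
by apply: (admissible_force cy hl _ xiC) => j; exact: cont_on_cr_measurable.
Qed.

Definition solution_on (y h : R -> X) (r t : R) (v : R -> X) : Prop :=
  cont_on `[r, t] v /\ forall s, r <= s <= t -> voc A v (force y h v) r s.

Lemma voc_force_cont_on (y h xi : R -> X) (r t C : R) : r <= t -> cont_on `[r, t] y ->
  loc_integrable h ->
  (forall j, measurable_fun `[r, t] (fun s => cr A (xi s) j)) ->
  (forall s, s \in `[r, t] -> `|xi s| <= C) ->
  (forall s, r <= s <= t -> voc A xi (force y h xi) r s) -> cont_on `[r, t] xi.
Proof.
move=> rt cy [mh ih] mxi xiC vxi; have [Cy yC] := cont_on_bounded cy.
apply: (@voc_cont_on _ _ A alpha a_lt1 a_lt12 xi (fun s => F (xi s + y s)) h r t (L * (C + Cy))) => //.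
- by move=> j; exact: measurable_force_F.
- by move=> j; apply: measurable_funTS; exact: mh.
- move=> s sD; rewrite (le_trans (F_le _))// ler_wpM2l//.
  by apply: (le_trans (ler_normD _ _)); apply: lerD; [exact: xiC|exact: yC].
Qed.

Lemma measurable_itvb (r t : R) : measurable_fun setT (fun s : R => r <= s <= t).
Proof. by apply: measurable_and; exact: measurable_fun_ler. Qed.

(** All data are cut to [[r, t]] and the equation is solved on the whole line with the forward
    kernel. The free term is the semigroup orbit of [vr] after [r] and 0 before, and [f] restores
    the [F (y s)] that the cut nonlinearity subtracts. *)
Lemma solution_on_exists (y h : R -> X) (r t : R) (vr : X) : r <= t -> continuous y ->
  loc_integrable h -> exists2 v, solution_on y h r t v & v r = vr.
Proof.
move=> rt cy hl; have [mh ih] := hl.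
have cy' (D : set R) : cont_on D y.
  by apply/within_cont_onP; exact: continuous_subspaceT.
have [nu [k [nu0 kP q1]]] := @forward_kernel _ _ A alpha a_lt1 a_lt12 L L0.
pose D s := r <= s <= t.
have mD : measurable_fun setT D by exact: measurable_itvb.
have cut s : s \in `[r, t]%classic = D s by apply/idP/idP; rewrite inE/= in_itv.
have /choice[b bE] : forall s, exists b : X, forall j, cr A b j =
    if r <= s then expR (- lam j * (s - r)) * cr A vr j else 0.
  move=> s; case: (leP r s) => rs; last by exists 0 => j; rewrite crX0.
  apply: (@crX_exists _ _ A alpha _ (`|vr| ^+ 2)) => m; apply: le_trans (besselX _ m).
  apply: ler_sum => j _; rewrite mulrCA exprMn ler_piMl ?sqr_ge0// exprn_ile1 ?expR_ge0//.
  by rewrite expR_le1 mulNr oppr_le0 mulr_ge0 ?subr_ge0//; exact/ltW/eigval_gt0.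
have enu s : r <= s -> expR (nu * s) <= expR (nu * r).
  by move=> rs; rewrite ler_expR ler_wnM2l// ltW.
have my j : measurable_fun setT (fun s => cr A (y s) j) by exact: cont_on_cr_measurable.
have mFy j : measurable_fun setT (fun s => cr A (F (y s)) j).
  exact: (@measurable_comp_F _ _ A alpha F L L0 FL).
have [Cy yC] := cont_on_bounded (cy' `[r, t]%classic).
pose f s : H := if D s then F (y s) else 0.
pose h' s : X := if D s then h s else 0.
have ih' : leb.-integrable setT (EFin \o (fun s => expR (nu * s) * `|h' s|)).
  have ih'' : leb.-integrable setT (EFin \o (fun s => `|h' s|)).
    have := (@integrable_mkcond _ _ _ leb _ (EFin \o (fun s => `|h s|)) (measurable_itv `[r, t])).1 (ih r t).
    congr (_.-integrable _ _); apply/funext => s; rewrite patchE cut.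
    have nE : `|h' s| = if D s then `|h s| else 0.
      by rewrite /h'; case: ifP => // _; rewrite normr0.
    by rewrite [RHS]/comp nE; case: ifP.
  have [/measurable_EFinP mn _] := integrableP _ _ _ ih''.
  apply: (@le_integrable _ _ _ leb setT measurableT _ (EFin \o (fun s => expR (nu * r) * `|h' s|))).
  - by apply/measurable_EFinP; apply: measurable_funM; first exact: measurable_expRMr.
  - move=> s _; rewrite /comp lee_fin !ger0_norm ?mulr_ge0 ?expR_ge0//.
    rewrite /h'; case: ifP => [/andP[rs _]|_]; last by rewrite normr0 !mulr0.
    by rewrite ler_wpM2r// enu.
  - exact: (@integrableZl _ _ _ leb setT measurableT _ _ ih'').
have [|||||x [mx [C xC] xE]] := @line_equation1 _ _ A alpha F L _ k nu D b y h' f L0 FL kP q1 mD _ my _ _ _ _ ih'.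
- move=> j; under eq_fun do rewrite bE.
  apply: measurable_fun_ifT => //; first exact: measurable_fun_ler.
  apply: measurable_funM => //; apply: measurableT_comp => //.
  by apply: measurable_funM => //; exact: measurable_funB.
- move=> j; apply: (eq_measurable_fun (fun s => if D s then cr A (h s) j else 0)).
    by move=> s _; rewrite /h'; case: ifP => // _; rewrite crX0.
  exact: measurable_fun_ifT.
- move=> j; apply: (eq_measurable_fun (fun s => if D s then cr A (F (y s)) j else 0)).
    by move=> s _; rewrite /f; case: ifP => // _; rewrite cr0.
  exact: measurable_fun_ifT.
- exists (expR (nu * r) * `|vr|) => s; have [rs|sr] := leP r s.
    rewrite ler_pM ?expR_ge0 ?enu//; apply: normX_le => // m.
    apply: le_trans (besselX _ m); apply: ler_sum => j _.
    rewrite bE rs mulrCA exprMn ler_piMl ?sqr_ge0// exprn_ile1 ?expR_ge0//.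
    by rewrite expR_le1 mulNr oppr_le0 mulr_ge0 ?subr_ge0//; exact/ltW/eigval_gt0.
  have -> : b s = 0 by apply: (@crX_inj _ _ A) => j; rewrite bE leNgt sr/= crX0.
  by rewrite normr0 mulr0 mulr_ge0 ?expR_ge0.
- exists (expR (nu * r) * (L * Cy)) => s; rewrite /f; case: ifPn => [sD|_].
    have /andP[rs st] := sD; rewrite ler_pM ?expR_ge0 ?enu//.
    by rewrite (le_trans (F_le _))// ler_wpM2l// yC// in_itv.
  rewrite normr0 mulr0 mulr_ge0 ?expR_ge0// mulr_ge0//.
  by apply: le_trans (yC r _); rewrite // in_itv/= lexx.
pose G s : H := (if D s then F (x s + y s) - F (y s) else 0) + f s + (h' s : H).
have GE s : D s -> G s = force y h x s.
  by move=> sD; rewrite /G /f /h' sD subrK.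
have G0 s j : ~~ D s -> cr A (G s) j = 0.
  by move=> /negPf sD; rewrite /G /f /h' sD !crD !cr0 !add0r.
have mG j : measurable_fun setT (fun s => cr A (G s) j).
  have mFx : measurable_fun setT (fun s => cr A (F (x s + y s)) j) by exact: measurable_force_F.
  apply: (eq_measurable_fun (fun s => if D s then cr A (F (x s + y s)) j + cr A (h s) j else 0)).
    move=> s _; case: ifPn => sD; last by rewrite G0.
    by rewrite GE// crD.
  by apply: measurable_fun_ifT => //; exact: measurable_funD.
have vE s j : r <= s -> expR (lam j * s) * cr A (x s) j =
    expR (lam j * r) * cr A vr j + \int[leb]_(u in `[r, s]) (expR (lam j * u) * cr A (G u) j).
  move=> rs; have [iK ->] := xE s j; rewrite mulrDr; congr (_ + _).
    by rewrite bE rs mulrA -expRD; congr (expR _ * _); ring.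
  by apply: (conv_cut (T := t)) => // u; exact: G0.
have xr : x r = vr.
  apply: (@crX_inj _ _ A) => j; apply: (mulfI (lt0r_neq0 (expR_gt0 (lam j * r)))).
  by rewrite vE// set_itv1 Rintegral_set1 addr0.
have vx s : r <= s <= t -> voc A x (force y h x) r s.
  move=> /andP[rs st] j; rewrite vE// xr addrAC subrr add0r.
  apply: eq_Rintegral => u; rewrite inE/= in_itv/= => /andP[ru us].
  by rewrite GE// /D ru (le_trans us).
exists x => //; split=> //.
apply: (@voc_force_cont_on y h x r t (expR (- (nu * t)) * C)) => //.
- by move=> j; exact: measurable_funTS.
- move=> s; rewrite in_itv/= => /andP[rs st].
  rewrite expRN ler_pdivlMl ?expR_gt0//; apply: le_trans (xC s).
  by rewrite ler_wpM2r// ler_expR ler_wnM2l// ltW.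
Qed.

(** The difference is the forward convolution of the cut difference of the nonlinear terms. In the
    weighted norm it is at most q < 1 times itself, and it is finite because both solutions are
    bounded on a compact interval. *)
Lemma solution_on_unique (y h : R -> X) (r t : R) (v v' : R -> X) : continuous y -> loc_integrable h ->
  solution_on y h r t v -> solution_on y h r t v' -> v r = v' r -> forall s, r <= s <= t -> v s = v' s.
Proof.
move=> cy hl [cv vv] [cv' vv'] vr s sD.
have cy' (D : set R) : cont_on D y.
  by apply/within_cont_onP; exact: continuous_subspaceT.
have [nu [k [nu0 kP q1]]] := @forward_kernel _ _ A alpha a_lt1 a_lt12 L L0.
have [C vC] := cont_on_bounded cv; have [C' v'C] := cont_on_bounded cv'.
have cut u : u \in `[r, t]%classic = (r <= u <= t) by apply/idP/idP; rewrite inE/= in_itv.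
pose D : set R := [set u | r <= u <= t].
pose d u := expR (nu * u) * `|v u - v' u|.
suff : d s <= 0 / (1 - kmass k * L).
  rewrite mul0r /d pmulr_rle0 ?expR_gt0// normr_le0 subr_eq0.
  by move/eqP.
apply: (@contraction_bound _ _ D d 0 (kmass k * L) (expR (nu * r) * (C + C'))) => //.
- by rewrite mulr_ge0// (kmass_ge0 kP).
- by move=> u _; rewrite mulr_ge0 ?expR_ge0.
- move=> u /andP[ru ut]; rewrite ler_pM ?expR_ge0//.
    by rewrite ler_expR ler_wnM2l// ltW.
  have uI : u \in `[r, t] by rewrite in_itv/= ru.
  by apply: (le_trans (ler_normB _ _)); apply: lerD; [exact: vC|exact: v'C].
move=> M M0 dM u uD; rewrite add0r -mulrA.
pose f w : H := if r <= w <= t then F (v w + y w) - F (v' w + y w) else 0.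
have mF (x : R -> X) : cont_on `[r, t] x -> forall j,
    measurable_fun `[r, t] (fun s => cr A (F (x s + y s)) j).
  by move=> cx j; apply: measurable_force_F => // i; exact: cont_on_cr_measurable.
have mf j : measurable_fun setT (fun s => cr A (f s) j).
  have mFB : measurable_fun `[r, t] (fun s => cr A (F (v s + y s)) j - cr A (F (v' s + y s)) j).
    by apply: measurable_funB; exact: mF.
  have /(measurable_restrictT _ _).1 := mFB => /(_ (measurable_itv _)).
  congr measurable_fun; apply/funext => w; rewrite patchE cut /f.
  by case: ifP => // _; rewrite ?cr0 ?crB.
have fB w : expR (nu * w) * `|f w| <= L * M.
  rewrite /f; case: ifPn => [wD|_]; last by rewrite normr0 mulr0 mulr_ge0.
  apply: (@le_trans _ _ (L * d w)); last by rewrite ler_wpM2l// dM.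
  rewrite /d mulrCA ler_wpM2l ?expR_ge0// (le_trans (FL _ _))//.
  by rewrite opprD addrACA subrr addr0.
apply: (convH_dist kP mf fB) => j.
have [iK _] := convH kP u mf fB.
have /andP[ru ut] := uD.
apply: (mulfI (lt0r_neq0 (expR_gt0 (lam j * u)))).
rewrite (conv_cut (T := t) _ ru (mf j) _ (iK j))//; last first.
  by move=> w /negPf wD; rewrite /f wD cr0.
have ru' : `[r, u] `<=` `[r, t] by apply: subset_itvl; rewrite bnd_simp.
have aG x : cont_on `[r, t] x -> leb.-integrable `[r, u]
    (EFin \o (fun s => expR (lam j * s) * cr A (force y h x s) j)).
  by move=> cx; apply: voc_integrable; apply: admissible_force_cont => //; exact: cont_on_subset cx.
have := vv u uD j; have := vv' u uD j; rewrite vr => e1 e2.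
have -> : expR (lam j * u) * (cr A (v u) j - cr A (v' u) j) =
   \int[leb]_(s0 in `[r, u]) (expR (lam j * s0) * cr A (force y h v s0) j) -
   \int[leb]_(s0 in `[r, u]) (expR (lam j * s0) * cr A (force y h v' s0) j).
  by rewrite -e1 -e2; ring.
rewrite -(@RintegralB _ _ _ leb _ _ _ (measurable_itv _) (aG _ cv) (aG _ cv')).
apply: eq_Rintegral => w; rewrite inE/= in_itv/= => /andP[rw wu].
by rewrite /f rw (le_trans wu ut) /force crB !crD; ring.
Qed.

Definition forward_solution (y h : R -> X) (r : R) (v : R -> X) : Prop :=
  forall t, r <= t -> solution_on y h r t v.

Lemma solution_on_subset (y h : R -> X) (r t t' : R) v : t <= t' -> solution_on y h r t' v -> solution_on y h r t v.
Proof.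
move=> tt' [cv vv]; split; last by move=> s /andP[rs st]; apply: vv; rewrite rs (le_trans st).
by apply: cont_on_subset cv; apply: subset_itvl; rewrite bnd_simp.
Qed.

Lemma eq_solution_on (y h : R -> X) (r t : R) (v v' : R -> X) :
  (forall s, r <= s <= t -> v s = v' s) -> solution_on y h r t v -> solution_on y h r t v'.
Proof.
move=> vv' [cv vv]; split.
  by apply: eq_cont_on cv => s /=; rewrite in_itv/=; exact: vv'.
move=> s /andP[rs st]; apply: eq_voc (vv s _) => //; rewrite ?rs//.
- by rewrite vv'// lexx (le_trans rs).
- by rewrite vv'// rs.
- move=> u; rewrite in_itv/= => /andP[ru us]; rewrite /force vv'//.
  by rewrite ru (le_trans us).
Qed.

(** Solutions on [[r, r + n]] agree on common intervals by uniqueness; the value at [s] is read off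
    the first one known to reach beyond [s]. *)
Lemma forward_solution_exists (y h : R -> X) (r : R) (vr : X) : continuous y -> loc_integrable h ->
  exists2 v, forward_solution y h r v & v r = vr.
Proof.
move=> cy hl.
have rn (n : nat) : r <= r + n%:R by rewrite lerDl.
have /choice[x xE] : forall n, exists x, solution_on y h r (r + n%:R) x /\ x r = vr.
  by move=> n; have [x ? ?] := @solution_on_exists y h r (r + n%:R) vr (rn n) cy hl; exists x.
have agree m n s : (m <= n)%N -> r <= s <= r + m%:R -> x m s = x n s.
  move=> mn sD; apply: (@solution_on_unique y h r (r + m%:R)) => //.
  - exact: (xE m).1.
  - apply: (@solution_on_subset _ _ _ _ (r + n%:R)); last exact: (xE n).1.
    by rewrite lerD2l ler_nat.
  - by rewrite (xE m).2 (xE n).2.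
pose N s := (Num.truncn (s - r)).+1.
pose v s := x (N s) s.
have vE n s : r <= s <= r + n%:R -> x n s = v s.
  move=> sD; have /andP[rs sn] := sD.
  have sN : r <= s <= r + (N s)%:R.
    rewrite rs/= -lerBlDl; exact/ltW/truncnS_gt.
  have [nN|Nn] := leqP n (N s); first exact: agree.
  by rewrite /v (agree (N s) n s) ?(ltnW Nn).
exists v; last by rewrite -(vE 0%N) ?lexx/= ?addr0// (xE _).2.
move=> t rt; pose n := (Num.truncn (t - r)).+1.
have tn : t <= r + n%:R by rewrite -lerBlDl; exact/ltW/truncnS_gt.
apply: (solution_on_subset tn); apply: eq_solution_on (xE n).1 => s sD; exact: vE.
Qed.

Lemma forward_solution_cont_on (y h : R -> X) (r : R) v : forward_solution y h r v -> cont_on `[r, +oo[ v.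
Proof.
move=> vS s /=; rewrite in_itv/= andbT => rs e e0.
have rs1 : r <= s + 1 by lra.
have [cv _] := vS (s + 1) rs1.
have [|dl dl0 h1] := cv s _ e e0; first by rewrite /= in_itv/= rs lerDl ler01.
exists (Num.min dl 1); first by rewrite lt_min dl0 ltr01.
move=> u; rewrite /= in_itv/= andbT => ru; rewrite lt_min => /andP[su su1].
apply: h1 => //; rewrite /= in_itv/= ru/=.
by move: su1; rewrite ltr_distlC => /andP[_ /ltW].
Qed.

End forward_solutions.

(** * The Lyapunov-Perron equation *)

Section backward_trajectories.
Context {R : realType} {H : hilbertType R} (A : spectral_operator H).
Context {alpha : {nonneg R}}.
Notation X := (fracdom A alpha).
Notation lam := (eigval A).
Notation wt j := (lam j `^ alpha%:num).
Notation leb := (@lebesgue_measure R).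
Hypothesis a_lt1 : alpha%:num < 1.
Hypothesis a_lt12 : alpha%:num < 2^-1.
Variables (F : X -> H) (L : R).
Hypothesis L0 : 0 <= L.
Hypothesis FL : forall x y : X, `|F x - F y| <= L * `|x - y|.
Hypothesis F0 : F 0 = 0.
Variables (n : nat) (mu : R) (k : R -> R).
Hypothesis kP : @kernel _ _ A alpha (skernel A true n) k mu.
Hypothesis q1 : kmass k * L < 1.
Hypothesis mu_gt : forall j, (j < n)%N -> lam j <= mu.
Hypothesis mu_lt : mu < lam n.
Variables (y h : R -> X) (Cy : R).
Hypothesis cy : continuous y.
Hypothesis yC : forall s, s <= 0 -> expR (mu * s) * `|y s| <= Cy.
Hypothesis hl : loc_integrable h.
Hypothesis hI : leb.-integrable `]-oo, (0 : R)] (EFin \o (fun s => expR (mu * s) * `|h s|)).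

Definition backward_trajectory (xi : R -> X) : Prop := forall r, r <= 0 -> solution_on F y h r 0 xi.

Definition past_bounded (xi : R -> X) : Prop :=
  exists C, forall t, t <= 0 -> expR (mu * t) * `|xi t| <= C.

Definition past_measurable (xi : R -> X) : Prop :=
  forall j, measurable_fun `]-oo, (0 : R)] (fun s => cr A (xi s) j).

Definition cutF (xi : R -> X) (s : R) : H := if s <= 0 then F (xi s + y s) else 0.
Definition cuth (s : R) : X := if s <= 0 then h s else 0.

(* The Lyapunov-Perron equation written as one convolution on the whole line: the
   integrals over [t, 0] and ]-oo, t] are the two branches of [skernel]. *)
Definition line_form (x : X) (xi : R -> X) : Prop := forall t j, t <= 0 ->
  cr A (xi t) j = (if (j < n)%N then expR (- lam j * t) * cr A x j else 0) +
    \int[leb]_s (skernel A true n j (t - s) * cr A (cutF xi s + (cuth s : H)) j).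

Let cutE s : s \in `]-oo, (0 : R)]%classic = (s <= 0).
Proof. by apply/idP/idP; rewrite inE/= in_itv. Qed.

Lemma measurable_cut (D : set R) (f g : R -> R) : measurable_fun `]-oo, (0 : R)] f ->
  (forall s, s <= 0 -> g s = f s) -> (forall s, 0 < s -> g s = 0) ->
  measurable_fun setT g.
Proof.
move=> mf g1 g2; have /(measurable_restrictT _ _).1 := mf => /(_ (measurable_itv _)).
congr measurable_fun; apply/funext => s; rewrite patchE cutE.
by case: leP => s0; [rewrite g1|rewrite g2].
Qed.

Lemma cont_on_y (D : set R) : cont_on D y.
Proof. by apply/within_cont_onP; exact: continuous_subspaceT. Qed.

Lemma measurable_cutF (xi : R -> X) j : past_measurable xi ->
  measurable_fun setT (fun s => cr A (cutF xi s) j).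
Proof.
move=> mxi; apply: (@measurable_cut setT (fun s => cr A (F (xi s + y s)) j)).
- by apply: (measurable_force_F L0 FL) => //; exact: cont_on_y.
- by move=> s s0; rewrite /cutF s0.
- by move=> s s0; rewrite /cutF leNgt s0/= cr0.
Qed.

Lemma measurable_cuth j : measurable_fun setT (fun s => cr A (cuth s) j).
Proof.
apply: (@measurable_cut setT (fun s => cr A (h s) j)).
- by apply: measurable_funTS; exact: hl.1.
- by move=> s s0; rewrite /cuth s0.
- by move=> s s0; rewrite /cuth leNgt s0/= crX0.
Qed.

Lemma cutF_bound (xi : R -> X) C : (forall t, t <= 0 -> expR (mu * t) * `|xi t| <= C) ->
  forall s, expR (mu * s) * `|cutF xi s| <= L * (C + Cy).
Proof.
move=> xC s.
have CC : 0 <= C + Cy.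
  apply: addr_ge0; [apply: le_trans (xC 0 (lexx _))|apply: le_trans (yC (lexx _))];
  by rewrite mulr_ge0 ?expR_ge0.
rewrite /cutF; case: ifPn => [s0|_]; last by rewrite normr0 mulr0 mulr_ge0.
apply: (@le_trans _ _ (expR (mu * s) * (L * (`|xi s| + `|y s|)))).
  rewrite ler_wpM2l ?expR_ge0//; apply: (le_trans (F_le FL F0 _)).
  by rewrite ler_wpM2l// ler_normD.
rewrite mulrCA ler_wpM2l// mulrDr; apply: lerD; [exact: xC|exact: yC].
Qed.

Lemma integrable_cuth : leb.-integrable setT (EFin \o (fun s => expR (mu * s) * `|cuth s|)).
Proof.
have := (@integrable_mkcond _ _ _ leb _ (EFin \o (fun s => expR (mu * s) * `|h s|))
  (measurable_itv `]-oo, 0])).1 hI.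
congr (_.-integrable _ _); apply/funext => s; rewrite patchE cutE.
have nE : `|cuth s| = if s <= 0 then `|h s| else 0.
  by rewrite /cuth; case: ifP => // _; rewrite normr0.
by rewrite [RHS]/comp nE; case: ifP; rewrite ?mulr0.
Qed.

Lemma line_integrable (xi : R -> X) t j : past_measurable xi -> past_bounded xi ->
  leb.-integrable setT (EFin \o (fun s => skernel A true n j (t - s) *
    cr A (cutF xi s + (cuth s : H)) j)).
Proof.
move=> mxi [C xC].
have [i1 _] := convH kP t (fun j => measurable_cutF j mxi) (cutF_bound xC).
have [i2 _] := convX kP t measurable_cuth integrable_cuth.
rewrite (_ : (fun s => _) = (fun s => skernel A true n j (t - s) * cr A (cutF xi s) j +
  skernel A true n j (t - s) * cr A (cuth s) j)).
  exact: (@integrableD _ _ _ leb _ measurableT _ _ (i1 j) (i2 j)).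
by apply/funext => s; rewrite crD mulrDr.
Qed.

(** Growth of a single coordinate of the convolution at [-oo]; it is compared with
    [expR (- lam j * t)] below. *)
Lemma line_conv_bound (xi : R -> X) j : past_measurable xi -> past_bounded xi ->
  exists M, forall t, expR (mu * t) * `|\int[leb]_s (skernel A true n j (t - s) *
    cr A (cutF xi s + (cuth s : H)) j)| <= M.
Proof.
move=> mxi [C xC].
pose M1 := kmass k * (L * (C + Cy)); pose M2 := \int[leb]_s (expR (mu * s) * `|cuth s|).
exists ((wt j)^-1 * (M1 + M2)) => t.
have [i1 s1] := convH kP t (fun j => measurable_cutF j mxi) (cutF_bound xC).
have [i2 s2] := convX kP t measurable_cuth integrable_cuth.
have -> : (fun s => skernel A true n j (t - s) * cr A (cutF xi s + (cuth s : H)) j) =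
  (fun s => skernel A true n j (t - s) * cr A (cutF xi s) j +
  skernel A true n j (t - s) * cr A (cuth s) j).
  by apply/funext => s; rewrite crD mulrDr.
rewrite (@RintegralD _ _ _ leb _ _ _ measurableT (i1 j) (i2 j)).
have one (I : nat -> R) M : 0 <= M ->
    (forall m, \sum_(j < m) (wt j * I j) ^+ 2 <= (expR (- (mu * t)) * M) ^+ 2) ->
    expR (mu * t) * `|I j| <= (wt j)^-1 * M.
  move=> M0 sM; rewrite ler_pdivlMl ?wt_gt0// mulrCA -ler_pdivlMl ?expR_gt0// -expRN.
  rewrite -[wt j]ger0_norm ?powR_ge0// -normrM -(@ler_pXn2r _ 2) ?nnegrE ?mulr_ge0 ?expR_ge0//.
  rewrite real_normK ?num_real//; apply: le_trans (sM j.+1).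
  by rewrite big_ord_recr/= lerDr sumr_ge0// => i _; exact: sqr_ge0.
rewrite mulrDr; apply: (@le_trans _ _ (expR (mu * t) *
   (`|\int[leb]_s (skernel A true n j (t - s) * cr A (cutF xi s) j)| +
    `|\int[leb]_s (skernel A true n j (t - s) * cr A (cuth s) j)|))).
  by rewrite ler_wpM2l ?expR_ge0// ler_normD.
rewrite mulrDr; apply: lerD.
  apply: (one (fun j => \int[leb]_s (skernel A true n j (t - s) * cr A (cutF xi s) j))) => //.
  by rewrite mulr_ge0 ?(kmass_ge0 kP)//; apply: le_trans (cutF_bound xC 0); rewrite mulr_ge0 ?expR_ge0.
apply: (one (fun j => \int[leb]_s (skernel A true n j (t - s) * cr A (cuth s) j))) => //.
by apply: Rintegral_ge0 => s _; rewrite mulr_ge0 ?expR_ge0.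
Qed.

Lemma cut_forceE (xi : R -> X) s : s <= 0 ->
  cutF xi s + (cuth s : H) = force F y h xi s.
Proof. by move=> s0; rewrite /cutF /cuth s0. Qed.

Lemma measurable_cut_force (xi : R -> X) j : past_measurable xi ->
  measurable_fun setT (fun s => cr A (cutF xi s + (cuth s : H)) j).
Proof.
move=> mxi; under eq_fun do rewrite crD.
by apply: measurable_funD; [exact: measurable_cutF|exact: measurable_cuth].
Qed.

Lemma line_conv_diff (xi : R -> X) (r t : R) j : past_measurable xi -> past_bounded xi ->
  r <= t -> t <= 0 ->
  expR (lam j * t) * (\int[leb]_s (skernel A true n j (t - s) * cr A (cutF xi s + (cuth s : H)) j)) -
  expR (lam j * r) * (\int[leb]_s (skernel A true n j (r - s) * cr A (cutF xi s + (cuth s : H)) j)) =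
  \int[leb]_(s in `[r, t]) (expR (lam j * s) * cr A (force F y h xi s) j).
Proof.
move=> mxi bxi rt t0.
rewrite (@skernel_diff _ _ A true n j r t (fun s => cr A (cutF xi s + (cuth s : H)) j))//.
- apply: eq_Rintegral => s; rewrite inE/= in_itv/= => /andP[_ st].
  by rewrite cut_forceE// (le_trans st).
- exact: measurable_cut_force.
- exact: line_integrable.
- exact: line_integrable.
Qed.

(** At time 0 the kernel of a low mode lives on [s >= 0], where the cut forcing vanishes except at
    the single point 0. *)
Lemma line_conv0 (xi : R -> X) j : (j < n)%N ->
  \int[leb]_s (skernel A true n j (0 - s) * cr A (cutF xi s + (cuth s : H)) j) = 0.
Proof.
move=> jn.
transitivity (\int[leb]_(s in [set (0 : R)]) (- cr A (cutF xi s + (cuth s : H)) j)); last first.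
  exact: Rintegral_set1.
rewrite [RHS]Rintegral_mkcond; apply: eq_Rintegral => s _; rewrite patchE.
have -> : (s \in [set (0 : R)]) = (s == 0).
  by apply/idP/eqP; rewrite inE.
rewrite /skernel sub0r oppr_gt0 jn/=; case: (ltgtP s 0) => s0.
- by rewrite mul0r.
- by rewrite /cutF /cuth leNgt s0/= crD !cr0 addr0 mulr0.
- by rewrite s0 oppr0 mulr0 expR0 mulN1r.
Qed.

Lemma cont_on_past_measurable (xi : R -> X) : cont_on `]-oo, (0 : R)] xi -> past_measurable xi.
Proof. by move=> cxi j; exact: cont_on_cr_measurable. Qed.

Lemma backward_trajectory_cont_on (xi : R -> X) : backward_trajectory xi -> cont_on `]-oo, (0 : R)] xi.
Proof.
move=> bxi s /=; rewrite in_itv/= => s0 e e0.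
have s10 : s - 1 <= 0 by lra.
have [cv _] := bxi _ s10.
have [|dl dl0 h1] := cv s _ e e0.
  by rewrite /= in_itv/= s0 andbT; lra.
exists (Num.min dl 1); first by rewrite lt_min dl0 ltr01.
move=> u; rewrite /= in_itv/= => u0; rewrite lt_min => /andP[su su1].
apply: h1 => //; rewrite /= in_itv/= u0 andbT.
by move: su1; rewrite ltr_distlC => /andP[/ltW].
Qed.

(** After multiplication by [expR (lam j * t)] the free term is constant in time and drops out of
    differences; what remains is [voc]. Continuity then follows. *)
Lemma line_form_backward_trajectory (x : X) (xi : R -> X) : past_measurable xi -> past_bounded xi ->
  line_form x xi -> backward_trajectory xi /\ forall j, (j < n)%N -> cr A (xi 0) j = cr A x j.
Proof.
move=> mxi bxi lf.
have vxi r t : r <= t -> t <= 0 -> voc A xi (force F y h xi) r t.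
  move=> rt t0 j; rewrite -(line_conv_diff j mxi bxi rt t0).
  rewrite (lf t j t0) (lf r j (le_trans rt t0)) !mulrDr opprD addrACA.
  have E u : expR (lam j * u) * (if (j < n)%N then expR (- lam j * u) * cr A x j else 0) =
      if (j < n)%N then cr A x j else 0.
    by case: ifP => _; rewrite ?mulr0// mulrA -expRD mulNr subrr expR0 mul1r.
  by rewrite !E subrr add0r.
split=> [r r0|j jn].
  have [C xC] := bxi.
  split; last by move=> s /andP[rs s0]; exact: vxi.
  apply: (@voc_force_cont_on _ _ A alpha a_lt1 a_lt12 F L L0 FL F0 y h xi r 0
    (expR (`|mu| * (`|r| + `|0|)) * C)) => //.
  - exact: cont_on_y.
  - move=> j; apply: measurable_funS (mxi j) => //.
    by move=> s /=; rewrite !in_itv/= => /andP[].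
  - move=> s sD; have := sD; rewrite in_itv/= => /andP[rs s0].
    have C0 : 0 <= C by apply: le_trans (xC 0 (lexx _)); rewrite mulr_ge0 ?expR_ge0.
    have sD' : s \in `[r, 0 : R] by [].
    have eb := expR_itv_bound (- mu) sD'.
    rewrite normrN ger0_norm ?expR_ge0// in eb.
    apply: (@le_trans _ _ (expR (- mu * s) * C)); last by apply: ler_wpM2r => //; exact: eb.
    by rewrite mulNr expRN ler_pdivlMl ?expR_gt0// xC.
  - by move=> s /andP[rs s0]; exact: vxi.
rewrite (lf 0 j (lexx _)) jn mulr0 expR0 mul1r -[RHS]addr0; congr (_ + _).
exact: line_conv0.
Qed.

(* For [j >= n] the solution and the convolution differ by a multiple of
   [e^(- lam_j t)], which is too large at [-oo] unless it vanishes. *)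
Lemma backward_trajectory_line_form (xi : R -> X) : past_bounded xi -> backward_trajectory xi -> line_form (xi 0) xi.
Proof.
move=> bxi tr.
have cxi := backward_trajectory_cont_on tr; have mxi := cont_on_past_measurable cxi.
pose I j t := \int[leb]_s (skernel A true n j (t - s) * cr A (cutF xi s + (cuth s : H)) j).
have dE r t j : r <= t -> t <= 0 ->
    expR (lam j * t) * (cr A (xi t) j - I j t) = expR (lam j * r) * (cr A (xi r) j - I j r).
  move=> rt t0; have [_ /(_ t)] := tr r (le_trans rt t0).
  rewrite rt t0 => /(_ isT j); rewrite -(line_conv_diff j mxi bxi rt t0) -/(I j t) -/(I j r).
  have exch (a b c d : R) : a - b = c - d -> a - c = b - d by move=> ?; lra.
  by move=> e; rewrite !mulrBr; exact: exch.
move=> t j t0; case: ifPn => [jn|]; last rewrite -leqNgt => nj.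
  have I00 : I j 0 = 0 by exact: line_conv0.
  have := dE t 0 j t0 (lexx _); rewrite I00 subr0 mulr0 expR0 mul1r => ->.
  by rewrite mulrA -expRD mulNr addNr expR0 mul1r -/(I j t) subrK.
rewrite add0r; apply/eqP; rewrite -subr_eq0 -/(I j t).
have [M IM] := line_conv_bound j mxi bxi; have [C xC] := bxi.
pose c := expR (lam j * t) * (cr A (xi t) j - I j t).
suff : c = 0 by move/eqP; rewrite mulf_eq0 gt_eqF ?expR_gt0.
have d0 : 0 < lam j - mu by rewrite subr_gt0 (lt_le_trans mu_lt)// eigval_nondecreasing.
pose B := (wt j)^-1 * C + M.
have cB r : r <= t -> `|c| <= expR ((lam j - mu) * r) * B.
  move=> rt; rewrite /c (dE r t j rt t0) normrM ger0_norm ?expR_ge0//.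
  rewrite (_ : expR (lam j * r) = expR ((lam j - mu) * r) * expR (mu * r)); last first.
    by rewrite -expRD; congr expR; ring.
  rewrite -mulrA ler_wpM2l ?expR_ge0//.
  apply: (@le_trans _ _ (expR (mu * r) * (`|cr A (xi r) j| + `|I j r|))).
    by rewrite ler_wpM2l ?expR_ge0// ler_normB.
  rewrite mulrDr; apply: lerD; last exact: IM.
  apply: (@le_trans _ _ (expR (mu * r) * ((wt j)^-1 * `|xi r|))).
    by rewrite ler_wpM2l ?expR_ge0// norm_cr_le.
  by rewrite mulrCA ler_wpM2l ?invr_ge0 ?powR_ge0// xC// (le_trans rt).
have B0 : 0 <= B.
  have := le_trans (normr_ge0 _) (cB t (lexx _)).
  by rewrite pmulr_rge0 ?expR_gt0.
apply/eqP; rewrite -normr_le0; apply/ler_addgt0Pr => e e0; rewrite add0r.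
(* So far in the past that [expR (- ((lam j - mu) * r))] exceeds [B / e], by [1 + x <= expR x]. *)
pose r := Num.min t (- (B / e / (lam j - mu))).
have rt : r <= t by rewrite ge_min lexx.
apply: (le_trans (cB r rt)).
have rB : r <= - (B / e / (lam j - mu)) by rewrite ge_min lexx orbT.
rewrite mulrC -ler_pdivlMr ?expR_gt0// -expRN.
have h1 : B / e <= - ((lam j - mu) * r).
  have := ler_wpM2l (ltW d0) rB; rewrite mulrN [X in _ <= - X]mulrC divfK ?gt_eqF//.
  by rewrite lerNr.
rewrite -ler_pdivrMl// mulrC; apply: (le_trans h1).
by apply: le_trans (expR_ge1Dx _); rewrite lerDr.
Qed.

(** The free terms differ by at most [|x1 - x2|] in the weighted norm, because [lam j <= mu] for the
    low modes and time is negative; the convolutions contract. For [x1 = x2] this is uniqueness. *)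
Lemma line_form_lipschitz (x1 x2 : X) (xi1 xi2 : R -> X) :
  past_measurable xi1 -> past_bounded xi1 -> line_form x1 xi1 ->
  past_measurable xi2 -> past_bounded xi2 -> line_form x2 xi2 ->
  forall t, t <= 0 ->
  expR (mu * t) * `|xi1 t - xi2 t| <= `|x1 - x2| / (1 - kmass k * L).
Proof.
move=> m1 b1 l1 m2 b2 l2 t t0.
have [C1 xC1] := b1; have [C2 xC2] := b2.
pose d t := expR (mu * t) * `|xi1 t - xi2 t|.
apply: (@contraction_bound _ _ [set t | t <= 0] d `|x1 - x2| (kmass k * L) (C1 + C2)) => //.
- by rewrite mulr_ge0// (kmass_ge0 kP).
- by move=> u _; rewrite /d mulr_ge0 ?expR_ge0.
- move=> u /= u0; rewrite /d; apply: (@le_trans _ _ (expR (mu * u) * (`|xi1 u| + `|xi2 u|))).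
    by rewrite ler_wpM2l ?expR_ge0// ler_normB.
  by rewrite mulrDr; apply: lerD; [exact: xC1|exact: xC2].
move=> M M0 dM u /= u0.
pose f s := cutF xi1 s - cutF xi2 s.
have mf j : measurable_fun setT (fun s => cr A (f s) j).
  by under eq_fun do rewrite crB; apply: measurable_funB; exact: measurable_cutF.
have fB s : expR (mu * s) * `|f s| <= L * M.
  rewrite /f /cutF; case: ifPn => [s0|_]; last by rewrite subr0 normr0 mulr0 mulr_ge0.
  apply: (@le_trans _ _ (L * (expR (mu * s) * `|xi1 s - xi2 s|))); last first.
    by rewrite ler_wpM2l// dM.
  rewrite mulrCA ler_wpM2l ?expR_ge0//; apply: (le_trans (FL _ _)).
  by rewrite opprD addrACA subrr addr0.
have [w wE] : exists w : X, forall j, cr A w j =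
    if (j < n)%N then expR (- lam j * u) * cr A (x1 - x2 : X) j else 0.
  apply: (@crX_exists _ _ A alpha (fun j => if (j < n)%N then expR (- lam j * u) * cr A (x1 - x2 : X) j else 0)
     ((expR (- mu * u) * `|x1 - x2|) ^+ 2)) => m.
  rewrite exprMn; apply: (@le_trans _ _ (expR (- mu * u) ^+ 2 *
    \sum_(j < m) (wt j * cr A (x1 - x2 : X) j) ^+ 2)); last first.
    by rewrite ler_wpM2l ?sqr_ge0// besselX.
  rewrite mulr_sumr; apply: ler_sum => j _; case: ifPn => [jn|_]; last first.
    by rewrite mulr0 expr0n mulr_ge0 ?sqr_ge0.
  rewrite mulrCA exprMn ler_wpM2r ?sqr_ge0// ler_pXn2r ?nnegrE ?expR_ge0// ler_expR.
  by rewrite !mulNr lerN2 ler_wnM2r// mu_gt.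
have wn : expR (mu * u) * `|w| <= `|x1 - x2|.
  rewrite -ler_pdivlMl ?expR_gt0// -expRN -mulNr; apply: normX_le => [|m].
    by rewrite mulr_ge0 ?expR_ge0.
  rewrite exprMn; apply: (@le_trans _ _ (expR (- mu * u) ^+ 2 *
    \sum_(j < m) (wt j * cr A (x1 - x2 : X) j) ^+ 2)); last first.
    by rewrite ler_wpM2l ?sqr_ge0// besselX.
  rewrite mulr_sumr; apply: ler_sum => j _; rewrite wE; case: ifPn => [jn|_]; last first.
    by rewrite mulr0 expr0n mulr_ge0 ?sqr_ge0.
  rewrite mulrCA exprMn ler_wpM2r ?sqr_ge0// ler_pXn2r ?nnegrE ?expR_ge0// ler_expR.
  by rewrite !mulNr lerN2 ler_wnM2r// mu_gt.
have key : expR (mu * u) * `|(xi1 u - xi2 u) - w| <= kmass k * (L * M).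
  apply: (convH_dist kP mf fB) => j.
  rewrite wE crXB (l1 u j u0) (l2 u j u0).
  have i1 := line_integrable u j m1 b1; have i2 := line_integrable u j m2 b2.
  have -> : (fun s => skernel A true n j (u - s) * cr A (f s) j) =
    (fun s => skernel A true n j (u - s) * cr A (cutF xi1 s + (cuth s : H)) j -
              skernel A true n j (u - s) * cr A (cutF xi2 s + (cuth s : H)) j).
    by apply/funext => s; rewrite /f crB !crD; ring.
  rewrite (@RintegralB _ _ _ leb _ _ _ measurableT i1 i2).
  by case: ifP => _; rewrite ?crXB; ring.
rewrite /d -[xi1 u - xi2 u](subrK w).
apply: (@le_trans _ _ (expR (mu * u) * (`|xi1 u - xi2 u - w| + `|w|))).
  by rewrite ler_wpM2l ?expR_ge0// ler_normD.
by rewrite mulrDr addrC; apply: lerD => //; rewrite -mulrA.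
Qed.

End backward_trajectories.

(** * The Bochner form of the Lyapunov-Perron equation *)

Section lyapunov_perron_equation.
Context {R : realType} {H : hilbertType R} (A : spectral_operator H).
Context {alpha : {nonneg R}}.
Notation X := (fracdom A alpha).
Notation lam := (eigval A).
Notation wt j := (lam j `^ alpha%:num).
Notation leb := (@lebesgue_measure R).
Hypothesis a_lt1 : alpha%:num < 1.
Hypothesis a_lt12 : alpha%:num < 2^-1.
Variables (F : X -> H) (L : R).
Hypothesis L0 : 0 <= L.
Hypothesis FL : forall x y : X, `|F x - F y| <= L * `|x - y|.
Hypothesis F0 : F 0 = 0.
Variables (n : nat) (mu : R).
Hypothesis mu0 : 0 < mu.
Hypothesis mu_lt : mu < lam n.
Variables (y h : R -> X) (Cy : R).
Hypothesis cy : continuous y.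
Hypothesis yC : forall s, s <= 0 -> expR (mu * s) * `|y s| <= Cy.
Hypothesis hl : loc_integrable h.
Hypothesis hI : leb.-integrable `]-oo, (0 : R)] (EFin \o (fun s => expR (mu * s) * `|h s|)).

Lemma integrable_expR_past (d : R) : 0 < d ->
  leb.-integrable `]-oo, (0 : R)] (EFin \o (fun s => expR (d * s))).
Proof.
(* The backward branch of this profile is [expR (d * u)] itself. *)
move=> d0; have := @integrable_wprofile R 0 0 1 1 d (lexx _) ltr01 (lexx _) ler01 ltr01 d0.
move=> /(@integrableS _ _ _ leb setT _ _ measurableT (measurable_itv `]-oo, 0]) (subsetT _)).
apply: eq_integrable => // s; rewrite inE/= in_itv/= => s0.
by rewrite /wprofile ltNge s0 /= mul1r.
Qed.

Lemma Rintegral_patch (D : set R) (f g : R -> R) :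
  (forall s, f s = if s \in D then g s else 0) -> \int[leb]_s f s = \int[leb]_(s in D) g s.
Proof.
by move=> fg; rewrite [RHS]Rintegral_mkcond; apply: eq_Rintegral => s _; rewrite patchE fg.
Qed.

Section trajectory.
Variable xi : R -> X.
Hypothesis mxi : past_measurable xi.
Hypothesis bxi : past_bounded mu xi.
Let G s : H := F (xi s + y s) + (h s : H).

Lemma past_force_meas (D : set R) j : measurable D -> D `<=` `]-oo, (0 : R)] ->
  measurable_fun D (fun s => cr A (G s) j).
Proof.
move=> mD D0; apply: (eq_measurable_fun (fun s => cr A (cutF F y xi s + (cuth h s : H)) j)).
  by move=> s; rewrite inE => /D0; rewrite /= in_itv/= => s0; rewrite cut_forceE.
apply: measurable_funTS; exact: (@measurable_cut_force _ _ A alpha F L L0 FL y h cy hl xi j mxi).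
Qed.

Lemma past_force_le : exists2 C, 0 <= C & forall s, s <= 0 ->
  `|G s| <= expR (- mu * s) * C + (wt 0)^-1 * `|h s|.
Proof.
have [C xC] := bxi.
have CC : 0 <= C + Cy.
  apply: addr_ge0; [apply: le_trans (xC 0 (lexx _))|apply: le_trans (yC (lexx _))];
  by rewrite mulr_ge0 ?expR_ge0.
exists (L * (C + Cy)); first exact: mulr_ge0.
move=> s s0; apply: (le_trans (ler_normD _ _)); apply: lerD; last exact: norm_fd_val_le.
have := cutF_bound L0 FL F0 yC xC s; rewrite /cutF s0.
by rewrite mulNr expRN ler_pdivlMl ?expR_gt0.
Qed.

Lemma past_force_int (t : R) :
  leb.-integrable `[t, (0 : R)] (EFin \o (fun s => `|G s|)).
Proof.
have [C C0 GC] := past_force_le.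
have i1 := integrable_cst_itv (expR (`|mu| * (`|t| + `|0 : R|)) * C) t 0.
have i2 := @integrableZl _ _ _ leb _ (measurable_itv _) (wt 0)^-1 _ (hl.2 t 0).
have := @integrableD _ _ _ leb _ (measurable_itv _) _ _ i1 i2.
apply: (@le_integrable _ _ _ leb _ (measurable_itv _)).
  apply/measurable_EFinP; apply: (@measurable_normH _ _ A) => // j.
  by apply: past_force_meas => // s /=; rewrite !in_itv/= => /andP[].
move=> s sD; rewrite /comp lee_fin normr_id (le_trans _ (ler_norm _))//.
have s0 : s <= 0 by move: sD; rewrite /= in_itv/= => /andP[].
apply: (le_trans (GC s s0)); rewrite lerD2r ler_wpM2r//.
have := expR_itv_bound (- mu) sD; rewrite normrN; apply: le_trans.
exact: ler_norm.
Qed.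

(** Here [t - s <= 0]: the semigroup runs backward, but only on the first n modes, where
    [expR (lam n * - t)] bounds it on the whole interval. *)
Lemma bochner_low (t : R) j : t <= 0 ->
  cr A (bochner_integral leb `[t, (0 : R)] (fun s => semigroup A (t - s) (proj A n (G s)))) j =
  if (j < n)%N then \int[leb]_(s in `[t, (0 : R)]) (expR (- lam j * (t - s)) * cr A (G s) j) else 0.
Proof.
move=> t0.
have crE s i : cr A (semigroup A (t - s) (proj A n (G s))) i =
    if (i < n)%N then expR (- lam i * (t - s)) * cr A (G s) i else 0.
  rewrite (@cr_semigroup_fin _ _ _ _ _ n); last by move=> i' ni; rewrite cr_proj ltnNge ni.
  by rewrite cr_proj; case: ifP => _; rewrite ?mulr0.
have sub0 : `[t, (0 : R)] `<=` `]-oo, (0 : R)].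
  by move=> s /=; rewrite !in_itv/= => /andP[].
have mE i : measurable_fun `[t, (0 : R)] (fun s => expR (- lam i * (t - s))).
  apply: measurable_funTS; apply: measurableT_comp => //.
  by apply: measurable_funM => //; exact: measurable_funB.
have mf i : measurable_fun `[t, (0 : R)] (fun s => cr A (semigroup A (t - s) (proj A n (G s))) i).
  apply: (eq_measurable_fun (fun s : R => if (i < n)%N then expR (- lam i * (t - s)) * cr A (G s) i else 0)).
    by move=> s _; rewrite crE.
  by case: (i < n)%N => //; apply: measurable_funM => //; exact: past_force_meas.
have bnd s : `[t, (0 : R)]%classic s ->
    `|semigroup A (t - s) (proj A n (G s))| <= expR (lam n * - t) * `|G s|.
  rewrite /= in_itv/= => /andP[ts s0].
  apply: (@norm_le_cr _ _ A) => [|m]; first by rewrite mulr_ge0 ?expR_ge0.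
  rewrite exprMn; apply: (@le_trans _ _ (expR (lam n * - t) ^+ 2 * \sum_(i < m) cr A (G s) i ^+ 2)).
    rewrite mulr_sumr; apply: ler_sum => i _; rewrite crE; case: ifPn => i_n.
      rewrite exprMn ler_wpM2r ?sqr_ge0// ler_pXn2r ?nnegrE ?expR_ge0// ler_expR.
      rewrite mulNr -mulrN opprB.
      have lin : lam i <= lam n by apply: eigval_nondecreasing; exact: ltnW.
      apply: (@le_trans _ _ (lam n * (s - t))); first by rewrite ler_wpM2r// subr_ge0.
      by rewrite ler_wpM2l ?(ltW (eigval_gt0 _ _))// gerDr.
    by rewrite expr0n mulr_ge0 ?sqr_ge0.
  by rewrite ler_wpM2l ?sqr_ge0// bessel.
have iphi := @integrableZl _ _ _ leb _ (measurable_itv _) (expR (lam n * - t)) _ (past_force_int t).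
have [_ ->] := @bochner_integral_cr _ _ A _ _ leb `[t, (0 : R)]%classic
  (fun s => semigroup A (t - s) (proj A n (G s))) _ (measurable_itv _) mf iphi bnd.
case: ifPn => jn; first by apply: eq_Rintegral => s _; rewrite crE jn.
transitivity (\int[leb]_(s in `[t, (0 : R)]) (0 : R)); last by rewrite Rintegral_cst// mul0r.
by apply: eq_Rintegral => s _; rewrite crE (negPf jn).
Qed.

(** On the modes from n on the semigroup decays at least like [expR (- lam n * (t - s))]. Against a
    forcing of growth [expR (- mu * s)] this is integrable at [-oo] because [mu < lam n]. *)
Lemma bochner_high (t : R) j : t <= 0 ->
  cr A (bochner_integral leb `]-oo, t] (fun s => semigroup A (t - s) (G s - proj A n (G s)))) j =
  if (j < n)%N then 0 else \int[leb]_(s in `]-oo, t]) (expR (- lam j * (t - s)) * cr A (G s) j).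
Proof.
move=> t0.
have crE s i : s <= t -> cr A (semigroup A (t - s) (G s - proj A n (G s))) i =
    if (i < n)%N then 0 else expR (- lam i * (t - s)) * cr A (G s) i.
  move=> st; rewrite cr_semigroup ?subr_ge0// crB cr_proj.
  by case: ifP => _; rewrite ?subrr ?mulr0 ?subr0.
have sub0 : `]-oo, t] `<=` `]-oo, (0 : R)].
  by move=> s /=; rewrite !in_itv/= => /le_trans; apply.
have mE i : measurable_fun `]-oo, t] (fun s => expR (- lam i * (t - s))).
  apply: measurable_funTS; apply: measurableT_comp => //.
  by apply: measurable_funM => //; exact: measurable_funB.
have [C C0 GC] := past_force_le.
pose E0 := expR (- (lam n * t)).
have d0 : 0 < lam n - mu by rewrite subr_gt0.
have phiI : leb.-integrable `]-oo, t] (EFin \o (fun s =>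
    E0 * C * expR ((lam n - mu) * s) + E0 * (wt 0)^-1 * (expR (mu * s) * `|h s|))).
  apply: (@integrableS _ _ _ leb `]-oo, (0 : R)]) => //.
  have i1 := @integrableZl _ _ _ leb _ (measurable_itv _) (E0 * C) _ (integrable_expR_past d0).
  have i2 := @integrableZl _ _ _ leb _ (measurable_itv _) (E0 * (wt 0)^-1) _ hI.
  exact: (@integrableD _ _ _ leb _ (measurable_itv _) _ _ i1 i2).
have mf i : measurable_fun `]-oo, t] (fun s => cr A (semigroup A (t - s) (G s - proj A n (G s))) i).
  apply: (eq_measurable_fun (fun s : R => if (i < n)%N then 0 else expR (- lam i * (t - s)) * cr A (G s) i)).
    by move=> s; rewrite inE/= in_itv/= => st; rewrite crE.
  by case: (i < n)%N => //; apply: measurable_funM => //; exact: past_force_meas.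
have bnd s : `]-oo, t]%classic s -> `|semigroup A (t - s) (G s - proj A n (G s))| <=
    E0 * C * expR ((lam n - mu) * s) + E0 * (wt 0)^-1 * (expR (mu * s) * `|h s|).
  rewrite /= in_itv/= => st; have s0 := le_trans st t0.
  apply: (@le_trans _ _ (expR (- lam n * (t - s)) * `|G s|)).
    apply: (@norm_le_cr _ _ A) => [|m]; first by rewrite mulr_ge0 ?expR_ge0.
    rewrite exprMn; apply: (@le_trans _ _ (expR (- lam n * (t - s)) ^+ 2 * \sum_(i < m) cr A (G s) i ^+ 2)).
      rewrite mulr_sumr; apply: ler_sum => i _; rewrite crE//; case: ltnP => i_n.
        by rewrite expr0n mulr_ge0 ?sqr_ge0.
      rewrite exprMn ler_wpM2r ?sqr_ge0// ler_pXn2r ?nnegrE ?expR_ge0// ler_expR.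
      by rewrite ler_wpM2r ?subr_ge0// lerN2 eigval_nondecreasing.
    by rewrite ler_wpM2l ?sqr_ge0// bessel.
  apply: (@le_trans _ _ (expR (- lam n * (t - s)) * (expR (- mu * s) * C + (wt 0)^-1 * `|h s|))).
    by rewrite ler_wpM2l ?expR_ge0// GC.
  have -> : expR (- lam n * (t - s)) = E0 * expR (lam n * s).
    by rewrite /E0 -expRD; congr expR; ring.
  have e1 : expR (lam n * s) * expR (- mu * s) = expR ((lam n - mu) * s).
    by rewrite -expRD; congr expR; ring.
  rewrite mulrDr; apply: lerD.
    by rewrite -!mulrA [expR (lam n * s) * _]mulrA e1 [C * _]mulrC.
  rewrite -!mulrA ler_wpM2l ?expR_ge0// mulrCA ler_wpM2l ?invr_ge0 ?powR_ge0//.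
  by rewrite ler_wpM2r// ler_expR ler_wnM2r// ltW.
have [_ ->] := @bochner_integral_cr _ _ A _ _ leb `]-oo, t]%classic
  (fun s => semigroup A (t - s) (G s - proj A n (G s))) _ (measurable_itv _) mf phiI bnd.
case: ltnP => jn.
  transitivity (\int[leb]_(s in `]-oo, t]) (0 : R)); last by rewrite Rintegral_cst// mul0r.
  by apply: eq_Rintegral => s; rewrite inE/= in_itv/= => st; rewrite crE// jn.
by apply: eq_Rintegral => s; rewrite inE/= in_itv/= => st; rewrite crE// ltnNge jn.
Qed.

Lemma line_convE (t : R) j : t <= 0 ->
  \int[leb]_s (skernel A true n j (t - s) * cr A (cutF F y xi s + (cuth h s : H)) j) =
  if (j < n)%N then - \int[leb]_(s in `[t, (0 : R)]) (expR (- lam j * (t - s)) * cr A (G s) j)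
  else \int[leb]_(s in `]-oo, t]) (expR (- lam j * (t - s)) * cr A (G s) j).
Proof.
move=> t0; have mE : measurable_fun setT (fun s : R => expR (- lam j * (t - s))).
  apply: measurableT_comp => //.
  by apply: measurable_funM => //; exact: measurable_funB.
case: ltnP => jn.
  have -> : - (\int[leb]_(s in `[t, (0 : R)]) (expR (- lam j * (t - s)) * cr A (G s) j)) =
      \int[leb]_(s in `[t, (0 : R)]) (- (expR (- lam j * (t - s)) * cr A (G s) j)).
    rewrite -mulN1r -lebesgue_RintegralZl//.
      by apply: eq_Rintegral => s _; rewrite mulN1r.
    apply: (@admissible_cr_integrable _ _ A _ _ j _ (expR (`|lam j| * (`|t| + `|t| + `|0 : R|)))) => //.
    - split; last exact: past_force_int.
      by move=> i; apply: past_force_meas => // s /=; rewrite !in_itv/= => /andP[].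
    - exact: measurable_funTS.
    - move=> s /=; rewrite in_itv/= => /andP[ts s0]; rewrite ger0_norm ?expR_ge0// ler_expR.
      rewrite mulNr -mulrN opprB ger0_norm ?(ltW (eigval_gt0 _ _))//.
      rewrite ler_wpM2l ?(ltW (eigval_gt0 _ _))// normr0 addr0.
      have := ler_norm (- t); rewrite normrN; have := normr_ge0 t; lra.
  apply: Rintegral_patch => s.
  have -> : (s \in `[t, (0 : R)]%classic) = (t <= s <= 0) by apply/idP/idP; rewrite inE/= in_itv.
  rewrite /skernel subr_gt0 jn /=; case: (ltP s t) => st /=; first by rewrite mul0r.
  case: (leP s 0) => s0; first by rewrite cut_forceE// mulNr.
  by rewrite /cutF /cuth leNgt s0/= crD !cr0 addr0 mulr0.
rewrite -Rintegral_itv_co_cc; last first.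
  apply: measurable_funM; first exact: measurable_funTS.
  by apply: past_force_meas => // s /=; rewrite !in_itv/= => /ltW /le_trans; apply.
apply: Rintegral_patch => s.
have -> : (s \in `]-oo, t[%classic) = (s < t) by apply/idP/idP; rewrite inE/= in_itv.
rewrite /skernel subr_gt0 ltnNge jn /=.
case: ifP => st; last by rewrite mul0r.
by rewrite cut_forceE// (le_trans (ltW st)).
Qed.

(** Coordinatewise comparison of the two forms. Membership of [x] in [PnH n] makes the semigroup at
    negative times a finite sum and the free term vanish from mode n on. *)
Lemma lyapunov_perron_line (x : X) : PnH n x ->
  (forall t, t <= 0 -> (xi t : H) = semigroup A t x
    - bochner_integral leb `[t, (0 : R)] (fun s => semigroup A (t - s) (proj A n (G s)))
    + bochner_integral leb `]-oo, t] (fun s => semigroup A (t - s) (G s - proj A n (G s)))) <->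
  line_form F n y h x xi.
Proof.
move=> [u _ ux].
have xn i : (n <= i)%N -> cr A x i = 0 by move=> ni; rewrite -ux cr_proj ltnNge ni.
have E t j : t <= 0 -> cr A (semigroup A t x
    - bochner_integral leb `[t, (0 : R)] (fun s => semigroup A (t - s) (proj A n (G s)))
    + bochner_integral leb `]-oo, t] (fun s => semigroup A (t - s) (G s - proj A n (G s)))) j =
    (if (j < n)%N then expR (- lam j * t) * cr A x j else 0) +
    \int[leb]_s (skernel A true n j (t - s) * cr A (cutF F y xi s + (cuth h s : H)) j).
  move=> t0; rewrite line_convE// crD crB (cr_semigroup_fin _ _ xn) bochner_low// bochner_high//.
  case: ltnP => jn; first by rewrite addr0.
  by rewrite xn// mulr0 subr0.
split=> [xiE t j t0|lf t t0]; first by rewrite xiE// E.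
by apply: (@cr_inj _ _ A) => j; rewrite E// lf.
Qed.

End trajectory.

End lyapunov_perron_equation.

(** * Existence and tracking *)

Section existence_and_tracking.
Context {R : realType} {H : hilbertType R} (A : spectral_operator H).
Context {alpha : {nonneg R}}.
Notation X := (fracdom A alpha).
Notation lam := (eigval A).
Notation wt j := (lam j `^ alpha%:num).
Notation leb := (@lebesgue_measure R).
Hypothesis a_lt1 : alpha%:num < 1.
Hypothesis a_lt12 : alpha%:num < 2^-1.
Variables (F : X -> H) (L : R).
Hypothesis L0 : 0 <= L.
Hypothesis FL : forall x y : X, `|F x - F y| <= L * `|x - y|.
Hypothesis F0 : F 0 = 0.
Variables (n : nat) (mu : R) (k : R -> R).
Hypothesis kP : @kernel _ _ A alpha (skernel A true n) k mu.
Hypothesis q1 : kmass k * L < 1.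
Hypothesis mu0 : 0 < mu.
Hypothesis mu_gt : forall j, (j < n)%N -> lam j <= mu.
Hypothesis mu_lt : mu < lam n.
Variables (h : R -> X).
Hypothesis hl : loc_integrable h.
Hypothesis hI : leb.-integrable `]-oo, (0 : R)] (EFin \o (fun s => expR (mu * s) * `|h s|)).

Lemma mode_bound (x : X) (c : nat -> R) (B : R) m : (forall j, `|c j| <= B) ->
  \sum_(j < m) (wt j * (c j * cr A x j)) ^+ 2 <= (B * `|x|) ^+ 2.
Proof.
move=> cB; rewrite exprMn; apply: (@le_trans _ _ (B ^+ 2 *
    \sum_(j < m) (wt j * cr A x j) ^+ 2)); last by rewrite ler_wpM2l ?sqr_ge0// besselX.
rewrite mulr_sumr; apply: ler_sum => j _.
rewrite mulrCA exprMn ler_wpM2r ?sqr_ge0// -(real_normK (num_real (c j))).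
by rewrite ler_pXn2r ?nnegrE// (le_trans _ (cB j)).
Qed.

Lemma measurable_le0 : measurable_fun setT (fun s : R => s <= 0).
Proof. exact: measurable_fun_ler. Qed.

(** The base point may depend measurably on the parameter; the graph over a noise-shifted base point
    relies on this. *)
Lemma line_form_exists d (T : measurableType d) (y : T -> R -> X) (x : T -> X) :
  jmeasX y -> (forall w, continuous (y w)) ->
  (forall w, exists C, forall s, s <= 0 -> expR (mu * s) * `|y w s| <= C) ->
  (forall j, measurable_fun setT (fun w => cr A (x w) j)) ->
  exists xi : T -> R -> X, [/\ jmeasX xi, forall w, past_bounded mu (xi w) &
    forall w, line_form F n (y w) h (x w) (xi w)].
Proof.
move=> my cy yC mx.
pose c t j : R := if (t <= 0) && (j < n)%N then expR (- lam j * t) else 0.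
have cB t j : `|c t j| <= expR (- (mu * t)).
  rewrite /c; case: ifP => [/andP[t0 jn]|_]; last by rewrite normr0 expR_ge0.
  by rewrite ger0_norm ?expR_ge0// ler_expR mulNr lerN2 ler_wnM2r// mu_gt.
have ex w : exists b : R -> X, forall t j, cr A (b t) j = c t j * cr A (x w) j.
  suff /choice[b bE] : forall t, exists b : X, forall j, cr A b j = c t j * cr A (x w) j by exists b.
  move=> t; exact: (@crX_exists _ _ A alpha (fun j => c t j * cr A (x w) j) _
    (fun m => mode_bound (x w) m (cB t))).
have [b bE] := choice ex.
pose f w s : H := if s <= 0 then F (y w s) else 0.
have mcut := measurable_snd_bool (T := T) measurable_le0.
have mb : jmeasX b.
  move=> j; under eq_fun do rewrite bE.
  apply: measurable_funM; last by apply: (measurableT_comp (mx j)); exact: measurable_fst.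
  rewrite /c; case: (j < n)%N; last first.
    apply: (eq_measurable_fun (fun p : T * R => 0 : R)); last exact: measurable_cst.
    by move=> p _; rewrite andbF.
  apply: (eq_measurable_fun (fun p : T * R => if p.2 <= 0 then expR (- lam j * p.2) else 0)).
    by move=> p _; rewrite andbT.
  apply: measurable_fun_ifT => //.
  by apply: (measurableT_comp (f := fun s : R => expR (- lam j * s)));
    [exact: measurable_expRMr|exact: measurable_snd].
have mh : jmeasX (fun _ : T => cuth h).
  by move=> j; apply: (measurableT_comp (measurable_cuth hl j)); exact: measurable_snd.
have mf : jmeasH A f.
  move=> j; apply: (eq_measurable_fun (fun p : T * R => if p.2 <= 0 then cr A (F (y p.1 p.2)) j else 0)).
    by move=> p _; rewrite /f; case: ifP => // _; rewrite cr0.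
  by apply: measurable_fun_ifT => //; exact: (jmeasH_comp_F L0 FL my).
have bB w : exists B, forall t, expR (mu * t) * `|b w t| <= B.
  exists (`|x w|) => t; rewrite -ler_pdivlMl ?expR_gt0// -expRN.
  apply: normX_le => [|m]; first by rewrite mulr_ge0 ?expR_ge0.
  under eq_bigr do rewrite bE.
  exact: mode_bound.
have fB w : exists B, forall t, expR (mu * t) * `|f w t| <= B.
  have [C yCw] := yC w.
  have C0 : 0 <= C by apply: le_trans (yCw 0 (lexx _)); rewrite mulr_ge0 ?expR_ge0.
  exists (L * C) => t; rewrite /f; case: ifPn => [t0|_]; last by rewrite normr0 mulr0 mulr_ge0.
  apply: (@le_trans _ _ (expR (mu * t) * (L * `|y w t|))).
    by rewrite ler_wpM2l ?expR_ge0// (F_le FL F0).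
  by rewrite mulrCA ler_wpM2l// yCw.
have [xi [mxi xiB xiE]] := line_equation L0 FL kP q1 measurable_le0 mb my mh mf bB fB
  (fun _ => integrable_cuth hI).
exists xi; split => // [w|w t j t0].
  by have [C xC] := xiB w; exists C => t _; exact: xC.
have [_ ->] := xiE w t j; rewrite bE /c t0 /=; congr (_ + _).
  by case: ifP => // _; rewrite mul0r.
apply: eq_Rintegral => s _; congr (_ * cr A (_ + _) _).
by rewrite /cutdiff /f /cutF; case: ifP => _; rewrite ?subrK ?addr0.
Qed.

(* The difference of the tracking orbit and of [v], extended by the orbit
   itself to negative times, solves a fixpoint equation on the whole line in the
   space of functions that are [O(e^(- mu t))] at both ends. *)
Lemma tracking (y : R -> X) (Cy : R) (v : R -> X) : continuous y ->
  (forall s, s <= 0 -> expR (mu * s) * `|y s| <= Cy) ->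
  forward_solution F y h 0 v ->
  exists xi v' : R -> X, [/\ past_bounded mu xi, backward_trajectory F y h xi, forward_solution F y h 0 v',
    v' 0 = xi 0 & exists C, forall t : R, 0 <= t -> `|v' t - v t| <= C * expR (- mu * t)].
Proof.
move=> cy yC vS.
have cy' (D : set R) : cont_on D y by exact: cont_on_y.
have Cy0 : 0 <= Cy by apply: le_trans (yC 0 (lexx _)); rewrite mulr_ge0 ?expR_ge0.
(* The unknown is the orbit before 0 and the orbit minus [v] after 0, so it jumps by [- v 0]. Its
   free term is the kernel's response to that jump, which is why [c t j] is minus
   [skernel A true n j t]. *)
pose c (t : R) j : R := if t <= 0 then (if (j < n)%N then expR (- lam j * t) else 0)
  else (if (j < n)%N then 0 else - expR (- lam j * t)).
have cB t j : `|c t j| <= expR (- (mu * t)).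
  rewrite /c; case: (leP t 0) => t0; case: (ltnP j n) => jn; rewrite ?(normr0, normrN) ?expR_ge0//.
    by rewrite (ger0_norm (expR_ge0 _)) ler_expR mulNr lerN2 ler_wnM2r// mu_gt.
  rewrite (ger0_norm (expR_ge0 _)) ler_expR mulNr lerN2 (ler_wpM2r (ltW t0))//.
  by rewrite (le_trans (ltW mu_lt))// eigval_nondecreasing.
have mexp j : measurable_fun setT (fun t : R => expR (- lam j * t)) by exact: measurable_expRMr.
have mc j : measurable_fun setT (c ^~ j).
  rewrite /c; apply: measurable_fun_ifT; first exact: measurable_le0.
    by case: (j < n)%N; [exact: mexp|exact: measurable_cst].
  by case: (j < n)%N; [exact: measurable_cst|rewrite [X in measurable_fun _ X](_ : _ = (-%R \o (fun t : R => expR (- lam j * t)))) //; apply: measurableT_comp => //; exact: mexp].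
have /choice[b bE] : forall t, exists b : X, forall j, cr A b j = c t j * cr A (v 0) j.
  move=> t; exact: (@crX_exists _ _ A alpha (fun j => c t j * cr A (v 0) j) _
    (fun m => mode_bound (v 0) m (cB t))).
(* After time 0 the forcing of the difference is [F (z + v + y) - F (v + y)], in which [h] cancels;
   before it [f] restores [F (y s)], and the cut [h] supplies the external forcing. *)
pose a (s : R) : X := if s <= 0 then y s else v s + y s.
pose f (s : R) : H := if s <= 0 then F (y s) else 0.
have my j : measurable_fun setT (fun s : R => cr A (y s) j) by exact: cont_on_cr_measurable.
have cv : cont_on `[0 : R, +oo[ v by exact: forward_solution_cont_on vS.
have ma j : measurable_fun setT (fun s : R => cr A (a s) j).
  have mv : measurable_fun `[0 : R, +oo[ (fun s : R => cr A (v s) j) by exact: cont_on_cr_measurable.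
  have mv' := (measurable_restrictT _ (measurable_itv `[0 : R, +oo[)).1 mv.
  apply: (eq_measurable_fun (fun s : R => if s <= 0 then cr A (y s) j else
    ((fun s : R => cr A (v s) j) \_ `[0 : R, +oo[) s + cr A (y s) j)).
    move=> s _; rewrite /a; case: leP => // s0; rewrite crXD patchE ifT// inE/= in_itv/= andbT.
    exact: ltW.
  by apply: measurable_fun_ifT => //; [exact: measurable_le0|exact: measurable_funD].
have mf j : measurable_fun setT (fun s : R => cr A (f s) j).
  apply: (eq_measurable_fun (fun s : R => if s <= 0 then cr A (F (y s)) j else 0)).
    by move=> s _; rewrite /f; case: ifP => // _; rewrite cr0.
  apply: measurable_fun_ifT => //; first exact: measurable_le0.
  exact: (measurable_comp_F L0 FL).
have bB : exists B, forall t, expR (mu * t) * `|b t| <= B.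
  exists (`|v 0|) => t; rewrite -ler_pdivlMl ?expR_gt0// -expRN.
  apply: normX_le => [|m]; first by rewrite mulr_ge0 ?expR_ge0.
  under eq_bigr do rewrite bE.
  exact: mode_bound.
have fB : exists B, forall t, expR (mu * t) * `|f t| <= B.
  exists (L * Cy) => t; rewrite /f; case: ifPn => [t0|_]; last by rewrite normr0 mulr0 mulr_ge0.
  apply: (@le_trans _ _ (expR (mu * t) * (L * `|y t|))).
    by rewrite ler_wpM2l ?expR_ge0// (F_le FL F0).
  by rewrite mulrCA ler_wpM2l// yC.
have mb j : measurable_fun setT (fun s : R => cr A (b s) j).
  by under eq_fun do rewrite bE; apply: measurable_funM.
have mtrue : measurable_fun setT (fun _ : R => true) by exact: measurable_cst.
have [z [mz [C zC] zE]] := line_equation1 L0 FL kP q1 mtrue mb ma (measurable_cuth hl) mf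
  bB fB (integrable_cuth hI).
have C0 : 0 <= C by apply: le_trans (zC 0); rewrite mulr_ge0 ?expR_ge0.
pose G (s : R) : H := F (z s + a s) - F (a s) + f s + (cuth h s : H).
have Gneg (s : R) : s <= 0 -> G s = force F y h z s.
  by move=> s0; rewrite /G /a /f /cuth s0 subrK.
have Gpos (s : R) : 0 < s -> G s = F (z s + (v s + y s)) - F (v s + y s).
  move=> s0; have s0' : (s <= 0) = false by rewrite leNgt s0.
  by rewrite /G /a /f /cuth s0' addr0; exact: addr0.
have mG j : measurable_fun setT (fun s : R => cr A (G s) j).
  have mza : forall i, measurable_fun setT (fun s : R => cr A (z s + a s : X) i).
    by move=> i; under eq_fun do rewrite crXD; apply: measurable_funD.
  have m1 := measurable_comp_F L0 FL j measurableT mza.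
  have m2 := measurable_comp_F L0 FL j measurableT ma.
  apply: (eq_measurable_fun (fun s : R => cr A (F (z s + a s)) j - cr A (F (a s)) j + cr A (f s) j
     + cr A (cuth h s) j)).
    by move=> s _; rewrite /G !crD crN.
  apply: measurable_funD; last exact: (measurable_cuth hl j).
  by apply: measurable_funD => //; exact: measurable_funB.
have zE' (t : R) j : cr A (z t) j - cr A (b t) j =
    \int[leb]_s (skernel A true n j (t - s) * cr A (G s) j).
  by have [_ ->] := zE t j; rewrite addrAC subrr add0r.
have zdiff (r t : R) j : r <= t ->
    expR (lam j * t) * (cr A (z t) j - cr A (b t) j) -
    expR (lam j * r) * (cr A (z r) j - cr A (b r) j) =
    \int[leb]_(s in `[r, t]) (expR (lam j * s) * cr A (G s) j).
  move=> rt; have [it _] := zE t j; have [ir _] := zE r j; rewrite !zE'.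
  exact: (@skernel_diff _ _ A true n j r t (fun s : R => cr A (G s) j)).
have cneg (t : R) j : t <= 0 -> expR (lam j * t) * cr A (b t) j = if (j < n)%N then cr A (v 0) j else 0.
  move=> t0; rewrite bE /c t0; case: ifP => _; last by rewrite mul0r mulr0.
  by rewrite mulrA -expRD mulNr subrr expR0 mul1r.
have cpos (t : R) j : 0 < t -> expR (lam j * t) * cr A (b t) j = if (j < n)%N then 0 else - cr A (v 0) j.
  move=> t0; rewrite bE /c leNgt t0 /=; case: ifP => _; first by rewrite mul0r mulr0.
  by rewrite mulrA mulrN -expRD (mulNr (lam j)) subrr expR0 mulN1r.
pose v' (t : R) : X := if t <= 0 then z t else z t + v t.
have v'0 : v' 0 = z 0 by rewrite /v' lexx.
exists z, v'; split=> //.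
- by exists C => t _; exact: zC.
- move=> r r0.
  have vz s : r <= s <= 0 -> voc A z (force F y h z) r s.
    move=> /andP[rs s0] j; have := zdiff r s j rs; rewrite !mulrBr !cneg//.
    move=> e; rewrite (_ : \int[leb]_(u in `[r, s]) (expR (lam j * u) * cr A (force F y h z u) j) =
        \int[leb]_(u in `[r, s]) (expR (lam j * u) * cr A (G u) j)).
      by rewrite -e; ring.
    apply: eq_Rintegral => u; rewrite inE/= in_itv/= => /andP[_ us].
    by rewrite Gneg// (le_trans us).
  split=> //.
  apply: (@voc_force_cont_on _ _ A alpha a_lt1 a_lt12 F L L0 FL F0 y h z r 0
    (expR (`|mu| * (`|r| + `|0 : R|)) * C)) => //.
  + by move=> j; apply: measurable_funTS; exact: mz.
  + move=> s sD; have eb := expR_itv_bound (- mu) sD.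
    rewrite normrN ger0_norm ?expR_ge0// in eb.
    apply: (@le_trans _ _ (expR (- mu * s) * C)); last by apply: ler_wpM2r => //; exact: eb.
    by rewrite mulNr expRN ler_pdivlMl ?expR_gt0.
- move=> T T0.
  have [cvT vvT] := vS T T0.
  have [Cv vC] := cont_on_bounded cvT.
  have mv' j : measurable_fun `[0 : R, T] (fun s : R => cr A (v' s) j).
    apply: (eq_measurable_fun (fun s : R => if s <= 0 then cr A (z s) j else cr A (z s) j + cr A (v s) j)).
      by move=> s _; rewrite /v'; case: ifP => // _; rewrite crXD.
    apply: measurable_fun_if => //.
    + exact: measurable_funTS measurable_le0.
    + by apply: measurable_funTS; exact: mz.
    + apply: (@measurable_funS _ _ _ _ `[0 : R, T]) => //.
      apply: measurable_funD; first by apply: measurable_funTS; exact: mz.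
      exact: cont_on_cr_measurable.
  have Cv0 : 0 <= Cv by apply: le_trans (vC 0 _); rewrite // in_itv/= lexx.
  have zb s : 0 <= s -> `|z s| <= C.
    move=> s0; have := zC s; rewrite -ler_pdivlMl ?expR_gt0// -expRN => /le_trans; apply.
    by rewrite ler_piMl// expR_le1 oppr_le0 mulr_ge0// ltW.
  have v'C s : s \in `[0 : R, T] -> `|v' s| <= C + Cv.
    move=> sD; have /andP[s0 sT] : 0 <= s <= T by move: sD; rewrite in_itv.
    rewrite /v'; case: ifP => _; first by rewrite (le_trans (zb s s0))// lerDl.
    by apply: (le_trans (ler_normD _ _)); apply: lerD; [exact: zb|exact: vC].
  have vv' t : 0 <= t <= T -> voc A v' (force F y h v') 0 t.
    move=> /andP[t0 tT] j; have [t00|tn0] := eqVneq t 0.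
      by rewrite t00 subrr set_itv1 Rintegral_set1.
    have {}t0 : 0 < t by rewrite lt0r tn0.
    have tt' : (t <= 0) = false by rewrite leNgt t0.
    have sub : `[0 : R, t] `<=` `[0 : R, T] by apply: subset_itvl; rewrite bnd_simp.
    have cvt : cont_on `[0 : R, t] v by exact: cont_on_subset cvT.
    have afv := admissible_force_cont L0 FL F0 (cy' `[0 : R, t]%classic) hl cvt.
    have ifv := voc_integrable j afv.
    have GB s : s \in `[0 : R, t] -> `|G s| <= `|G 0| + L * C.
      rewrite in_itv/= => /andP[]; rewrite le_eqVlt => /predU1P[<- _|s0 _].
        by rewrite lerDl mulr_ge0.
      rewrite Gpos//; apply: (@le_trans _ _ (L * C)); last by rewrite lerDr.
      apply: (le_trans (FL _ _)); rewrite ler_wpM2l// [_ - _](_ : _ = z s); first exact/zb/ltW.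
      by rewrite -addrA subrr addr0.
    have aG : admissible A G `[0 : R, t].
      split; first by move=> i; apply: measurable_funTS; exact: mG.
      apply: (@le_integrable _ _ _ leb _ (measurable_itv _) _ (EFin \o (fun=> `|G 0| + L * C))).
      - apply/measurable_EFinP; apply: (@measurable_normH _ _ A) => // i.
        by apply: measurable_funTS; exact: mG.
      - move=> s sD; rewrite /comp lee_fin normr_id (le_trans _ (ler_norm _))//.
        exact: GB.
      - exact: integrable_cst_itv.
    have iG := voc_integrable j aG.
    have e1 := zdiff 0 t j (ltW t0).
    have /(_ t) := vvT; rewrite (ltW t0) tT => /(_ isT j) e2.
    have -> : \int[leb]_(s in `[0 : R, t]) (expR (lam j * s) * cr A (force F y h v' s) j) =
        \int[leb]_(s in `[0 : R, t]) (expR (lam j * s) * cr A (G s) j) +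
        \int[leb]_(s in `[0 : R, t]) (expR (lam j * s) * cr A (force F y h v s) j).
      rewrite -(@RintegralD _ _ _ leb _ _ _ (measurable_itv _) iG ifv).
      have msum : measurable_fun `[0 : R, t] (fun s => expR (lam j * s) * cr A (G s) j +
          expR (lam j * s) * cr A (force F y h v s) j).
        apply: measurable_funD; apply: measurable_funM.
        - exact: measurable_expRMr.
        - exact: aG.1.
        - exact: measurable_expRMr.
        - exact: afv.1.
      (* At [s = 0] the definitions take the branch of negative times and the integrands need not
         agree, so this null point is removed. *)
      have oc : `]0 : R, t] `<=` `[0 : R, t] by exact: subset_itv_oc_cc.
      have EQ s : s \in `]0 : R, t]%classic -> expR (lam j * s) * cr A (G s) j +
          expR (lam j * s) * cr A (force F y h v s) j = expR (lam j * s) * cr A (force F y h v' s) j.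
        rewrite inE/= in_itv/= => /andP[s0 _]; rewrite -mulrDr -crD; congr (_ * cr A _ _).
        rewrite Gpos// /force /v' leNgt s0 /= addrA subrK; congr (F _ + _).
        by rewrite addrA.
      rewrite -[LHS]Rintegral_itv_oc_cc; last first.
        apply: (eq_measurable_fun _ EQ); exact: measurable_funS msum.
      rewrite -[RHS]Rintegral_itv_oc_cc; last exact: measurable_funS msum.
      by apply: eq_Rintegral => s /EQ ->.
    rewrite -e1 -e2 !mulrBr cpos// cneg// mulr0 expR0 !mul1r v'0 /v' tt' crXD mulrDr.
    by case: ifP => _; ring.
  split=> //; exact: (@voc_force_cont_on _ _ A alpha a_lt1 a_lt12 F L L0 FL F0 y h v' 0 T (C + Cv)).
(* At [t = 0] the difference of the orbits is [z 0 - v 0] and not [z 0], hence the second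
   summand. *)
exists (C + `|z 0 - v 0|) => t; rewrite le_eqVlt => /predU1P[<-|t0].
  by rewrite v'0 mulr0 expR0 mulr1 lerDr.
have tt' : (t <= 0) = false by rewrite leNgt t0.
rewrite /v' tt' addrK; apply: (@le_trans _ _ (C * expR (- mu * t))).
  by rewrite mulrC mulNr expRN ler_pdivlMl ?expR_gt0.
by rewrite ler_wpM2r ?expR_ge0// lerDl.
Qed.

End existence_and_tracking.

(** * Forcing, noise and the cocycle *)

Section forcing.
Context {R : realType} {H : hilbertType R} (A : spectral_operator H).
Context {alpha : {nonneg R}}.
Notation X := (fracdom A alpha).
Notation lam := (eigval A).
Notation leb := (@lebesgue_measure R).

Lemma integrable_shift_set (d : R) (D D' : set R) (f : R -> R) :
  measurable (D : set (measurableTypeR R)) -> measurable (D' : set (measurableTypeR R)) ->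
  (forall s, (s \in D') = (s + d \in D)) ->
  leb.-integrable D (EFin \o f) -> leb.-integrable D' (EFin \o (fun s => f (s + d))).
Proof.
move=> mD mD' DD' /(@integrable_mkcond _ _ _ leb _ _ mD).1 fD.
apply/(@integrable_mkcond _ _ _ leb _ _ mD').
have e (E : set R) (u : R -> R) : (EFin \o u) \_ E = EFin \o (u \_ E).
  by apply/funext => s; rewrite [RHS]/comp !patchE; case: ifP.
rewrite e in fD; have := integrable_shift d fD.
rewrite e; congr (_.-integrable _ _); apply/funext => s.
by rewrite /comp !patchE DD'.
Qed.

Lemma integrable_patch (D : set R) (f : R -> R) : measurable (D : set (measurableTypeR R)) ->
  leb.-integrable D (EFin \o f) -> leb.-integrable setT (EFin \o (f \_ D)).
Proof.
move=> mD /(@integrable_mkcond _ _ _ leb _ _ mD).1; congr (_.-integrable _ _).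
by apply/funext => s; rewrite [RHS]/comp !patchE; case: ifP.
Qed.

Lemma Rintegral_shift_set (d : R) (D D' : set R) (f : R -> R) :
  measurable (D : set (measurableTypeR R)) ->
  (forall s, (s \in D') = (s + d \in D)) -> measurable_fun D f ->
  \int[leb]_(s in D') f (s + d) = \int[leb]_(s in D) f s.
Proof.
move=> mD DD' mf; rewrite [LHS]Rintegral_mkcond [RHS]Rintegral_mkcond.
rewrite -(@Rintegral_shift _ d (f \_ D)); last by apply/(measurable_restrictT _ _).1.
by apply: eq_Rintegral => s _; rewrite !patchE DD'.
Qed.

(** On a bounded interval [x <= 1 + x^2] suffices. *)
Lemma L2loc_loc_integrable (g : R -> X) : L2loc g -> loc_integrable g.
Proof.
move=> [mg ig].
have mg' j : measurable_fun setT (fun s => cr A (g s) j) by exact: measurable_crX.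
split => // r t.
have mn : measurable_fun `[r, t] (fun s => `|g s|).
  by apply: (@measurable_normX _ _ A) => // j; apply: measurable_funTS; exact: mg'.
have i2 : leb.-integrable `[r, t] (EFin \o (fun s => `|g s| ^+ 2)).
  apply/integrableP; split.
    by apply/measurable_EFinP; exact: measurable_funX.
  apply: le_lt_trans (ig r t); rewrite le_eqVlt; apply/orP; left; apply/eqP.
  by apply: eq_integral => s _; rewrite /comp /= ger0_norm// exprn_ge0.
have i12 := @integrableD _ _ _ leb _ (measurable_itv `[r, t]) _ _ (integrable_cst_itv 1 r t) i2.
apply: (@le_integrable _ _ _ leb _ (measurable_itv _) _ _ _ _ i12).
  exact/measurable_EFinP.
move=> s _; rewrite /= lee_fin normr_id (le_trans _ (ler_norm _))//.
have := sqr_ge0 (`|g s| - 2^-1); nra.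
Qed.

Lemma loc_integrable_shift (g : R -> X) tau : loc_integrable g -> loc_integrable (gshift g tau).
Proof.
move=> [mg ig]; split=> [j|r t].
  by apply: (measurableT_comp (mg j)); exact: measurable_shift.
apply: (@integrable_shift_set tau `[r + tau, t + tau] `[r, t] (fun s => `|g s|)) => //.
by move=> s; apply/idP/idP; rewrite !inE/= !in_itv/= !lerD2r.
Qed.

(** At negative times the weight with [mu] is below the one with [lam 0]. A positive [tau] adds a
    bounded interval, covered by local integrability, and the shift itself costs the constant factor
    [expR (- mu * tau)]. *)
Lemma past_integrable_shift (g : R -> X) tau (mu : R) : loc_integrable g -> lam 0%N <= mu ->
  (\int[leb]_(s in `]-oo, 0%R])
     (expR (lam 0%N * s) * `|fpow A alpha%:num (g s)|)%:E < +oo)%E ->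
  leb.-integrable `]-oo, (0 : R)] (EFin \o (fun s => expR (mu * s) * `|gshift g tau s|)).
Proof.
move=> [mg ig] lm ifin.
have mn (D : set R) : measurable (D : set (measurableTypeR R)) -> measurable_fun D (fun s => `|g s|).
  by move=> mD; apply: (@measurable_normX _ _ A) => // j; apply: measurable_funTS; exact: mg.
have me (c : R) (D : set R) : measurable (D : set (measurableTypeR R)) ->
    measurable_fun D (fun s => expR (c * s) * `|g s|).
  by move=> mD; apply: measurable_funM; [exact: measurable_expRMr|exact: mn].
have i0 : leb.-integrable `]-oo, (0 : R)] (EFin \o (fun s => expR (lam 0%N * s) * `|g s|)).
  apply/integrableP; split; first by apply/measurable_EFinP; exact: me.
  apply: le_lt_trans ifin; rewrite le_eqVlt; apply/orP; left; apply/eqP.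
  by apply: eq_integral => s _; rewrite /comp /= ger0_norm// mulr_ge0// expR_ge0.
have i1 : leb.-integrable `]-oo, (0 : R)] (EFin \o (fun s => expR (mu * s) * `|g s|)).
  apply: (@le_integrable _ _ _ leb _ (measurable_itv _) _ _ _ _ i0).
    by apply/measurable_EFinP; exact: me.
  move=> s; rewrite /= in_itv/= => s0; rewrite lee_fin.
  rewrite !(ger0_norm (mulr_ge0 (expR_ge0 _) (normr_ge0 _))) ler_wpM2r// ler_expR.
  exact: ler_wnM2r.
have i2 : leb.-integrable `[(0 : R), `|tau|] (EFin \o (fun s => expR (mu * s) * `|g s|)).
  have iz := @integrableZl _ _ _ leb _ (measurable_itv _) (expR (`|mu| * `|tau|)) _ (ig 0 `|tau|).
  apply: (@le_integrable _ _ _ leb _ (measurable_itv _) _ _ _ _ iz).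
    by apply/measurable_EFinP; exact: me.
  move=> s; rewrite /= in_itv/= => /andP[s0 st]; rewrite lee_fin.
  rewrite !(ger0_norm (mulr_ge0 (expR_ge0 _) (normr_ge0 _))) ler_wpM2r// ler_expR.
  by rewrite (le_trans (ler_norm _))// normrM ler_wpM2l// ger0_norm.
have i3 : leb.-integrable `]-oo, tau] (EFin \o (fun s => expR (mu * s) * `|g s|)).
  have p1 := integrable_patch (measurable_itv _) i1.
  have p2 := integrable_patch (measurable_itv _) i2.
  have p12 := @integrableD _ _ _ leb _ measurableT _ _ p1 p2.
  have := @integrableS _ _ _ leb setT _ _ measurableT (measurable_itv `]-oo, tau]) (@subsetT _ _) p12.
  apply: (@le_integrable _ _ _ leb _ (measurable_itv _)).
    by apply/measurable_EFinP; exact: me.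
  move=> s; rewrite /= in_itv/= => st; rewrite lee_fin (le_trans _ (ler_norm _))//.
  rewrite (ger0_norm (mulr_ge0 (expR_ge0 _) (normr_ge0 _))) !patchE.
  have f0 : 0 <= expR (mu * s) * `|g s| by rewrite mulr_ge0 ?expR_ge0.
  case: (leP s 0) => s0; first by rewrite ifT ?inE/= ?in_itv//= lerDl; case: ifP.
  rewrite [X in _ <= _ + X]ifT ?lerDr; first by case: ifP.
  by rewrite inE/= in_itv/= (ltW s0) (le_trans st)// ler_norm.
have i4 := @integrableZl _ _ _ leb _ (measurable_itv _) (expR (- mu * tau)) _ i3.
have := @integrable_shift_set tau _ `]-oo, (0 : R)]
  (fun s => expR (- mu * tau) * (expR (mu * s) * `|g s|)) (measurable_itv _) (measurable_itv _) _ i4.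
rewrite (_ : (fun s => expR (- mu * tau) * (expR (mu * (s + tau)) * `|g (s + tau)|)) =
  (fun s => expR (mu * s) * `|gshift g tau s|)).
  by apply => s; apply/idP/idP; rewrite !inE/= !in_itv/= -lerBrDr subrr.
apply/funext => s; rewrite mulrA -expRD /gshift; congr (expR _ * _); ring.
Qed.

End forcing.

Section shift_measurability.
Context {R : realType} {H : hilbertType R}.

(** Convergence of paths is uniform convergence on compacts, and the shifted path on K is determined
    by the path on [K + t] and at the point [t]. *)
Lemma theta_continuous (t : R) : continuous (theta t : path_space H -> path_space H).
Proof.
apply: continuous_comp_initial => w.
apply/(@compact_open_fam_compactP R H (theta t w)
  ((fun w' : path_space H => path_fun (theta t w')) @ nbhs w)).
  exact: path_continuous.
apply/fam_cvgP => K cK P /uniform_nbhs [E [entE EP]].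
have [e e0 eE] : exists2 e : R, 0 < e & forall a b : H, `|a - b| < e -> E (a, b).
  move: entE; rewrite -entourage_ballE => -[e e0 eE]; exists e => // a b ab.
  by apply: eE; rewrite /= -ball_normE.
have e20 : 0 < e / 2 by rewrite divr_gt0.
have cw : {family compact, (fun w' : path_space H => path_fun w') @ nbhs w --> path_fun w}.
  apply/compact_open_fam_compactP; first exact: path_continuous.
  exact: (@initial_continuous _ _ (@path_fun R H : path_space H -> {compact-open, R -> H}) w).
pose K' : set R := ((fun s => s + t) @` K) `|` [set t].
have cK' : compact K'.
  apply: compactU; last exact: compact_set1.
  apply: continuous_compact => //; apply: continuous_subspaceT => s.
  by apply: cvgD; [exact: cvg_id|exact: cvg_cst].
have [e' e'E] : exists e' : {posnum R}, e'%:num = e / 2 by exists (PosNum e20).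
have := cw _ (fam_nbhs (path_fun w) (entourage_ball H e') cK').
rewrite nbhs_simpl /=; apply: filterS => w' h; apply: EP => s Ks /=; apply: eE.
have h1 : `|w (s + t) - w' (s + t)| < e / 2.
  have := h (s + t); rewrite /= -ball_normE /= e'E; apply.
  by left; exists s.
have h2 : `|w t - w' t| < e / 2.
  by have := h t; rewrite /= -ball_normE /= e'E; apply; right.
rewrite opprD addrACA -opprD (le_lt_trans (ler_normB _ _))// [e]splitr.
exact: ltrD.
Qed.

Lemma measurable_theta (t : R) : measurable_fun setT (theta t : path_space H -> path_space H).
Proof.
apply: (@measurability _ _ _ _ _ _ (@open (path_space H))) => // _ [B oB <-].
rewrite setTI; apply: sub_sigma_algebra.
by move/continuousP : (@theta_continuous t); apply.
Qed.

End shift_measurability.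

Section noise_path.
Context {R : realType} {H : hilbertType R} (A : spectral_operator H).
Context {alpha : {nonneg R}}.
Notation X := (fracdom A alpha).
Variable z : path_space H -> X.
Hypothesis zT : tempered_continuous z.

(** Temperedness bounds the weighted path near [-oo], and continuity bounds it on the remaining
    compact interval. *)
Lemma tempered_past_bound (mu : R) w : 0 < mu ->
  exists C, forall s : R, s <= 0 -> expR (mu * s) * `|z (theta s w)| <= C.
Proof.
move=> mu0; have [cz /(_ _ mu0) z0] := zT w.
have [M [_ MP]] : \forall t \near -oo, expR (mu * t) * `|z (theta t w)| <= 1.
  move/cvgrPdist_le : z0 => /(_ 1 ltr01); apply: filterS => t.
  by rewrite sub0r normrN => /(le_trans (ler_norm _)).
have [C zC] := @cont_on_bounded _ _ _ (Num.min (M - 1) 0) 0 ((within_cont_onP _ _).1 (continuous_subspaceT cz)).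
exists (1 + `|C|) => s s0; have [sM|Ms] := ltP s M.
  by rewrite (le_trans (MP s sM))// lerDl.
apply: (@le_trans _ _ C); last by rewrite (le_trans (ler_norm _))// lerDr.
apply: le_trans (zC s _); last first.
  by rewrite in_itv/= s0 andbT ge_min (le_trans _ Ms)// gerBl.
by rewrite ler_piMl// expR_le1 mulr_ge0_le0// ltW.
Qed.

Lemma jmeasX_noise : borel_measurable setT z ->
  jmeasX (fun w s => z (theta s w)).
Proof.
move=> mz j; apply: (@measurable_fun_caratheodory _ _ _ (fun w s => cr A (z (theta s w)) j)) => [s|w].
  exact: (measurableT_comp (measurable_crX j mz) (@measurable_theta _ _ s)).
move=> s; apply: (continuous_comp (f := fun s => z (theta s w)) (g := fun x : X => cr A x j)).
  exact: (zT w).1.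
exact: crX_continuous.
Qed.

Lemma path_fun_inj : injective (@path_fun R H).
Proof.
move=> [u cu u0] [v cv v0] /= e; move: e cu u0 cv v0 => -> cu u0 cv v0.
by congr PathSpace; exact: Prop_irrelevance.
Qed.

Lemma theta_theta (s t : R) (w : path_space H) : theta s (theta t w) = theta (s + t) w.
Proof.
apply: path_fun_inj; apply/funext => r /=; rewrite !addrA opprB addrA addrNK.
by [].
Qed.

Lemma theta0 (w : path_space H) : theta 0 w = w.
Proof.
by apply: path_fun_inj; apply/funext => r /=; rewrite addr0 path0 subr0.
Qed.

End noise_path.

(** * Gluing and shifting solutions; the cocycle in terms of solutions *)

Section cocycle.
Context {R : realType} {H : hilbertType R} (A : spectral_operator H).
Context {alpha : {nonneg R}}.
Notation X := (fracdom A alpha).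
Notation lam := (eigval A).
Notation leb := (@lebesgue_measure R).
Hypothesis a_lt1 : alpha%:num < 1.
Hypothesis a_lt12 : alpha%:num < 2^-1.
Variables (F : X -> H) (L : R).
Hypothesis L0 : 0 <= L.
Hypothesis FL : forall x y : X, `|F x - F y| <= L * `|x - y|.
Hypothesis F0 : F 0 = 0.

Lemma continuous_cont_on (y : R -> X) (D : set R) : continuous y -> cont_on D y.
Proof. by move=> cy; apply/within_cont_onP; exact: continuous_subspaceT. Qed.

Lemma cont_on_cat (v : R -> X) (r s t : R) : r <= s -> s <= t ->
  cont_on `[r, s] v -> cont_on `[s, t] v -> cont_on `[r, t] v.
Proof.
move=> rs st c1 c2 x /=; rewrite in_itv/= => /andP[rx xt] e e0.
have [xs|sx|xs] := ltgtP x s.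
- have [|dl dl0 h] := c1 x _ e e0; first by rewrite /= in_itv/= rx ltW.
  exists (Num.min dl (s - x)); first by rewrite lt_min dl0 subr_gt0.
  move=> u; rewrite /= in_itv/= => /andP[ru ut]; rewrite lt_min => /andP[xu1 xu2].
  apply: h => //; rewrite /= in_itv/= ru/=.
  by move: xu2; rewrite ltr_distlC => /andP[_]; lra.
- have [|dl dl0 h] := c2 x _ e e0; first by rewrite /= in_itv/= xt ltW.
  exists (Num.min dl (x - s)); first by rewrite lt_min dl0 subr_gt0.
  move=> u; rewrite /= in_itv/= => /andP[ru ut]; rewrite lt_min => /andP[xu1 xu2].
  apply: h => //; rewrite /= in_itv/= ut andbT.
  by move: xu2; rewrite ltr_distlC => /andP[+ _]; lra.
- have [|d1 d10 h1] := c1 x _ e e0; first by rewrite /= in_itv/= rx xs lexx.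
  have [|d2 d20 h2] := c2 x _ e e0; first by rewrite /= in_itv/= xt xs lexx.
  exists (Num.min d1 d2); first by rewrite lt_min d10.
  move=> u; rewrite /= in_itv/= => /andP[ru ut]; rewrite lt_min => /andP[xu1 xu2].
  by case: (leP u s) => us; [apply: h1|apply: h2]; rewrite //= in_itv/= ?ru ?us ?ut ?ltW.
Qed.

Lemma solution_on_cat (y h v : R -> X) (r s t : R) : r <= s -> s <= t -> continuous y ->
  loc_integrable h -> solution_on F y h r s v -> solution_on F y h s t v -> solution_on F y h r t v.
Proof.
move=> rs st cy hl [c1 v1] [c2 v2].
have c := cont_on_cat rs st c1 c2; split => // u /andP[ru ut].
have [us|su] := leP u s; first by apply: v1; rewrite ru.
apply: (@voc_cat _ _ _ _ _ r s u) => //; first exact: ltW.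
- apply: (admissible_force_cont L0 FL F0) => //; first exact: continuous_cont_on.
  by apply: cont_on_subset c; apply: subset_itvl; rewrite bnd_simp.
- by apply: v1; rewrite rs lexx.
- by apply: v2; rewrite ut ltW.
Qed.

Lemma solution_on_trim (y h v : R -> X) (r s t : R) : r <= s -> s <= t -> continuous y ->
  loc_integrable h -> solution_on F y h r t v -> solution_on F y h s t v.
Proof.
move=> rs st cy hl [c vv]; split.
  by apply: cont_on_subset c; apply: subset_itvr; rewrite bnd_simp.
move=> u /andP[su ut]; apply: (@voc_cut _ _ _ _ _ r s u) => //.
- apply: (admissible_force_cont L0 FL F0) => //; first exact: continuous_cont_on.
  by apply: cont_on_subset c; apply: subset_itvl; rewrite bnd_simp.
- by apply: vv; rewrite rs.
- by apply: vv; rewrite ut (le_trans rs su).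
Qed.

(** The substitution multiplies both sides of [voc] by [expR (- lam j * d)]. *)
Lemma solution_on_shift (y h v : R -> X) (r t d : R) : continuous y -> loc_integrable h ->
  solution_on F y h (r + d) (t + d) v ->
  solution_on F (fun s => y (s + d)) (fun s => h (s + d)) r t (fun s => v (s + d)).
Proof.
move=> cy hl [c vv]; split.
  move=> x /=; rewrite in_itv/= => xD e e0.
  have [|dl dl0 hh] := c (x + d) _ e e0; first by rewrite /= in_itv/= !lerD2r.
  exists dl => // u; rewrite /= in_itv/= => uD xu; apply: hh.
    by rewrite /= in_itv/= !lerD2r.
  by rewrite opprD addrACA subrr addr0.
move=> s /andP[rs st] j.
have /(_ (s + d)) := vv; rewrite !lerD2r rs st => /(_ isT j) e.
have c' : cont_on `[r + d, s + d] v.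
  by apply: cont_on_subset c; apply: subset_itvl; rewrite bnd_simp lerD2r.
have af := admissible_force_cont L0 FL F0 (continuous_cont_on (D := `[r + d, s + d]%classic) cy) hl c'.
have ia := voc_integrable j af.
have exD (u : R) : expR (lam j * u) = expR (- lam j * d) * expR (lam j * (u + d)).
  by rewrite -expRD; congr expR; ring.
pose f0 (u : R) : R := expR (- lam j * d) * (expR (lam j * u) * cr A (force F y h v u) j).
have -> : \int[leb]_(u in `[r, s]) (expR (lam j * u) *
    cr A (force F (fun s => y (s + d)) (fun s => h (s + d)) (fun s => v (s + d)) u) j) =
    \int[leb]_(u in `[r, s]) f0 (u + d).
  by apply: eq_Rintegral => u _; rewrite /f0 mulrA -exD.
rewrite (@Rintegral_shift_set _ d `[r + d, s + d] _ f0); first last.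
- by apply: measurable_funM => //; apply: measurable_funM; [exact: measurable_expRMr|exact: af.1].
- by move=> u; apply/idP/idP; rewrite !inE/= !in_itv/= !lerD2r.
- exact: measurable_itv.
rewrite (lebesgue_RintegralZl _ (measurable_itv _) ia) -e mulrBr !mulrA.
by rewrite -!exD.
Qed.

Section forced.
Variable z : path_space H -> X.
Hypothesis zT : tempered_continuous z.
Notation path w := (fun s : R => z (theta s w)).

Lemma mild_solutionP (r : R) (w : path_space H) (h : R -> X) (vr : X) (v : R -> X) :
  loc_integrable h ->
  mild_solution F z r w h vr v <-> forward_solution F (path w) h r v /\ v r = vr.
Proof.
move=> hl; have cy : continuous (path w) := (zT w).1.
have adm t : cont_on `[r, t] v -> admissible A (force F (path w) h v) `[r, t].
  by move=> cv; apply: (admissible_force_cont L0 FL F0) => //; exact: continuous_cont_on.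
split=> [[/within_cont_onP cv vv]|[vS vr0]].
  have cvt t : cont_on `[r, t] v.
    apply: cont_on_subset cv => s /=; rewrite !in_itv/= andbT; by case/andP.
  have vt t : r <= t -> forall j, expR (lam j * t) * cr A (v t) j - expR (lam j * r) * cr A vr j =
      \int[leb]_(s in `[r, t]) (expR (lam j * s) * cr A (force F (path w) h v s) j).
    move=> rt; apply/(duhamel_voc (v t : H) (vr : H) rt (adm t (cvt t))).
    exact: vv.
  have vr0 : v r = vr.
    apply: (@crX_inj _ _ A) => j; have := vt r (lexx _) j.
    rewrite set_itv1 Rintegral_set1 => /eqP; rewrite subr_eq0 => /eqP.
    by apply: mulfI; rewrite gt_eqF// expR_gt0.
  split => // t rt; split; first exact: cvt.
  by move=> s /andP[rs st] j; rewrite vr0; exact: vt.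
split; first by apply/within_cont_onP; exact: forward_solution_cont_on vS.
move=> t rt; have [cv vv] := vS t rt.
apply/(duhamel_voc (v t : H) (vr : H) rt (adm t cv)) => j; rewrite -vr0.
by apply: vv; rewrite rt lexx.
Qed.

Lemma vsolE (r t : R) (w : path_space H) (h v : R -> X) : loc_integrable h -> r <= t ->
  forward_solution F (path w) h r v -> vsol F z t r w h (v r) = v t.
Proof.
move=> hl rt vS; rewrite /vsol.
have mv : mild_solution F z r w h (v r) v by apply/mild_solutionP.
have := @xgetPex _ (cst 0) [set v' | mild_solution F z r w h (v r) v'] (ex_intro _ v mv).
set v' := xget _ _ => /= /(mild_solutionP r w (v r) v' hl)[v'S v'r].
apply: (solution_on_unique a_lt1 a_lt12 L0 FL F0 (zT w).1 hl (v'S t rt) (vS t rt) v'r).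
by rewrite rt lexx.
Qed.

Variable g : R -> X.
Hypothesis gl : loc_integrable g.

Lemma PhiE (t tau : R) (w : path_space H) (v : R -> X) : 0 <= t ->
  forward_solution F (path w) (gshift g tau) 0 v ->
  Phi F z g t tau w (v 0 + z w) = v t + z (theta t w).
Proof.
move=> t0 vS; rewrite /Phi /usol !theta_theta !subrr addrK theta0 addrK.
congr (_ + _).
pose v' s := v (s - tau).
have v'0 : v 0 = v' tau by rewrite /v' subrr.
have v't : v t = v' (t + tau) by rewrite /v' addrK.
rewrite v'0 v't; apply: vsolE => //; first by rewrite lerDr.
move=> s ts.
have st : 0 <= s - tau by rewrite subr_ge0.
have := vS _ st; rewrite -[X in solution_on _ _ _ X](subrr tau).
move=> /(solution_on_shift (zT w).1 (loc_integrable_shift tau gl)).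
rewrite (_ : (fun s => z (theta (s - tau) w)) = path (theta (- tau) w)); last first.
  by apply/funext => u; rewrite theta_theta.
by rewrite (_ : (fun s => gshift g tau (s - tau)) = g)//; apply/funext => u; rewrite /gshift subrK.
Qed.

(** Frees [Mset] from the chosen solution [vsol]: existence and uniqueness make following [vsol] on
    every [[r, t]] the same as being a solution there. *)
Lemma MsetP (mu : R) tau w x : Mset F z g mu tau w x <->
  exists xi, [/\ past_bounded mu xi, backward_trajectory F (path w) (gshift g tau) xi & xi 0 = x].
Proof.
have hl := loc_integrable_shift tau gl; have cy : continuous (path w) := (zT w).1.
split.
  move=> [xi [[cxi bxi] xiv] xi0]; exists xi; split => // r r0.
  have [v vS vr] := forward_solution_exists a_lt1 a_lt12 L0 FL F0 r (xi r) cy hl.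
  apply: eq_solution_on (vS 0 r0) => s /andP[rs s0].
  by rewrite -(xiv r s rs s0) -vr (vsolE hl rs vS).
move=> [xi [bxi xib xi0]]; exists xi => //; split.
  by split=> //; apply/within_cont_onP; exact: backward_trajectory_cont_on xib.
move=> r t rt t0.
have [v vS vr] := forward_solution_exists a_lt1 a_lt12 L0 FL F0 r (xi r) cy hl.
have r0 := le_trans rt t0.
rewrite -vr (vsolE hl rt vS).
apply: (solution_on_unique a_lt1 a_lt12 L0 FL F0 cy hl (vS 0 r0) (xib r r0) vr).
by rewrite rt.
Qed.

End forced.
End cocycle.

(** * The manifold *)

Section lipschitz_graphs.
Context {R : realType}.

Lemma edist_norm (V : normedModType R) (x y : V) : edist (x, y) = `|x - y|%:E.
Proof.
apply/eqP; rewrite eq_le; apply/andP; split; last first.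
  apply/ereal_infP => _ [r [_ +] <-]; rewrite lee_fin -ball_normE /=.
  exact: ltW.
apply/lee_addgt0Pr => e e0; apply: ereal_inf_lbound; rewrite -EFinD.
exists (`|x - y| + e) => //; split; first by rewrite ltr_wpDl.
by rewrite -ball_normE /= ltrDl.
Qed.

Lemma lipschitz_closed_zero (V W : normedModType R) (f : V -> W) (C : R) :
  (forall x y, `|f x - f y| <= C * `|x - y|) -> closed [set x | f x = 0].
Proof.
move=> fC x clx; apply/eqP; rewrite -normr_le0; apply/ler_addgt0Pr => e e0; rewrite add0r.
have C0 : 0 < `|C| + 1 by rewrite ltr_wpDl.
have eC : 0 < e / (`|C| + 1) by rewrite divr_gt0.
have [y [/= fy0]] := clx _ (nbhsx_ballx x _ eC).
rewrite -ball_normE /= => xy; rewrite -[f x]subr0 -fy0 (le_trans (fC x y))//.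
apply: (@le_trans _ _ ((`|C| + 1) * `|x - y|)).
  by rewrite ler_wpM2r// (le_trans (ler_norm _))// lerDl.
by rewrite -ler_pdivlMl// mulrC ltW.
Qed.

(** By Lipschitz continuity a countable dense set of base points suffices for the distance to the
    image; measurability in the random parameter then passes through the infimum. *)
Lemma edist_inf_dense (V : normedModType R) (E : set V) (phi : V -> V) (K : R) (p : nat -> V) a :
  (forall i, E (p i)) -> (forall x e, E x -> 0 < e -> exists i, `|x - p i| < e) ->
  (forall x y, E x -> E y -> `|phi x - phi y| <= K * `|x - y|) ->
  edist_inf [set phi x | x in E] a = einfs (fun i => `|a - phi (p i)|%:E) 0%N.
Proof.
move=> Ep dp phiK; rewrite /edist_inf; apply/eqP; rewrite eq_le; apply/andP; split.
  apply/ereal_infP => _ [i _ <-]; apply: ereal_inf_lbound.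
  exists (phi (p i)); last exact: edist_norm.
  by exists (p i).
apply/ereal_infP => _ [_ [x Ex <-] <-]; rewrite edist_norm.
apply/lee_addgt0Pr => e e0.
have K0 : 0 < `|K| + 1 by rewrite ltr_wpDl.
have eK : 0 < e / (`|K| + 1) by rewrite divr_gt0.
have [i xi] := dp x _ Ex eK.
apply: (@le_trans _ _ (`|a - phi (p i)|%:E)).
  by apply: ereal_inf_lbound; exists i.
rewrite -EFinD lee_fin -[a - phi (p i)](subrKA (phi x)) (le_trans (ler_normD _ _))// lerD2l.
rewrite (le_trans (phiK _ _ Ex (Ep i)))//.
apply: (@le_trans _ _ ((`|K| + 1) * `|x - p i|)).
  by rewrite ler_wpM2r// (le_trans (ler_norm _))// lerDl.
by rewrite -ler_pdivlMl// mulrC ltW.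
Qed.

End lipschitz_graphs.

(** * The graph, its translate by the noise, and the manifold properties *)

Section inertial_graph.
Context {R : realType} {H : hilbertType R} (A : spectral_operator H).
Context {alpha : {nonneg R}}.
Notation X := (fracdom A alpha).
Notation lam := (eigval A).
Notation wt j := (lam j `^ alpha%:num).
Notation leb := (@lebesgue_measure R).
Hypothesis a_lt1 : alpha%:num < 1.
Hypothesis a_lt12 : alpha%:num < 2^-1.
Variables (F : X -> H) (L : R).
Hypothesis L0 : 0 <= L.
Hypothesis FL : forall x y : X, `|F x - F y| <= L * `|x - y|.
Hypothesis F0 : F 0 = 0.
Variables (n : nat) (mu : R) (k : R -> R).
Hypothesis kP : @kernel _ _ A alpha (skernel A true n) k mu.
Hypothesis q1 : kmass k * L < 1.
Hypothesis mu0 : 0 < mu.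
Hypothesis mu_gt : forall j, (j < n)%N -> lam j <= mu.
Hypothesis mu_lt : mu < lam n.
Variable z : path_space H -> X.
Hypothesis zT : tempered_continuous z.
Hypothesis mz : borel_measurable setT z.
Variable g : R -> X.
Hypothesis gl : loc_integrable g.
Hypothesis gI : forall tau,
  leb.-integrable `]-oo, (0 : R)] (EFin \o (fun s => expR (mu * s) * `|gshift g tau s|)).
Notation path w := (fun s : R => z (theta s w)).

Lemma PnHP (x : X) : PnH n x <-> forall j, (n <= j)%N -> cr A x j = 0.
Proof.
split=> [[u _ ux] j nj|x0].
  by rewrite -ux cr_proj ltnNge nj.
exists (x : H) => //; apply: (@cr_inj _ _ A) => j.
by rewrite cr_proj; case: ltnP => // /x0.
Qed.

Lemma PnH_PnX (x : X) : PnH n (PnX n x).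
Proof. by apply/PnHP => j nj; rewrite cr_PnX ltnNge nj. Qed.

Lemma PnX_QnX (x : X) : x = PnX n x + QnX n x.
Proof. by rewrite /QnX addrC subrK. Qed.

Lemma PnX_id (x : X) : PnH n x -> PnX n x = x.
Proof.
move=> /PnHP x0; apply: (@crX_inj _ _ A) => j; rewrite cr_PnX.
by case: ltnP => // /x0.
Qed.

Lemma norm_PnX_le (x : X) : `|PnX n x| <= `|x|.
Proof.
apply: normX_le => // m; apply: le_trans (besselX x m).
by apply: ler_sum => j _; rewrite cr_PnX; case: ifP => _; rewrite ?mulr0 ?expr0n ?sqr_ge0.
Qed.

Lemma PnXB (x y : X) : PnX n (x - y) = PnX n x - PnX n y.
Proof. by apply: (@crX_inj _ _ A) => j; rewrite !(cr_PnX, crXB); case: ifP; rewrite ?subr0. Qed.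

(** The Lyapunov-Perron equation without continuity, which is a consequence; this is what the
    parametrised fixpoint delivers. *)
Definition orbit tau w (x : X) (xi : R -> X) : Prop :=
  [/\ past_measurable xi, past_bounded mu xi & line_form F n (path w) (gshift g tau) x xi].

Lemma orbit_backward_trajectory tau w x xi : orbit tau w x xi ->
  backward_trajectory F (path w) (gshift g tau) xi /\ forall j, (j < n)%N -> cr A (xi 0) j = cr A x j.
Proof.
move=> [mxi bxi lf]; have [Cy yC] := tempered_past_bound zT w mu0.
exact: (line_form_backward_trajectory a_lt1 a_lt12 L0 FL F0 kP (zT w).1 yC (loc_integrable_shift tau gl) (gI tau)).
Qed.

Lemma orbit_lipschitz tau w x1 x2 xi1 xi2 : orbit tau w x1 xi1 -> orbit tau w x2 xi2 ->
  forall t, t <= 0 -> expR (mu * t) * `|xi1 t - xi2 t| <= `|x1 - x2| / (1 - kmass k * L).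
Proof.
move=> [m1 b1 l1] [m2 b2 l2]; have [Cy yC] := tempered_past_bound zT w mu0.
exact: (line_form_lipschitz L0 FL F0 kP q1 mu_gt (zT w).1 yC (loc_integrable_shift tau gl) (gI tau)).
Qed.

Lemma orbit_eq tau w x xi1 xi2 : orbit tau w x xi1 -> orbit tau w x xi2 -> xi1 0 = xi2 0.
Proof.
move=> o1 o2; have := orbit_lipschitz o1 o2 (lexx 0).
by rewrite subrr normr0 mul0r mulr0 expR0 mul1r normr_le0 subr_eq0 => /eqP.
Qed.

Lemma orbit_head tau w (x1 x2 : X) xi : (forall j, (j < n)%N -> cr A x1 j = cr A x2 j) ->
  orbit tau w x1 xi -> orbit tau w x2 xi.
Proof.
move=> x12 [m b lf]; split => // t j t0; rewrite (lf t j t0).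
by case: ifP => // jn; rewrite x12.
Qed.

Lemma orbits_exist tau (x : path_space H -> X) :
  (forall j, measurable_fun setT (fun w => cr A (x w) j)) ->
  exists2 xi : path_space H -> R -> X, jmeasX xi & forall w, orbit tau w (x w) (xi w).
Proof.
move=> mx.
have [xi [mxi bxi lf]] := line_form_exists L0 FL F0 kP q1 mu_gt
  (loc_integrable_shift tau gl) (gI tau) (jmeasX_noise zT mz) (fun w => (zT w).1)
  (fun w => tempered_past_bound zT w mu0) mx.
exists xi => // w; split => // j.
by apply: measurable_funTS; exact: jmeasX1.
Qed.

Lemma orbit_exists tau w x : exists xi, orbit tau w x xi.
Proof.
have [xi _ xiP] := @orbits_exist tau (fun=> x) (fun j => measurable_cst _).
by exists (xi w).
Qed.

Lemma lyapunov_perron_orbit tau w x xi : PnH n x ->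
  lyapunov_perron F z g mu n tau w x xi <->
  cont_on `]-oo, (0 : R)] xi /\ orbit tau w x xi.
Proof.
move=> xP; have [Cy yC] := tempered_past_bound zT w mu0.
have LP (m : past_measurable xi) (b : past_bounded mu xi) :=
  lyapunov_perron_line L0 FL F0 mu_lt (zT w).1 yC
  (loc_integrable_shift tau gl) (gI tau) m b xP.
split=> [[[/within_cont_onP cxi bxi] eqxi]|[cxi [mxi bxi lf]]].
  have mxi := cont_on_past_measurable cxi.
  by split => //; split => //; apply/LP.
by split; [split => //; exact/within_cont_onP|exact/LP].
Qed.

(** [xistar] is one chosen solution; by uniqueness any orbit gives the same value at 0, in
    particular one that depends measurably on [w]. *)
Lemma mmapE tau w x xi : PnH n x -> orbit tau w x xi ->
  mmap F z g mu n tau w x = QnX n (xi 0).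
Proof.
move=> xP xiO; rewrite /mmap; congr QnX.
have lp : lyapunov_perron F z g mu n tau w x xi.
  by apply/lyapunov_perron_orbit => //; split => //; apply: backward_trajectory_cont_on; exact: (orbit_backward_trajectory xiO).1.
have := @xgetPex _ (cst 0) [set xi | lyapunov_perron F z g mu n tau w x xi] (ex_intro _ xi lp).
rewrite -/(xistar _ _ _ _ _ _ _ _) => /(lyapunov_perron_orbit _ _ _ xP)[_ xiO'].
exact: orbit_eq xiO' xiO.
Qed.

Lemma orbit0 tau w x xi : PnH n x -> orbit tau w x xi -> xi 0 = x + mmap F z g mu n tau w x.
Proof.
move=> xP xiO; rewrite (mmapE xP xiO) [LHS](PnX_QnX); congr (_ + _).
have [_ h] := orbit_backward_trajectory xiO.
apply: (@crX_inj _ _ A) => j; rewrite cr_PnX; case: ltnP => [/h//|nj].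
by move/PnHP : xP => ->.
Qed.

Lemma Mset_graph tau w : Mset F z g mu tau w =
  [set x + mmap F z g mu n tau w x | x in PnH n].
Proof.
apply/seteqP; split=> [y /(MsetP a_lt1 a_lt12 L0 FL F0 zT gl)[xi [bxi txi <-]]|_ [x xP <-]].
  have [Cy yC] := tempered_past_bound zT w mu0.
  have lf := backward_trajectory_line_form L0 FL F0 kP mu_lt (zT w).1 yC (loc_integrable_shift tau gl) (gI tau) bxi txi.
  have mxi := cont_on_past_measurable (backward_trajectory_cont_on txi).
  have xiO : orbit tau w (PnX n (xi 0)) xi.
    apply: (@orbit_head _ _ (xi 0)); last by split.
    by move=> j jn; rewrite cr_PnX jn.
  exists (PnX n (xi 0)); first exact: PnH_PnX.
  by rewrite -(orbit0 (PnH_PnX _) xiO).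
have [xi xiO] := orbit_exists tau w x; have [_ bxi _] := xiO.
apply/(MsetP a_lt1 a_lt12 L0 FL F0 zT gl); exists xi; split => //.
  exact: (orbit_backward_trajectory xiO).1.
exact: orbit0.
Qed.

Lemma mmap_lipschitz tau w x1 x2 : PnH n x1 -> PnH n x2 ->
  `|mmap F z g mu n tau w x1 - mmap F z g mu n tau w x2| <= (1 - kmass k * L)^-1 * `|x1 - x2|.
Proof.
move=> P1 P2; have [xi1 o1] := orbit_exists tau w x1; have [xi2 o2] := orbit_exists tau w x2.
rewrite (mmapE P1 o1) (mmapE P2 o2) -QnX_B (le_trans (norm_QnX_le _ _))//.
by have := orbit_lipschitz o1 o2 (lexx 0); rewrite mulr0 expR0 mul1r mulrC.
Qed.

(* [y + z] with [y] on the graph of [mmap] has low modes [PnX y + PnX z]: written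
   as a graph over its own low modes, the translate is that of [graph_map]. *)
Definition graph_map tau w (x : X) : X :=
  QnX n (z w) + mmap F z g mu n tau w (x - PnX n (z w)).

Lemma PnH_sub (x y : X) : PnH n x -> PnH n (x - PnX n y).
Proof.
move=> /PnHP x0; apply/PnHP => j nj.
by rewrite crXB cr_PnX ltnNge nj subr0 x0.
Qed.

Lemma graph_map_lipschitz tau w x1 x2 : PnH n x1 -> PnH n x2 ->
  `|graph_map tau w x1 - graph_map tau w x2| <= (1 - kmass k * L)^-1 * `|x1 - x2|.
Proof.
move=> P1 P2; rewrite /graph_map opprD addrACA subrr add0r.
have := mmap_lipschitz tau w (PnH_sub (z w) P1) (PnH_sub (z w) P2).
by rewrite [X in _ -> _ <= _ * `|X|](_ : _ = (x1 - PnX n (z w)) - (x2 - PnX n (z w)))// opprB addrA subrK.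
Qed.

Lemma cr_mmap tau w x j : PnH n x -> (j < n)%N -> cr A (mmap F z g mu n tau w x) j = 0.
Proof. by move=> xP jn; rewrite /mmap cr_QnX jn. Qed.

Lemma cr_graph_map tau w x j : PnH n x -> (j < n)%N -> cr A (graph_map tau w x) j = 0.
Proof. by move=> xP jn; rewrite /graph_map crXD cr_QnX jn cr_mmap// ?addr0//; exact: PnH_sub. Qed.

(** The base point [x - PnX n (z w)] is itself random. Instead of composing measurable maps, the
    fixpoint is solved with this base point as part of the parametrised data. *)
Lemma measurable_graph_map tau x j : PnH n x ->
  measurable_fun setT (fun w => cr A (graph_map tau w x) j).
Proof.
move=> xP.
have mzj i : measurable_fun setT (fun w => cr A (z w) i) by exact: measurable_crX.
have mx i : measurable_fun setT (fun w => cr A (x - PnX n (z w)) i).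
  apply: (eq_measurable_fun (fun w => cr A x i - (if (i < n)%N then cr A (z w) i else 0))).
    by move=> w _; rewrite crXB cr_PnX.
  apply: measurable_funB => //; case: (i < n)%N => //; exact: measurable_cst.
have [xi mxi xiO] := orbits_exist tau mx.
have mxi0 : measurable_fun setT (fun w => cr A (xi w 0) j).
  exact: (measurable_fun_pair1 (0 : R) (mxi j)).
apply: (eq_measurable_fun (fun w => if (j < n)%N then 0 else cr A (z w) j + cr A (xi w 0) j)).
  move=> w _; rewrite /graph_map (mmapE (PnH_sub _ xP) (xiO w)) crXD !cr_QnX.
  by case: ifP => _; rewrite ?addr0.
case: (j < n)%N; first exact: measurable_cst.
exact: measurable_funD.
Qed.

Lemma shifted_graph tau w :
  [set x + z w + mmap F z g mu n tau w x | x in PnH n] =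
  [set x + graph_map tau w x | x in PnH n].
Proof.
apply/seteqP; split=> _ [x xP <-].
  exists (x + PnX n (z w)).
    rewrite -[PnX n (z w)]opprK -(PnX_id (PnH_PnX (z w))).
    have := PnH_sub (- z w) xP.
    suff -> : PnX n (- z w) = - PnX n (PnX n (z w)) by [].
    by rewrite (PnX_id (PnH_PnX _)) -[- z w]sub0r PnXB (PnX_id _) ?sub0r//; apply/PnHP => j _; rewrite crX0.
  have addE (a p q m : X) : a + p + (q + m) = a + (p + q) + m by rewrite !addrA.
  by rewrite /graph_map addrK addE -PnX_QnX.
exists (x - PnX n (z w)); first exact: PnH_sub.
have subE (a p b m : X) : a - p + b + m = a + ((b - p) + m) by rewrite !addrA [a + b - p]addrAC.
exact: subE.
Qed.

Definition shifted_manifold tau w : set X := [set y + z w | y in Mset F z g mu tau w].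

Lemma shifted_manifoldE tau w :
  shifted_manifold tau w = [set x + z w + mmap F z g mu n tau w x | x in PnH n].
Proof.
rewrite /shifted_manifold Mset_graph; apply/seteqP; split=> [_ [_ [x xP <-] <-]|_ [x xP <-]].
  by exists x => //; rewrite addrAC.
by exists (x + mmap F z g mu n tau w x); [exists x|rewrite addrAC].
Qed.

Lemma shifted_manifold_graph tau w :
  shifted_manifold tau w = [set x + graph_map tau w x | x in PnH n].
Proof. by rewrite shifted_manifoldE shifted_graph. Qed.

Lemma graph_proj (x y : X) tau w : PnH n x -> y = x + graph_map tau w x -> PnX n y = x.
Proof.
move=> xP ->; apply: (@crX_inj _ _ A) => j; rewrite cr_PnX; case: ltnP => [jn|nj].
  by rewrite crXD cr_graph_map// addr0.
by move/PnHP : xP => ->.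
Qed.

Lemma lip_const_ge0 : 0 <= (1 - kmass k * L)^-1.
Proof. by rewrite invr_ge0 subr_ge0 ltW. Qed.

(** The set is the zero set of the Lipschitz map [y |-> QnX n y - graph_map tau w (PnX n y)]. *)
Lemma closed_shifted_manifold tau w : closed (shifted_manifold tau w).
Proof.
rewrite shifted_manifold_graph.
rewrite (_ : [set _ | _ in _] = [set y | QnX n y - graph_map tau w (PnX n y) = 0]).
  apply: (@lipschitz_closed_zero _ _ _ _ (1 + (1 - kmass k * L)^-1)) => x y.
  have subACA (a b c d : X) : a - b - (c - d) = (a - c) - (b - d) by rewrite opprD addrACA -opprD.
  rewrite (subACA (QnX n x)) -QnX_B (le_trans (ler_normB _ _))//.
  rewrite mulrDl mul1r; apply: lerD; first exact: norm_QnX_le.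
  apply: (le_trans (graph_map_lipschitz tau w (PnH_PnX x) (PnH_PnX y))).
  by apply: ler_wpM2l; [exact: lip_const_ge0|rewrite -PnXB; exact: norm_PnX_le].
apply/seteqP; split=> [y [x xP /esym yx]|y /= /eqP].
  have yP := graph_proj xP yx.
  rewrite /= yP (_ : QnX n y = graph_map tau w x); first exact: subrr.
  by rewrite /QnX yP yx [x + _]addrC addrK.
rewrite subr_eq0 => /eqP yq; exists (PnX n y); first exact: PnH_PnX.
by rewrite -yq -PnX_QnX.
Qed.

(** [PnX n] does not increase norms, so it carries a dense sequence of the space to one of
    [PnH n]. *)
Lemma random_closed_shifted_manifold tau : random_closed_set (shifted_manifold tau).
Proof.
split=> [w|a].
  split; first exact: closed_shifted_manifold.
  rewrite shifted_manifold_graph; exists (0 + graph_map tau w 0), 0 => //.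
  by apply/PnHP => j _; rewrite crX0.
have [d dd] := @fracdom_dense R H A alpha.
pose p i := PnX n (d i).
have pE i : PnH n (p i) by exact: PnH_PnX.
have E w : edist_inf (shifted_manifold tau w) a =
    einfs (fun i => `|a - (p i + graph_map tau w (p i))|%:E) 0%N.
  rewrite shifted_manifold_graph.
  apply: (@edist_inf_dense _ _ _ (fun x => x + graph_map tau w x) (1 + (1 - kmass k * L)^-1)) => //.
    move=> x e xP e0; have [i xi] := dd x e e0; exists i.
    by rewrite -[x](PnX_id xP) -PnXB (le_lt_trans (norm_PnX_le _)).
  move=> x y xP yP; rewrite opprD addrACA (le_trans (ler_normD _ _))//.
  by rewrite mulrDl mul1r lerD2l graph_map_lipschitz.
apply: (eq_measurable_fun (fun w => einfs (fun i => `|a - (p i + graph_map tau w (p i))|%:E) 0%N)).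
  by move=> w _; rewrite E.
apply: (measurable_fun_einfs (f := fun i w => `|a - (p i + graph_map tau w (p i))|%:E)) => i.
apply/measurable_EFinP; apply: (@measurable_normX _ _ A) => // j.
apply: (eq_measurable_fun (fun w => cr A a j - (cr A (p i) j + cr A (graph_map tau w (p i)) j))).
  by move=> w _; rewrite crXB crXD.
apply: measurable_funB => //; apply: measurable_funD => //.
exact: measurable_graph_map.
Qed.

Lemma finite_dim_PnH : finite_dim_subspace (PnH n : set X).
Proof.
exists n, (fun i => eigvecX A i); apply/seteqP; split=> [x /PnHP xP|_ [c _ <-]].
  exists (fun i : 'I_n => cr A x i) => //; apply: (@crX_inj _ _ A) => j.
  by rewrite (cr_sum_eigvecX A (cr A x)); case: ltnP => // /xP.
apply/PnHP => j nj.
pose c' i := if insub i is Some i' then c i' else 0 : R.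
rewrite (_ : \sum_(i < n) _ = \sum_(i < n) c' i *: eigvecX A i); last first.
  by apply: eq_bigr => i _; rewrite /c' valK.
by rewrite cr_sum_eigvecX ltnNge nj.
Qed.

Lemma PnX0P (x : X) : PnX n x = 0 <-> forall j, (j < n)%N -> cr A x j = 0.
Proof.
split=> [x0 j jn|x0].
  by have := cr_PnX n x j; rewrite x0 jn crX0.
by apply: (@crX_inj _ _ A) => j; rewrite cr_PnX crX0; case: ifP => // /x0.
Qed.

Lemma direct_sum_PnH : direct_sum (PnH n : set X) [set x | PnX n x = 0].
Proof.
split.
- split; split.
  + by apply/PnHP => j _; rewrite crX0.
  + move=> a u v /PnHP uP /PnHP vP; apply/PnHP => j nj.
    by rewrite crXD crXZ uP// vP// mulr0 addr0.
  + by apply/PnX0P => j _; rewrite crX0.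
  + move=> a u v /= /PnX0P uP /PnX0P vP; apply/PnX0P => j jn.
    by rewrite crXD crXZ uP// vP// mulr0 addr0.
- split.
    rewrite (_ : PnH n = [set x | QnX n x = 0]).
      by apply: (@lipschitz_closed_zero _ _ _ _ 1) => x y; rewrite -QnX_B mul1r norm_QnX_le.
    apply/seteqP; split=> x /= => [xP|/eqP]; first by rewrite /QnX PnX_id// subrr.
    by rewrite subr_eq0 => /eqP ->; exact: PnH_PnX.
  by apply: (@lipschitz_closed_zero _ _ _ _ 1) => x y; rewrite -PnXB mul1r norm_PnX_le.
- apply/seteqP; split=> [x [xP /= x0]|_ ->]; first by rewrite -(PnX_id xP) x0.
  by split; [apply/PnHP|apply/PnX0P] => j _; rewrite crX0.
- move=> x; exists (PnX n x), (QnX n x); split; [exact: PnH_PnX| |exact: PnX_QnX].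
  by rewrite /= /QnX PnXB (PnX_id (PnH_PnX _)) subrr.
Qed.

Lemma path_theta t w : path (theta t w) = fun s => path w (s + t).
Proof. by apply/funext => s; rewrite theta_theta. Qed.

Lemma gshiftD tau t : gshift g (tau + t) = fun s => gshift g tau (s + t).
Proof. by apply/funext => s; rewrite /gshift addrAC addrA. Qed.

Lemma trajectory_shift tau w (t : R) (u : R -> X) :
  (forall r, r <= t -> solution_on F (path w) (gshift g tau) r t u) ->
  backward_trajectory F (path (theta t w)) (gshift g (tau + t)) (fun s => u (s + t)).
Proof.
move=> ut r r0; rewrite path_theta gshiftD.
apply: (solution_on_shift L0 FL F0 (zT w).1 (loc_integrable_shift tau gl)).
by rewrite add0r; apply: ut; rewrite -[leRHS]add0r lerD2r.
Qed.

Lemma past_bounded_shift (t : R) (u : R -> X) : 0 <= t -> cont_on `[(0 : R), t] u ->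
  past_bounded mu u -> past_bounded mu (fun s => u (s + t)).
Proof.
move=> t0 cu [C uC]; have [C' uC'] := cont_on_bounded cu.
exists (Num.max (expR (- mu * t) * C) C') => s s0; rewrite le_max.
have [st|st] := leP (s + t) 0.
  rewrite (_ : expR (mu * s) = expR (- mu * t) * expR (mu * (s + t))); last first.
    by rewrite -expRD; congr expR; ring.
  by rewrite -mulrA ler_wpM2l ?expR_ge0// uC.
apply/orP; right; apply: le_trans (uC' (s + t) _); last first.
  by rewrite in_itv/= (ltW st)/= gerDr.
by rewrite ler_piMl// expR_le1 mulr_ge0_le0// ltW.
Qed.

(** A past orbit prolonged by the forward solution and shifted by [t] is again a past orbit with the
    same growth. Conversely a past orbit at the later time, shifted back, passes at time 0 through a
    point that flows to the given one, by forward uniqueness. *)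
Lemma invariant_shifted_manifold t tau w : 0 <= t ->
  Phi F z g t tau w @` shifted_manifold tau w = shifted_manifold (tau + t) (theta t w).
Proof.
move=> t0; have hl := loc_integrable_shift tau gl; have cy : continuous (path w) := (zT w).1.
have MP := MsetP a_lt1 a_lt12 L0 FL F0 zT gl mu.
have PE v := PhiE a_lt1 a_lt12 L0 FL F0 zT gl t0 (v := v) (tau := tau) (w := w).
apply/seteqP; split=> [_ [_ [x /MP[xi [bxi txi xi0]] <-] <-]|_ [x /MP[xi [bxi txi xi0]] <-]].
  have [v vS v0] := forward_solution_exists a_lt1 a_lt12 L0 FL F0 0 x cy hl.
  exists (v t); last by rewrite -v0 PE.
  pose u s := if s <= 0 then xi s else v s.
  have us s : s <= 0 -> u s = xi s by rewrite /u => ->.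
  have uv s : 0 <= s -> u s = v s.
    by rewrite /u le0r => /orP[/eqP ->|s0]; rewrite ?lexx ?xi0 ?v0// leNgt s0.
  have ut : solution_on F (path w) (gshift g tau) 0 t u.
    by apply: eq_solution_on (vS t t0) => s /andP[s0 _]; rewrite uv.
  apply/MP; exists (fun s => u (s + t)); split.
  - apply: past_bounded_shift => //; first exact: ut.1.
    by have [C xC] := bxi; exists C => s s0; rewrite us// xC.
  - apply: trajectory_shift => r rt; have [r0|r0] := leP r 0.
      apply: (solution_on_cat L0 FL F0 r0 t0 cy hl _ ut).
      by apply: eq_solution_on (txi r r0) => s /andP[_ s0]; rewrite us.
    exact: (solution_on_trim L0 FL F0 (ltW r0) rt cy hl ut).
  - by rewrite add0r uv.
pose u s := xi (s - t).
have ut r : r <= t -> solution_on F (path w) (gshift g tau) r t u.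
  move=> rt; have r0 : r - t <= 0 by rewrite subr_le0.
  have := txi _ r0; rewrite path_theta gshiftD -[X in solution_on _ _ _ _ X](subrr t).
  have cy' : continuous (fun s => path w (s + t)) by rewrite -path_theta; exact: (zT _).1.
  have hl' : loc_integrable (fun s => gshift g tau (s + t)).
    by rewrite -gshiftD; exact: loc_integrable_shift.
  move=> /(solution_on_shift L0 FL F0 cy' hl'); rewrite -/u.
  rewrite (_ : (fun s => path w (s - t + t)) = path w).
    rewrite (_ : (fun s => gshift g tau (s - t + t)) = gshift g tau)//.
    by apply/funext => s; rewrite subrK.
  by apply/funext => s; rewrite subrK.
have [v vS v0] := forward_solution_exists a_lt1 a_lt12 L0 FL F0 0 (u 0) cy hl.
have vt : v t = x.
  rewrite -xi0 -(subrr t) -/(u t).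
  by apply: (solution_on_unique a_lt1 a_lt12 L0 FL F0 cy hl (vS t t0) (ut 0 t0) v0); rewrite t0 lexx.
exists (v 0 + z w); last by rewrite PE// vt.
exists (v 0) => //; apply/MP; exists u; split => //.
- have [C xC] := bxi; exists (expR (mu * t) * C) => s s0.
  rewrite (_ : expR (mu * s) = expR (mu * t) * expR (mu * (s - t))); last first.
    by rewrite -expRD; congr expR; ring.
  by rewrite -mulrA ler_wpM2l ?expR_ge0// xC// subr_le0 (le_trans s0).
- by move=> r r0; apply: solution_on_subset (ut r (le_trans r0 t0)).
Qed.

(** In the difference of two values of [Phi] the noise [z (theta t w)] cancels, so the tracking
    estimate applies with rate [mu]. *)
Lemma attracting_shifted_manifold tau w x : exists2 y, shifted_manifold tau w y &
  exists c1 c2 : R, [/\ 0 < c1, 0 < c2 & forall t, 0 <= t ->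
    `|Phi F z g t tau w x - Phi F z g t tau w y| <= c1 * expR (- c2 * t)].
Proof.
have hl := loc_integrable_shift tau gl; have cy : continuous (path w) := (zT w).1.
have [Cy yC] := tempered_past_bound zT w mu0.
have [v vS v0] := forward_solution_exists a_lt1 a_lt12 L0 FL F0 0 (x - z w) cy hl.
have [xi [v' [bxi txi v'S v'0 [C vC]]]] := tracking a_lt1 a_lt12 L0 FL F0 kP q1 mu0 mu_gt mu_lt
  hl (gI tau) cy yC vS.
exists (xi 0 + z w).
  by exists (xi 0) => //; apply/(MsetP a_lt1 a_lt12 L0 FL F0 zT gl); exists xi.
exists (`|C| + 1), mu; split=> [| |t t0]; [by rewrite ltr_wpDl|exact: mu0|].
have PE := PhiE a_lt1 a_lt12 L0 FL F0 zT gl t0.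
rewrite -{1}[x](subrK (z w)) -v0 -v'0 !PE// opprD addrACA subrr addr0 distrC.
rewrite (le_trans (vC t t0))// ler_wpM2r ?expR_ge0//.
by rewrite (le_trans (ler_norm _))// lerDl.
Qed.

Lemma inertial_manifold : random_inertial_manifold (@theta R H) (Phi F z g) shifted_manifold.
Proof.
split.
- exact: random_closed_shifted_manifold.
- exists (PnH n), [set x | PnX n x = 0], graph_map; split.
  + by split; [exact: finite_dim_PnH|exact: direct_sum_PnH].
  + by move=> tau w x xP; apply/PnX0P => j jn; rewrite cr_graph_map.
  + exact: shifted_manifold_graph.
  + move=> tau x xP; apply: (@borel_measurable_crX _ _ A) => // j.
    exact: measurable_graph_map.
  + move=> tau w; exists (1 - kmass k * L)^-1 => -[x y] /= [xP yP].
    exact: graph_map_lipschitz.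
- exact: invariant_shifted_manifold.
- exact: attracting_shifted_manifold.
Qed.

End inertial_graph.

Theorem theorem3p8 (R : realType) (H : hilbertType R)
    (A : spectral_operator H) (alpha : {nonneg R}) (Q : {linear H -> H})
    (P : probability (path_space H) R) (z : path_space H -> fracdom A alpha)
    (F : fracdom A alpha -> H) (g : R -> fracdom A alpha) (L k : R) (n : nat) :
  alpha%:num < 2^-1 ->
  trace_class_covariance Q ->
  wiener_measure P Q ->
  stationary_OU P z ->
  tempered_continuous z ->
  F 0 = 0 ->
  0 < L ->
  (forall u1 u2 : fracdom A alpha,
     `|F u1 - F u2| <= L * `|fpow A alpha%:num (u1 - u2)|) ->
  L2loc g ->
  (\int[@lebesgue_measure R]_(s in `]-oo, 0%R])
     (expR (eigval A 0%N * s) * `|fpow A alpha%:num (g s)|)%:E < +oo)%E ->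
  (0 < n)%N ->
  0 < k < 2^-1 ->
  (* lambda_n and lambda_(n+1), in the 1-based numbering *)
  let lam_n := eigval A n.-1 in
  let lam_n1 := eigval A n in
  lam_n1 - lam_n >= 2 * L / k *
    (lam_n1 `^ alpha%:num + lam_n `^ alpha%:num
     + c_alpha alpha%:num * (lam_n1 - lam_n) `^ alpha%:num) ->
  let mu := lam_n + 2 * L / k * lam_n `^ alpha%:num in
  exists Mt : R -> path_space H -> set (fracdom A alpha),
    random_inertial_manifold (@theta R H) (Phi F z g) Mt /\
    forall (tau : R) (w : path_space H),
      Mt tau w = [set x + z w + mmap F z g mu n tau w x | x in PnH n] /\
      Mt tau w = [set y + z w | y in Mset F z g mu tau w].
Proof.
move=> a_lt12 _ _ [mz _] zT F0 L_gt0 FL gL2 gI n0 /andP[k0 k_lt12] lam_n lam_n1 gap mu.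
have k_lt1 : k < 1 by rewrite (lt_trans k_lt12)// invf_lt1// ltr1n.
have a_lt1 : alpha%:num < 1 by rewrite (lt_trans a_lt12)// invf_lt1// ltr1n.
have lam_n_le_mu : lam_n <= mu.
  by rewrite lerDl mulr_ge0 ?powR_ge0// divr_ge0 ?mulr_ge0// ltW.
have mu0 : 0 < mu by apply: lt_le_trans lam_n_le_mu; exact: eigval_gt0.
have mu_gt j : (j < n)%N -> eigval A j <= mu.
  move=> jn; apply: le_trans lam_n_le_mu; apply: eigval_nondecreasing.
  by rewrite -ltnS prednK.
have mu_lt : mu < eigval A n := lyapunov_perron_mu_lt L_gt0 k0 gap.
have [kp [kP kL]] := lyapunov_perron_kernel a_lt1 L_gt0 k0 n0 gap.
have q1 : kmass kp * L < 1 := le_lt_trans kL k_lt1.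
have gl := L2loc_loc_integrable gL2.
have gIt tau := past_integrable_shift tau gl (le_trans (eigval_nondecreasing A (leq0n _)) lam_n_le_mu) gI.
exists (shifted_manifold F mu z g); split => [|tau w].
  exact: (inertial_manifold a_lt1 a_lt12 (ltW L_gt0) FL F0 kP q1 mu0 mu_gt mu_lt zT mz gl gIt).
split=> //.
exact: (shifted_manifoldE a_lt1 a_lt12 (ltW L_gt0) FL F0 kP q1 mu0 mu_gt mu_lt zT mz gl gIt).
Qed.
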